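(* Let $\{f(x|\theta,\Sigma)\}$ be the family of $d$-variate Gaussian densities with mean $\theta\in\Theta$ and covariance $\Sigma\in\Omega$, where $\Theta$ is a bounded subset of $\mathbb{R}^d$ and $\Omega$ is a subset of $S_d^{++}$ whose elements have largest eigenvalues bounded above. Let $k_0\ge1$, $k\ge k_0+1$, let $G_0\in\mathcal{E}_{k_0}(\Theta\times\Omega)$ be fixed with support points in the interior of $\Theta\times\Omega$, and let $\overline r=\overline r(k-k_0)$ be as defined in the context. (a) For any $1\le r<\overline r$, $$\lim_{\epsilon\to0}\ \inf_{G\in\mathcal{O}_k(\Theta\times\Omega)}\Big\{h(p_G,p_{G_0})/W_1^r(G,G_0):W_1(G,G_0)\le\epsilon\Big\}=0.$$ (b) For any $c_0>0$ let $$\mathcal{O}_{k,c_0}(\Theta\times\Omega)=\Big\{G=\sum_{i=1}^{k^*}p_i\delta_{(\theta_i,\Sigma_i)}\in\mathcal{O}_k(\Theta\times\Omega):p_i\ge c_0\ \forall\,1\le i\le k^*\Big\}.$$ Then there are $\epsilon_0>0$ and $C_0>0$ such that for all $G\in\mathcal{O}_{k,c_0}(\Theta\times\Omega)$ with $W_{\overline r}(G,G_0)\le\epsilon_0$, $$V(p_G,p_{G_0})\ge C_0W_{\overline r}^{\overline r}(G,G_0)\ge C_0W_1^{\overline r}(G,G_0).$$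
   Context: $S_d^{++}$: symmetric positive definite $d\times d$ matrices. Gaussian density: $f(x|\theta,\Sigma)=\frac{1}{(2\pi)^{d/2}|\Sigma|^{1/2}}\exp(-(x-\theta)^T\Sigma^{-1}(x-\theta)/2)$. $\mathcal{E}_k(\Theta\times\Omega)$ (resp. $\mathcal{O}_k(\Theta\times\Omega)$): discrete probability measures on $\Theta\times\Omega$ with exactly (resp. at most) $k$ distinct support points. For $G=\sum_ip_i\delta_{(\theta_i,\Sigma_i)}$, $p_G=\sum_ip_if(\cdot|\theta_i,\Sigma_i)$. $V(p,q)=\frac12\int|p-q|dx$, $h^2(p,q)=\frac12\int(\sqrt p-\sqrt q)^2dx$. $W_r(G,G')=\big(\inf_q\sum_{i,j}q_{ij}(\|\theta_i-\theta'_j\|+\|\Sigma_i-\Sigma'_j\|)^r\big)^{1/r}$, infimum over couplings $q$ of the weight vectors of $G,G'$; $\|\cdot\|$ is the Euclidean (entrywise $\ell_2$) norm. Ratios with denominator $W_1(G,G_0)=0$ are set to $\infty$. Definition of $\overline r$: for $k\ge k_0+1$, $\overline r$ is the minimum integer $r\ge1$ such that the system of polynomial equations $$\sum_{j=1}^{k-k_0+1}\ \sum_{\substack{n_1+2n_2=\alpha\\ n_1,n_2\ge0}}\frac{c_j^2a_j^{n_1}b_j^{n_2}}{n_1!\,n_2!}=0,\qquad\alpha=1,\dots,r,$$ has no non-trivial real solution $(c_j,a_j,b_j)_{j=1}^{k-k_0+1}$. A solution is non-trivial if all of $c_1,\dots,c_{k-k_0+1}$ differ from $0$ and at least one of $a_1,\dots,a_{k-k_0+1}$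 differs from $0$. *)

(* Defs.v *)
From mathcomp Require Import all_boot all_order all_algebra.
From mathcomp Require Import all_classical all_reals all_analysis.

Set Implicit Arguments.
Unset Strict Implicit.
Unset Printing Implicit Defensive.

Import Order.TTheory GRing.Theory Num.Theory.
Import numFieldNormedType.Exports.

Local Open Scope classical_set_scope.
Local Open Scope ring_scope.

(* [mx_norm], the library norm on matrices, is the sup norm. *)
Definition enorm (R : realType) (m n : nat) (A : 'M[R]_(m, n)) : R :=
  Num.sqrt (\sum_i \sum_j A i j ^+ 2).

Definition sym_mx (R : realType) (d : nat) : set 'M[R]_d :=
  [set A | A^T = A].

Definition spd_mx (R : realType) (d : nat) : set 'M[R]_d :=
  [set A | sym_mx A /\
    forall x : 'cV[R]_d, x != 0 -> 0 < (x^T *m A *m x) ord0 ord0].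

Definition eigenvalues_bounded_above (R : realType) (d : nat)
    (Omega : set 'M[R]_d) : Prop :=
  exists M : R, forall A, Omega A -> forall a : R, eigenvalue A a -> a <= M.

(* The ambient space is the product of R^d and the symmetric matrices: for
   1 < d, no set of symmetric matrices has interior points among all d x d
   matrices. *)
Definition interior_prod (R : realType) (d : nat)
    (Theta : set 'cV[R]_d) (Omega : set 'M[R]_d) : set ('cV[R]_d * 'M[R]_d) :=
  interior (Theta `*` Omega : set (subspace ([set: 'cV[R]_d] `*` @sym_mx R d))).

Definition gauss_density (R : realType) (d : nat)
    (theta : 'cV[R]_d) (Sigma : 'M[R]_d) (x : 'cV[R]_d) : R :=
  ((2 * pi) `^ (d%:R / 2) * Num.sqrt (\det Sigma))^-1 *
  expR (- ((x - theta)^T *m invmx Sigma *m (x - theta)) ord0 ord0 / 2).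

(* A finitely supported probability measure, given by its distinct support
   points (mean i, cov i) and their positive weights. *)
Record mixing (R : realType) (d : nat) := Mixing {
  natoms : nat;
  weight : 'I_natoms -> R;
  mean : 'I_natoms -> 'cV[R]_d;
  cov : 'I_natoms -> 'M[R]_d;
  weight_gt0 : forall i, 0 < weight i;
  weight_sum1 : \sum_i weight i = 1;
  atom_inj : injective (fun i => (mean i, cov i)) }.

Arguments weight {R d} _ _.
Arguments mean {R d} _ _.
Arguments cov {R d} _ _.

Definition atom (R : realType) (d : nat) (G : mixing R d) (i : 'I_(natoms G)) :
  'cV[R]_d * 'M[R]_d := (mean G i, cov G i).

Arguments atom {R d} G i.

Definition supported_in (R : realType) (d : nat)
    (Theta : set 'cV[R]_d) (Omega : set 'M[R]_d) (G : mixing R d) : Prop :=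
  forall i, (Theta `*` Omega) (atom G i).

Definition mix_exact (R : realType) (d k : nat)
    (Theta : set 'cV[R]_d) (Omega : set 'M[R]_d) : set (mixing R d) :=
  [set G | natoms G = k /\ supported_in Theta Omega G].

Definition mix_atmost (R : realType) (d k : nat)
    (Theta : set 'cV[R]_d) (Omega : set 'M[R]_d) : set (mixing R d) :=
  [set G | (natoms G <= k)%N /\ supported_in Theta Omega G].

Definition mix_atmost_lb (R : realType) (d k : nat) (c0 : R)
    (Theta : set 'cV[R]_d) (Omega : set 'M[R]_d) : set (mixing R d) :=
  [set G | mix_atmost k Theta Omega G /\ forall i, c0 <= weight G i].

Definition mix_density (R : realType) (d : nat) (G : mixing R d)
    (x : 'cV[R]_d) : R :=
  \sum_i weight G i * gauss_density (mean G i) (cov G i) x.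

Definition tcons (R : realType) (d : nat)
    (p : d.-tuple (measurableTypeR R) * measurableTypeR R) :
    d.+1.-tuple (measurableTypeR R) := [tuple of p.2 :: p.1].

Lemma measurable_tcons (R : realType) (d : nat) :
  measurable_fun setT (@tcons R d).
Proof. exact: (measurable_cons measurable_snd measurable_fst). Qed.

(* Lebesgue measure on R^d, as the d-fold product of the one on R; the name
   below is the measure structure of [pushforward], which takes the
   measurability proof as an argument. *)
Fixpoint lebesgue_tuple (R : realType) (d : nat) :
    {measure set (d.-tuple (measurableTypeR R)) -> \bar R} :=
  match d with
  | 0 => \d_([tuple] : 0.-tuple (measurableTypeR R))
  | d'.+1 =>
      measure_function_pushforward__canonical__measure_function_Measure
        (lebesgue_tuple R d' \x @lebesgue_measure R)%E
        (@measurable_tcons R d')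
  end.

Definition tvdist (R : realType) (d : nat) (p q : 'cV[R]_d -> R) : R :=
  2^-1 * \int[lebesgue_tuple R d]_t
    `|p (\col_i tnth t i) - q (\col_i tnth t i)|.

Definition hellinger (R : realType) (d : nat) (p q : 'cV[R]_d -> R) : R :=
  Num.sqrt (2^-1 * \int[lebesgue_tuple R d]_t
    (Num.sqrt (p (\col_i tnth t i)) - Num.sqrt (q (\col_i tnth t i))) ^+ 2).

Definition coupling (R : realType) (d : nat) (G G' : mixing R d) :
    set 'M[R]_(natoms G, natoms G') :=
  [set q | [/\ forall i j, 0 <= q i j,
      forall i, \sum_j q i j = weight G i &
      forall j, \sum_i q i j = weight G' j]].

Arguments coupling {R d} G G' _.

Definition transport_cost (R : realType) (d : nat) (r : R) (G G' : mixing R d)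
    (q : 'M[R]_(natoms G, natoms G')) : R :=
  \sum_i \sum_j q i j *
    (enorm (mean G i - mean G' j) + enorm (cov G i - cov G' j)) `^ r.

Definition wasserstein (R : realType) (d : nat) (r : R) (G G' : mixing R d) : R :=
  inf (@transport_cost R d r G G' @` coupling G G') `^ r^-1.

Definition hellinger_ratio (R : realType) (d : nat) (r : R) (G G0 : mixing R d) :
    \bar R :=
  if wasserstein 1 G G0 == 0 then +oo%E
  else (hellinger (mix_density G) (mix_density G0) /
        wasserstein 1 G G0 `^ r)%:E.

Definition rbar_poly (R : realType) (m alpha : nat) (c a b : 'I_m -> R) : R :=
  \sum_j \sum_(n1 < alpha.+1) \sum_(n2 < alpha.+1 | (n1 + 2 * n2 == alpha)%N)
    c j ^+ 2 * a j ^+ n1 * b j ^+ n2 / (n1`! * n2`!)%:R.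

Definition has_nontrivial_solution (R : realType) (m r : nat) : Prop :=
  exists c a b : 'I_m -> R,
    [/\ forall alpha, (1 <= alpha <= r)%N -> rbar_poly alpha c a b = 0,
        forall j, c j != 0 & exists j, a j != 0].

(* [r] is the number rbar(n) attached to n = k - k0 extra atoms. *)
Definition is_rbar (R : realType) (n r : nat) : Prop :=
  [/\ (1 <= r)%N, ~ has_nontrivial_solution R n.+1 r &
      forall s, (1 <= s)%N -> ~ has_nontrivial_solution R n.+1 s -> (r <= s)%N].

(* Main.v *)
(* Write a Gaussian density at a fixed point as a function of mean and
   variance: in dimension one it solves the heat equation, so along a path
   (tau + a t, v + 2 b t^2) the coefficient of t^m in its Taylor expansion is
   the m-th derivative in the mean times the polynomial
   sum_{n1 + 2 n2 = m} a^n1 b^n2 / (n1! n2!) of the system defining rbar.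
   Part (b): integrating against exp (- (u.x - c)^2 / 2) bounds the total
   variation from below by the difference of one-dimensional mixtures of means
   u.theta and variances u.Sigma.u + 1.  Small Wasserstein distance and weights
   at least c0 force every atom of G to be close to an atom of G0, and every
   atom of G0 to be approached by at most k - k0 + 1 atoms of G; the derivatives
   of the kernels at the distinct atoms of G0 are linearly independent, so
   finitely many values of c detect the Taylor coefficients, and by compactness
   those of order at most rbar cannot vanish together.  Finitely many directions
   u on the curve u_i = z^(2^i) recover the d-dimensional parameters.
   Part (a): replace one atom (theta, S) of G0 by k - k0 + 1 atoms moved along
   S u, by a_j t in the mean and 2 b_j t^2 in the covariance, where (c, a, b)
   solves the system up to order rbar - 1.  Then W_1 is of order t, whereas the
   chi-square distance to G0, hence h^2, is O(t^(2 rbar)). *)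
From HB Require Import structures.
Require Import Defs.
From mathcomp Require Import all_boot all_order all_algebra.
From mathcomp Require Import all_classical all_reals all_analysis.
From mathcomp Require Import measurable_realfun.
From mathcomp Require Import ring lra zify.

Set Implicit Arguments.
Unset Strict Implicit.
Unset Printing Implicit Defensive.

Import Order.TTheory GRing.Theory Num.Theory.
Import numFieldNormedType.Exports.

Local Open Scope classical_set_scope.
Local Open Scope ring_scope.

(** * Lebesgue measure on tuples *)

(** The obstacle in (b) is that [has_nontrivial_solution] asks only for some [a j != 0], so the
    compactness argument must also exclude [a = 0] with [b != 0]. In that case the order-4 equation
    is a positive combination of the [b j ^+ 2], so it suffices that [4 <= rbar], which
    [is_rbar_ge4] gets from an explicit solution of the first three equations. Groups of atoms
    shrink at different speeds, so each is rescaled by its own parabolic radius, in which a mean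
    shift counts with order one and a variance shift with order two. Rescaled groups lie in a
    compact set away from 0, and the Taylor remainder, one order higher, is absorbed once the radii
    are small. The unit variance added by the test function keeps the kernels and their derivatives
    uniformly bounded near the projected atoms. In (a), [u] is normalized by [quad S u = 1] and the
    atoms move along [S *m u], so that densities change only through the scalar
    [dotv u (x - theta)], which is standard normal under the atom. The comparison becomes
    one-dimensional, provided that the Taylor remainder keeps enough Gaussian decay for the
    chi-square integral to converge. *)

Definition tuncons (R : realType) (d : nat) (t : d.+1.-tuple (measurableTypeR R)) :
    d.-tuple (measurableTypeR R) * measurableTypeR R :=
  ([tuple of behead t], thead t).

Lemma tunconsK (R : realType) (d : nat) : cancel (@tcons R d) (@tuncons R d).
Proof. by move=> [t x]; congr (_, _); apply/val_inj. Qed.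

Lemma measurable_tuncons (R : realType) (d : nat) :
  measurable_fun setT (@tuncons R d).
Proof.
apply: measurable_fun_pair; last exact: measurable_tnth.
apply/measurable_fun_tnthP => i /=.
rewrite (_ : _ \o _ = fun t => tnth t (lift ord0 i)); first exact: measurable_tnth.
by apply/funext => t /=; rewrite !(tnth_nth 0) /= nth_behead.
Qed.

(* [fubini_tonelli] takes sigma-finiteness from a structure instance, and
   [lebesgue_tuple] has none. *)
Section sigma_finite_alias.
Context (R : realType) (disp : measure_display) (T : measurableType disp)
  (mu : {measure set T -> \bar R}).

Definition with_sigma_finite (h : sigma_finite setT mu) : set T -> \bar R := mu.

Context (h : sigma_finite setT mu).
HB.instance Definition _ := Measure.on (with_sigma_finite h).
HB.instance Definition _ :=
  Measure_isSigmaFinite.Build _ _ _ (with_sigma_finite h) h.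

End sigma_finite_alias.

(** Needed for Tonelli's theorem, which peels off one coordinate at a time. Both exhaustions are
    nondecreasing, so the diagonal rectangles built from [F n] and [H n] already cover the
    product. *)
Lemma sigma_finite_lebesgue_tuple (R : realType) (d : nat) :
  sigma_finite setT (lebesgue_tuple R d).
Proof.
elim: d => [|d IH].
  exists (fun=> setT); first by rewrite bigcup_const//; exists 0%N.
  by move=> _; split => //=; rewrite diracE ltry.
have /sigma_finiteP[F [FT ndF Foo]] := IH.
have /sigma_finiteP[H [HT ndH Hoo]] := sigma_finiteT (@lebesgue_measure R).
exists (fun n => @tuncons R d @^-1` (F n `*` H n)).
  rewrite -preimage_bigcup -[LHS](preimage_setT (@tuncons R d)); congr (_ @^-1` _).
  apply/seteqP; split=> // -[t x] _.
  have [[n _ Fnt] [k _ Hkx]] : (\bigcup_i F i) t /\ (\bigcup_i H i) x.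
    by rewrite -FT -HT.
  exists (maxn n k) => //; split.
    by move: t Fnt; exact/subsetPset/ndF/leq_maxl.
  by move: x Hkx; exact/subsetPset/ndH/leq_maxr.
move=> n; have [mF Fn] := Foo n; have [mH Hn] := Hoo n; split.
  rewrite -[X in measurable X]setTI; apply: measurable_tuncons => //.
  exact: measurableX.
rewrite /= /pushforward -comp_preimage (_ : _ \o _ = id); last first.
  by apply/funext => x /=; rewrite tunconsK.
rewrite -[X in (X < _)%E]/((with_sigma_finite IH \x @lebesgue_measure R)%E (F n `*` H n)).
by rewrite product_measure1E// lte_mul_pinfty// ge0_fin_numE.
Qed.

Lemma lebesgue_tuple_tonelli (R : realType) (d : nat)
    (f : d.+1.-tuple (measurableTypeR R) -> \bar R) :
  measurable_fun setT f -> (forall t, (0 <= f t)%E) ->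
  (\int[lebesgue_tuple R d.+1]_t f t =
   \int[lebesgue_tuple R d]_t \int[lebesgue_measure]_x f (tcons (t, x)))%E.
Proof.
move=> mf f0.
rewrite /= (ge0_integral_pushforward (@measurable_tcons R d))//= preimage_setT.
pose mu := with_sigma_finite (@sigma_finite_lebesgue_tuple R d).
rewrite -[LHS]/(\int[mu \x @lebesgue_measure R]_x (f \o @tcons R d) x)%E.
rewrite fubini_tonelli1//=.
by apply: measurableT_comp => //; exact: measurable_tcons.
Qed.

(** * Gaussian integrals *)

Definition quad (R : realType) (d : nat) (A : 'M[R]_d) (y : 'cV[R]_d) : R :=
  (y^T *m A *m y) ord0 ord0.

Definition tcol (R : realType) (d : nat) (t : d.-tuple (measurableTypeR R)) : 'cV[R]_d :=
  \col_i tnth t i.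

Lemma quadE (R : realType) (d : nat) (A : 'M[R]_d) (y : 'cV[R]_d) :
  quad A y = \sum_j (\sum_i y i ord0 * A i j) * y j ord0.
Proof.
rewrite /quad mxE; apply: eq_bigr => j _; congr (_ * _).
by rewrite mxE; apply: eq_bigr => i _; rewrite mxE.
Qed.

Lemma tcol_tcons (R : realType) (d : nat) (t : d.-tuple (measurableTypeR R)) (x : R) :
  tcol (tcons (t, x)) = col_mx x%:M (tcol t) :> 'cV[R]_(1 + d).
Proof.
apply/colP => i; rewrite mxE.
case: (splitP i) => j ij.
  have -> : i = lshift d j by exact: val_inj.
  by rewrite col_mxEu ord1 mxE eqxx mulr1n (tnth_nth 0).
have -> : i = rshift 1 j by exact: val_inj.
by rewrite col_mxEd mxE !(tnth_nth 0).
Qed.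

Lemma measurable_quad (R : realType) (d : nat) (A : 'M[R]_d) (m : 'cV[R]_d) :
  measurable_fun setT (fun t : d.-tuple (measurableTypeR R) => quad A (tcol t - m)).
Proof.
have mc i : measurable_fun setT
    (fun t : d.-tuple (measurableTypeR R) => (tcol t - m) i ord0 : R).
  under eq_fun do rewrite !mxE.
  by apply: measurable_funB => //; exact: measurable_tnth.
under eq_fun do rewrite quadE.
apply: measurable_sum => j; apply: measurable_funM => //.
by apply: measurable_sum => i; apply: measurable_funM.
Qed.

Lemma measurable_expquad (R : realType) (d : nat) (A : 'M[R]_d) (m : 'cV[R]_d) :
  measurable_fun setT
    (fun t : d.-tuple (measurableTypeR R) => expR (- quad A (tcol t - m) / 2)).
Proof.
apply: measurableT_comp => //; apply: measurable_funM => //.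
by apply: measurableT_comp => //; exact: measurable_quad.
Qed.

Lemma integral_expsqr (R : realType) (a m : R) : 0 < a ->
  (\int[lebesgue_measure]_x (expR (- (a * (x - m) ^+ 2) / 2))%:E)%E
    = (Num.sqrt (2 * pi) / Num.sqrt a)%:E.
Proof.
move=> a0; have sa0 : 0 < Num.sqrt a by rewrite sqrtr_gt0.
have s0 : (Num.sqrt a)^-1 != 0 by rewrite invr_eq0 gt_eqF.
have p0 : 0 < normal_peak (Num.sqrt a)^-1 by rewrite normal_peak_gt0.
have e x : expR (- (a * (x - m) ^+ 2) / 2) =
    (normal_peak (Num.sqrt a)^-1)^-1 * normal_pdf m (Num.sqrt a)^-1 x.
  rewrite normal_pdfE// mulrA mulVf ?gt_eqF// mul1r /normal_fun; congr expR.
  by rewrite exprVn sqr_sqrtr ?ltW// -mulr_natr; field; rewrite gt_eqF.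
under eq_integral do rewrite e EFinM.
rewrite ge0_integralZl//=; last 3 first.
- by apply/measurable_EFinP; exact: measurable_normal_pdf.
- by move=> x _; rewrite lee_fin normal_pdf_ge0.
- by rewrite lee_fin invr_ge0 ltW.
rewrite integral_normal_pdf mule1 /normal_peak invrK; congr EFin.
rewrite exprVn sqr_sqrtr ?ltW// -sqrtrV ?ltW// -sqrtrM ?mulr_ge0 ?pi_ge0//.
by congr Num.sqrt; rewrite -mulr_natr; ring.
Qed.

Section schur.
Context (R : realType) (d : nat) (A : 'M[R]_(1 + d)).
Hypothesis spdA : spd_mx A.

Let a := A ord0 ord0.
Let b : 'rV[R]_d := ursubmx A.
Definition schur_compl : 'M[R]_d := drsubmx A - a^-1 *: (b^T *m b).

Lemma schur_blockE : A = block_mx a%:M b b^T (drsubmx A).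
Proof.
have [sA _] := spdA; rewrite -{1}[A]submxK; congr block_mx.
  by apply/matrixP => i j; rewrite !ord1 !mxE /a lshift0 mulr1n.
by rewrite /b -[in LHS]sA trmx_ursub.
Qed.

(** Completing the square in the first coordinate; it lets a Gaussian integral be evaluated one
    coordinate at a time. *)
Lemma schur_quad (x : R) (y : 'cV[R]_d) : a != 0 ->
  quad A (col_mx x%:M y) =
    a * (x + (b *m y) ord0 ord0 / a) ^+ 2 + quad schur_compl y.
Proof.
move=> a0; set z := (b *m y) ord0 ord0.
have zE : b *m y = z%:M.
  by apply/matrixP => i j; rewrite !ord1 [RHS]mxE eqxx mulr1n.
have zE' : y^T *m b^T = z%:M by rewrite -trmx_mul zE tr_scalar_mx.
rewrite /quad {1}schur_blockE tr_col_mx tr_scalar_mx.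
rewrite /schur_compl -/a -/b mul_row_block mul_row_col !mulmxDl -!mulmxA zE.
rewrite mulmxBl mulmxBr.
have -> : y^T *m (a^-1 *: (b^T *m b) *m y) = (a^-1 * (z * z))%:M.
  by rewrite -scalemxAl -scalemxAr -(mulmxA b^T) (mulmxA y^T) zE' zE -scalar_mxM scale_scalar_mx.
rewrite (mulmxA y^T b^T) zE' -!scalar_mxM [in LHS]mxE [X in _ = _ + X]mxE !mxE eqxx !mulr1n.
by field.
Qed.

Lemma spd_diag_gt0 : 0 < a.
Proof.
have [_ pA] := spdA.
have := pA (col_mx 1 0); rewrite -/(quad _ _).
have -> : quad A (col_mx 1 0) = a.
  rewrite /quad schur_blockE tr_col_mx trmx1 trmx0 mul_row_block mul_row_col.
  by rewrite !mul1mx !mul0mx !mulmx0 mulmx1 !addr0 !mxE eqxx mulr1n.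
apply; apply/eqP => /(congr1 usubmx); rewrite col_mxKu => /matrixP/(_ ord0 ord0).
by rewrite !mxE => /eqP; rewrite oner_eq0.
Qed.

(** Substituting for [x] the value that kills the square in [schur_quad] leaves only the
    complement. *)
Lemma spd_schur : spd_mx schur_compl.
Proof.
have [sA pA] := spdA; split.
  rewrite /sym_mx /= /schur_compl linearB /= linearZ /= trmx_mul trmxK trmx_drsub.
  by rewrite sA.
move=> y y0.
have a0 := spd_diag_gt0.
have := pA (col_mx (- ((b *m y) ord0 ord0 / a))%:M y).
rewrite -/(quad _ _) schur_quad ?gt_eqF// addNr expr0n /= mulr0 add0r; apply.
by apply: contra y0 => /eqP/(congr1 dsubmx); rewrite col_mxKd linear0 => ->.
Qed.

Lemma det_schur : \det A = a * \det schur_compl.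
Proof.
have a0 := spd_diag_gt0.
have : A *m block_mx 1%:M (- (a^-1 *: b)) 0 1%:M = block_mx a%:M 0 b^T schur_compl.
  rewrite [X in X *m _]schur_blockE mulmx_block !mulmx1 !mulmx0 !addr0.
  congr block_mx.
    by rewrite mulmxN -scalemxAr mul_scalar_mx scalerA mulVf ?gt_eqF// scale1r addNr.
  by rewrite mulmxN -scalemxAr addrC.
move=> /(congr1 determinant); rewrite det_mulmx det_ublock det_lblock !det1 !mulr1.
by rewrite det_scalar1.
Qed.

End schur.

Lemma spd_det_gt0 (R : realType) (d : nat) (A : 'M[R]_d) : spd_mx A -> 0 < \det A.
Proof.
elim: d A => [|d IH] A spdA; first by rewrite det_mx00.
rewrite (det_schur spdA) mulr_gt0//; first exact: spd_diag_gt0 spdA.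
exact: IH (spd_schur spdA).
Qed.

(** Induction on the dimension: the inner integral over the first coordinate is a shifted
    one-dimensional Gaussian whose value [K] does not depend on the other coordinates, and what
    remains is the Gaussian of the Schur complement. *)
Lemma integral_expquad (R : realType) (d : nat) (A : 'M[R]_d) (m : 'cV[R]_d) :
  spd_mx A ->
  (\int[lebesgue_tuple R d]_t (expR (- quad A (tcol t - m) / 2))%:E
    = ((2 * pi) `^ (d%:R / 2) / Num.sqrt (\det A))%:E)%E.
Proof.
elim: d A m => [|d IH] A m spdA.
  rewrite [lebesgue_tuple R 0]/= integral_dirac//; last first.
    by apply/measurable_EFinP; exact: measurable_expquad.
  rewrite ?diracT ?mul1e det_mx00 sqrtr1 mul0r powRr0 invr1 mulr1.
  by rewrite quadE big_ord0 oppr0 mul0r expR0.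
have a0 := spd_diag_gt0 spdA; set a := A ord0 ord0 in a0.
pose m1 := (m : 'cV_(1 + d)) ord0 ord0.
pose m' : 'cV[R]_d := dsubmx (m : 'cV_(1 + d)).
pose b : 'rV[R]_d := ursubmx (A : 'M[R]_(1 + d)).
rewrite lebesgue_tuple_tonelli; last 2 first.
- by apply/measurable_EFinP; exact: measurable_expquad.
- by move=> t; rewrite lee_fin expR_ge0.
have e t x : quad A (tcol (tcons (t, x)) - m) =
    a * (x - (m1 - (b *m (tcol t - m')) ord0 ord0 / a)) ^+ 2 +
    quad (schur_compl A) (tcol t - m').
  have -> : tcol (tcons (t, x)) - m = col_mx (x - m1)%:M (tcol t - m') :> 'cV_(1 + d).
    have mE : m = col_mx m1%:M m' :> 'cV_(1 + d).
      rewrite -[LHS](@vsubmxK _ 1 d); congr col_mx.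
      by apply/matrixP => i j; rewrite !ord1 !mxE /m1 lshift0 mulr1n.
    transitivity (col_mx x%:M (tcol t) - col_mx m1%:M m' : 'cV_(1 + d)).
      by rewrite -mE -tcol_tcons.
    by rewrite opp_col_mx add_col_mx -raddfB.
  rewrite schur_quad ?gt_eqF//; congr (_ * _ ^+ 2 + _).
  by rewrite -/a -/b; ring.
pose K := Num.sqrt (2 * pi) / Num.sqrt a.
have inner t : (\int[lebesgue_measure]_x (expR (- quad A (tcol (tcons (t, x)) - m) / 2))%:E =
    K%:E * (expR (- quad (schur_compl A) (tcol t - m') / 2))%:E)%E.
  under eq_integral => x _ do rewrite e opprD mulrDl expRD EFinM muleC.
  rewrite ge0_integralZl//=.
  - by rewrite integral_expsqr// muleC.
  - apply/measurable_EFinP; apply: measurableT_comp => //; apply: measurable_funM => //.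
    apply: measurableT_comp => //; apply: measurable_funM => //.
    by apply: measurable_funX; apply: measurable_funB.
have K0 : 0 <= K by rewrite divr_ge0 ?sqrtr_ge0.
under eq_integral do rewrite inner.
rewrite ge0_integralZl//=; last by apply/measurable_EFinP; exact: measurable_expquad.
rewrite IH; last exact: spd_schur spdA.
rewrite (det_schur spdA) -/a -EFinM; congr EFin.
have -> : d.+1%:R / 2 = 2^-1 + d%:R / 2 :> R by rewrite -natr1; ring.
rewrite powRD; last first.
  by apply/implyP => _; rewrite gt_eqF// mulr_gt0 ?pi_gt0.
rewrite sqrtrM ?ltW// powR12_sqrt ?mulr_ge0 ?pi_ge0// /K invfM.
by ring.
Qed.

(** * Rank-one changes of the covariance *)

(** For [q > 0] this is [q^(n/2) He_n (z sqrt q)], with [He_n] the probabilists' Hermite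
    polynomials. The ring is arbitrary so that [z] may also be a polynomial. *)
Fixpoint herm (A : pzRingType) (n : nat) (z q : A) : A :=
  match n with
  | 0 => 1
  | n1.+1 => match n1 with
    | 0 => z * q
    | n2.+1 => z * q * herm n1 z q - n1%:R * q * herm n2 z q
    end
  end.

(* The [n]-th derivative in [tau] of [sqrt (2 pi)] times the density at [c] of
   the normal law with mean [tau] and variance [v]. *)
Definition gker (R : realType) (n : nat) (tau v c : R) : R :=
  herm n (c - tau) v^-1 * expR (- (c - tau) ^+ 2 / (2 * v) - ln v / 2).

Definition dotv (R : realType) (d : nat) (u y : 'cV[R]_d) : R :=
  (u^T *m y) ord0 ord0.

Section dotv.
Context (R : realType) (d : nat).
Implicit Types (u y w : 'cV[R]_d) (A : 'M[R]_d).

Lemma dotvE u y : dotv u y = \sum_i u i ord0 * y i ord0.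
Proof. by rewrite /dotv mxE; apply: eq_bigr => i _; rewrite mxE. Qed.

Lemma dotvC u y : dotv u y = dotv y u.
Proof. by rewrite !dotvE; apply: eq_bigr => i _; rewrite mulrC. Qed.

Lemma dotvDr u y w : dotv u (y + w) = dotv u y + dotv u w.
Proof. by rewrite /dotv mulmxDr mxE. Qed.

Lemma dotvZr u a w : dotv u (a *: w) = a * dotv u w.
Proof. by rewrite /dotv -scalemxAr mxE. Qed.

Lemma dotvBr u y w : dotv u (y - w) = dotv u y - dotv u w.
Proof. by rewrite -scaleN1r dotvDr dotvZr mulN1r. Qed.

Lemma dotv_quad A y : quad A y = dotv y (A *m y).
Proof. by rewrite /quad /dotv mulmxA. Qed.

Lemma dotv_trmx u A y : dotv u (A *m y) = dotv (A^T *m u) y.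
Proof. by rewrite /dotv mulmxA trmx_mul trmxK. Qed.

Lemma mulmx_outer u w y : (u *m w^T) *m y = dotv w y *: u.
Proof.
rewrite -mulmxA; have -> : w^T *m y = (dotv w y)%:M.
  by apply/matrixP => i j; rewrite !ord1 [RHS]mxE eqxx mulr1n.
by rewrite mul_mx_scalar.
Qed.

Lemma quad_outer A a u y : quad (A + a *: (u *m u^T)) y = quad A y + a * dotv u y ^+ 2.
Proof.
rewrite !dotv_quad mulmxDl -scalemxAl mulmx_outer dotvDr !dotvZr (dotvC y u).
by rewrite expr2.
Qed.

Lemma quadZ A a y : quad A (a *: y) = a ^+ 2 * quad A y.
Proof.
by rewrite !dotv_quad -scalemxAr dotvZr dotvC dotvZr dotvC mulrA expr2.
Qed.

Lemma quadB A y w : A^T = A ->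
  quad A (y - w) = quad A y - 2 * dotv w (A *m y) + quad A w.
Proof.
move=> sA; rewrite !dotv_quad mulmxBr dotvBr !(dotvC (y - w)) !dotvBr.
have -> : dotv (A *m w) y = dotv w (A *m y) by rewrite dotv_trmx sA.
by rewrite !(dotvC (A *m _)); ring.
Qed.

End dotv.

(** Two block triangular factorizations of the same bordered matrix are compared. *)
Lemma det_1_outer (R : realType) (d : nat) (u w : 'cV[R]_d) :
  \det (1%:M + u *m w^T) = 1 + dotv w u.
Proof.
pose B : 'M[R]_(1 + d) := block_mx 1%:M (- w^T) u 1%:M.
have B1 : B = block_mx 1%:M 0 u 1%:M *m block_mx 1%:M (- w^T) 0 (1%:M + u *m w^T).
  rewrite mulmx_block ?mul1mx ?mul0mx ?mulmx0 ?mulmx1 ?addr0 ?add0r.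
  by rewrite mulmxN addrC addrK.
have B2 : B = block_mx (1%:M + w^T *m u) (- w^T) 0 1%:M *m block_mx 1%:M 0 u 1%:M.
  rewrite mulmx_block ?mul1mx ?mul0mx ?mulmx0 ?mulmx1 ?addr0 ?add0r.
  by rewrite mulNmx addrK.
have := congr1 determinant B1; rewrite B2 !det_mulmx !det_ublock !det_lblock.
rewrite !det1 !mul1r !mulr1 => <-; rewrite det_mx11 !mxE eqxx mulr1n; congr (_ + _).
by rewrite dotvE; apply: eq_bigr => i _; rewrite mxE.
Qed.

Section rank_one.
Context (R : realType) (d : nat) (S : 'M[R]_d) (u : 'cV[R]_d).
Hypotheses (spdS : spd_mx S) (u1 : quad S u = 1).

Let w := S *m u.

Lemma spd_unitmx : S \in unitmx.
Proof. by rewrite unitmxE unitfE gt_eqF// spd_det_gt0. Qed.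

Lemma spd_invmx : spd_mx (invmx S).
Proof.
have uS := spd_unitmx; have [sS pS] := spdS; split.
  by rewrite /sym_mx /= trmx_inv sS.
move=> y y0; rewrite -/(quad _ _).
have := pS (invmx S *m y); rewrite -!/(quad _ _).
rewrite !dotv_quad mulmxA mulmxV// mul1mx dotvC; apply.
by apply: contra y0 => /eqP/(congr1 (mulmx S)); rewrite mulmxA mulmxV// mul1mx mulmx0 => ->.
Qed.

Let dotwu : dotv w u = 1.
Proof. by rewrite dotvC -dotv_quad. Qed.

(** Cauchy-Schwarz for the inner product of [S] against the unit vector [u]. It keeps a rank-one
    update with negative [s > -1] positive definite. *)
Lemma spd_cauchy y : dotv w y ^+ 2 <= quad S y.
Proof.
have [sS pS] := spdS.
set c := dotv w y.
have h : quad S (y - c *: u) = quad S y - c ^+ 2.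
  rewrite quadB// quadZ u1 mulr1.
  have -> : dotv (c *: u) (S *m y) = c ^+ 2.
    by rewrite dotvC dotvZr dotvC dotv_trmx sS -/w -/c expr2.
  by ring.
have : 0 <= quad S (y - c *: u).
  have [->|/pS/ltW//] := eqVneq (y - c *: u) 0.
  by rewrite dotv_quad mulmx0 dotvE big1// => i _; rewrite mxE mul0r.
by rewrite h subr_ge0.
Qed.

(** The update goes along [S *m u] instead of [u]: the inverse then changes along [u], and the
    density feels the change only through [dotv u (x - th)]. *)
Definition rank_one_upd s : 'M[R]_d := S + s *: (w *m w^T).

Lemma spd_rank_one s : -1 < s -> spd_mx (rank_one_upd s).
Proof.
move=> s1; have [sS pS] := spdS; split.
  rewrite /sym_mx /= /rank_one_upd linearD linearZ /= trmx_mul trmxK.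
  by rewrite sS.
move=> y y0; rewrite -/(quad _ _) quad_outer.
have Sy := pS _ y0; rewrite -/(quad _ _) in Sy.
have [s0|s0] := leP 0 s.
  by rewrite ltr_pwDl// mulr_ge0// sqr_ge0.
have := spd_cauchy y; set t := _ ^+ 2; set q := quad S y in Sy *.
by nra.
Qed.

(** Sherman-Morrison; the denominator is [1 + s] because [dotv w u = quad S u = 1]. *)
Lemma invmx_rank_one s : -1 < s ->
  invmx (rank_one_upd s) = invmx S - (s / (1 + s)) *: (u *m u^T).
Proof.
move=> s1; have uS := spd_unitmx; have [sS _] := spdS.
have s10 : 1 + s != 0 by rewrite gt_eqF//; lra.
set t := s / (1 + s); set B := _ - _.
have h : rank_one_upd s *m B = 1%:M.
  rewrite /rank_one_upd /B mulmxDl !mulmxBr mulmxV//.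
  rewrite -!scalemxAr -!scalemxAl (mulmxA S u) -/w.
  have -> : w *m w^T *m invmx S = w *m u^T.
    by rewrite -mulmxA; congr (_ *m _); rewrite /w trmx_mul sS -mulmxA mulmxV ?mulmx1.
  have -> : w *m w^T *m (u *m u^T) = w *m u^T.
    by rewrite mulmxA mulmx_outer dotwu scale1r.
  rewrite scalerA -addrA -[RHS]addr0; congr (_ + _).
  transitivity ((- t + (s - t * s)) *: (w *m u^T)).
    by rewrite scalerDl scalerBl scaleNr.
  by rewrite (_ : _ + _ = 0) ?scale0r// /t; field.
have uR : rank_one_upd s \in unitmx by case: (mulmx1_unit h).
by rewrite -[LHS]mulmx1 -h mulmxA mulVmx// mul1mx.
Qed.

Lemma det_rank_one s : \det (rank_one_upd s) = \det S * (1 + s).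
Proof.
have -> : rank_one_upd s = S *m (1%:M + u *m (s *: w)^T).
  by rewrite mulmxDr mulmx1 mulmxA -/w linearZ /= -scalemxAr.
by rewrite det_mulmx det_1_outer dotvC dotvZr dotvC dotwu mulr1.
Qed.

(** Under the density with parameters [th] and [S], the variable [dotv u (x - th)] is standard
    normal. The last factor is the ratio, at that variable, of the normal density with mean [tau]
    and variance [1 + s] to the standard one. Both parts of the theorem are reduced to dimension one
    through this identity. *)
Lemma gauss_density_rank_one (th : 'cV[R]_d) (tau s : R) x : -1 < s ->
  gauss_density (th + tau *: w) (rank_one_upd s) x =
  gauss_density th S x *
    (expR (dotv u (x - th) ^+ 2 / 2) * gker 0 tau (1 + s) (dotv u (x - th))).
Proof.
move=> s1; have s10 : 0 < 1 + s by lra.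
have uS := spd_unitmx; have [sS _] := spdS.
rewrite /gauss_density -!/(quad _ _) det_rank_one invmx_rank_one//.
set y := x - th; have -> : x - (th + tau *: w) = y - tau *: w by rewrite opprD addrA.
have iSw : invmx S *m w = u by rewrite /w mulmxA mulVmx ?mul1mx.
have sSi : (invmx S)^T = invmx S by rewrite trmx_inv sS.
set l := dotv u y.
have -> : quad (invmx S - (s / (1 + s)) *: (u *m u^T)) (y - tau *: w) =
    quad (invmx S) y - l ^+ 2 + (l - tau) ^+ 2 / (1 + s).
  rewrite -scaleNr quad_outer quadB// quadZ dotvBr dotvZr (dotvC u w) dotwu mulr1.
  rewrite (dotv_quad _ w) iSw dotwu.
  rewrite [in dotv (_ *: _) _]dotvC dotvZr dotvC dotv_trmx sSi iSw -/l.
  by field; rewrite gt_eqF.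
have dS := spd_det_gt0 spdS.
rewrite /gker /= mul1r sqrtrM ?ltW//.
have -> : Num.sqrt (1 + s) = expR (ln (1 + s) / 2).
  apply/eqP; rewrite -(@eqrXn2 _ 2) ?expR_ge0 ?sqrtr_ge0// sqr_sqrtr ?ltW//.
  by rewrite -expRM_natr divfK ?lnK.
rewrite !invfM -expRN -!mulrA; congr (_ * (_ * _)).
rewrite -!expRD; congr expR.
by field; rewrite gt_eqF.
Qed.

End rank_one.

(** * Testing a mixture against one-dimensional Gaussians *)

Section gauss_integral.
Context (R : realType) (d : nat).
Implicit Types (S : 'M[R]_d) (th u : 'cV[R]_d) (p q f : 'cV[R]_d -> R).
Local Notation mu := (lebesgue_tuple R d).

Lemma gauss_density_gt0 th S x : spd_mx S -> 0 < gauss_density th S x.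
Proof.
move=> spdS; rewrite /gauss_density mulr_gt0 ?expR_gt0// invr_gt0 mulr_gt0//.
  by rewrite powR_gt0// mulr_gt0 ?pi_gt0.
by rewrite sqrtr_gt0 spd_det_gt0.
Qed.

Lemma measurable_gauss th S :
  measurable_fun setT (fun t : d.-tuple (measurableTypeR R) => gauss_density th S (tcol t)).
Proof. by apply: measurable_funM => //; exact: measurable_expquad. Qed.

Lemma integral_gauss th S : spd_mx S ->
  (\int[mu]_t (gauss_density th S (tcol t))%:E = 1)%E.
Proof.
move=> spdS; rewrite /gauss_density.
under eq_integral do rewrite EFinM.
have dS := spd_det_gt0 spdS.
have p0 : 0 < (2 * pi) `^ (d%:R / 2) :> R by rewrite powR_gt0// mulr_gt0 ?pi_gt0.
rewrite ge0_integralZl//=.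
- rewrite (integral_expquad _ (spd_invmx spdS)) det_inv -EFinM sqrtrV ?ltW//.
  by congr EFin; field; rewrite !gt_eqF// sqrtr_gt0.
- by apply/measurable_EFinP; exact: measurable_expquad.
- by rewrite lee_fin invr_ge0 mulr_ge0 ?sqrtr_ge0 ?powR_ge0.
Qed.

Lemma integrable_gauss th S : spd_mx S ->
  mu.-integrable setT (EFin \o (fun t => gauss_density th S (tcol t))).
Proof.
move=> spdS; apply/integrableP; split.
  by apply/measurable_EFinP; exact: measurable_gauss.
under eq_integral do rewrite /= ger0_norm ?ltW ?gauss_density_gt0//.
by rewrite /= integral_gauss// ltry.
Qed.

Lemma quad_normalize S u : spd_mx S -> u != 0 ->
  quad S ((Num.sqrt (quad S u))^-1 *: u) = 1.
Proof.
move=> [sS pS] u0; have v0 := pS _ u0; rewrite -/(quad _ _) in v0.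
by rewrite quadZ exprVn sqr_sqrtr ?ltW// mulVf// gt_eqF.
Qed.

(* The test function turns [gauss_density th S] into a multiple of the
   Gaussian density obtained by a rank-one update of [S] with [s < 0]. *)
Lemma gauss_test_rank_one th S u c : spd_mx S -> u != 0 ->
  exists th' S', spd_mx S' /\ forall x,
    gauss_density th S x * expR (- (dotv u x - c) ^+ 2 / 2) =
    gker 0 (dotv u th) (quad S u + 1) c * gauss_density th' S' x.
Proof.
move=> spdS u0; have [sS pS] := spdS.
have v0 := pS _ u0; rewrite -/(quad _ _) in v0.
set v := quad S u in v0 *; set r := Num.sqrt v.
have r0 : 0 < r by rewrite sqrtr_gt0.
have rE : r ^+ 2 = v by rewrite sqr_sqrtr ?ltW.
pose u' := r^-1 *: u; have u'1 : quad S u' = 1 by exact: quad_normalize.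
(* Conjugate updating: if [l] is standard normal and [r * l] is observed as [e] with unit noise, the
   posterior of [l] has mean [r * e / (1 + v)] and variance [(1 + v)^-1 = 1 + s]. *)
pose e := c - dotv u th; pose s := - (v / (1 + v)); pose tau := r * e / (1 + v).
have s1 : -1 < s by rewrite ltrN2 ltr_pdivrMr; lra.
have s1E : 1 + s = (1 + v)^-1 by rewrite /s; field; rewrite gt_eqF//; lra.
exists (th + tau *: (S *m u')), (rank_one_upd S u' s); split.
  exact: spd_rank_one.
move=> x; rewrite gauss_density_rank_one//.
set g := gauss_density th S x; set l := dotv u' (x - th).
have -> : dotv u x - c = r * l - e.
  rewrite /l /e !dotvBr /u' !(dotvC _ x) !(dotvC _ th) !dotvZr.
  by field; rewrite gt_eqF.
rewrite mulrCA; congr (g * _); rewrite /gker /= !mul1r s1E lnV ?posrE; last lra.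
rewrite -!expRD; congr expR; rewrite -/e /tau (addrC v).
have -> : (r * l - e) ^+ 2 = v * l ^+ 2 - 2 * r * l * e + e ^+ 2.
  by rewrite -rE; ring.
have -> : (l - r * e / (1 + v)) ^+ 2 =
    l ^+ 2 - 2 * r * l * e / (1 + v) + v * e ^+ 2 / (1 + v) ^+ 2.
  by rewrite -rE; field; rewrite rE gt_eqF//; lra.
by field; rewrite gt_eqF//; lra.
Qed.

Lemma integral_gauss_test th S u c : spd_mx S -> u != 0 ->
  \int[mu]_t (gauss_density th S (tcol t) * expR (- (dotv u (tcol t) - c) ^+ 2 / 2)) =
  gker 0 (dotv u th) (quad S u + 1) c.
Proof.
move=> spdS u0; have [th' [S' [spdS' e]]] := gauss_test_rank_one th c spdS u0.
under eq_Rintegral do rewrite e.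
rewrite RintegralZl//; last exact: integrable_gauss.
by rewrite /Rintegral integral_gauss// mulr1.
Qed.

Lemma integrable_gauss_test th S u c : spd_mx S -> u != 0 ->
  mu.-integrable setT (EFin \o (fun t =>
    gauss_density th S (tcol t) * expR (- (dotv u (tcol t) - c) ^+ 2 / 2))).
Proof.
move=> spdS u0; have [th' [S' [spdS' e]]] := gauss_test_rank_one th c spdS u0.
rewrite (_ : _ \o _ = fun t => (gker 0 (dotv u th) (quad S u + 1) c)%:E *
  (gauss_density th' S' (tcol t))%:E)%E.
  by apply: integrableZl => //; exact: integrable_gauss.
by apply/funext => t /=; rewrite e EFinM.
Qed.

End gauss_integral.

Section mixture.
Context (R : realType) (d : nat).
Implicit Types (G : mixing R d) (u : 'cV[R]_d).
Local Notation mu := (lebesgue_tuple R d).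

Definition spd_mixing G := forall i, spd_mx (cov G i).

Lemma integrable_mix G : spd_mixing G ->
  mu.-integrable setT (EFin \o (fun t => mix_density G (tcol t))).
Proof.
move=> spdG.
rewrite (_ : _ \o _ = fun t =>
    \sum_i ((weight G i)%:E * (gauss_density (mean G i) (cov G i) (tcol t))%:E)%E).
  apply: integrable_sum => // i _; apply: integrableZl => //.
  exact: integrable_gauss.
by apply/funext => t /=; rewrite /mix_density -sumEFin.
Qed.

Lemma integral_mix_test G u c : spd_mixing G -> u != 0 ->
  mu.-integrable setT (EFin \o (fun t =>
    mix_density G (tcol t) * expR (- (dotv u (tcol t) - c) ^+ 2 / 2))) /\
  \int[mu]_t (mix_density G (tcol t) * expR (- (dotv u (tcol t) - c) ^+ 2 / 2)) =
  \sum_i weight G i * gker 0 (dotv u (mean G i)) (quad (cov G i) u + 1) c.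
Proof.
move=> spdG u0.
pose F i t := weight G i * (gauss_density (mean G i) (cov G i) (tcol t) *
  expR (- (dotv u (tcol t) - c) ^+ 2 / 2)).
have iF i : mu.-integrable setT (EFin \o F i).
  rewrite (_ : _ \o _ = fun t => (weight G i)%:E *
    (gauss_density (mean G i) (cov G i) (tcol t) *
     expR (- (dotv u (tcol t) - c) ^+ 2 / 2))%:E)%E; last first.
    by apply/funext => t /=; rewrite EFinM.
  by apply: integrableZl => //; exact: integrable_gauss_test.
have e t : mix_density G (tcol t) * expR (- (dotv u (tcol t) - c) ^+ 2 / 2) =
    \sum_i F i t.
  by rewrite /mix_density mulr_suml; apply: eq_bigr => i _; rewrite -mulrA.
rewrite (_ : _ \o _ = fun t => \sum_i (EFin \o F i) t)%E; last first.
  by apply/funext => t /=; rewrite e sumEFin.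
split; first by apply: integrable_sum.
rewrite /Rintegral; under eq_integral do rewrite e -sumEFin.
rewrite integral_sum//.
rewrite (eq_bigr (fun i => (weight G i * gker 0 (dotv u (mean G i)) (quad (cov G i) u + 1) c)%:E)).
  by rewrite sumEFin.
move=> i _; rewrite -(integral_gauss_test (mean G i) c (spdG i) u0).
rewrite -RintegralZl//; last exact: integrable_gauss_test.
by rewrite fineK//; apply: integrable_fin_num => //; exact: iF.
Qed.

(** The test function takes values in [(0, 1]], so inserting it can only decrease the integral of
    the absolute difference; the factor 2 undoes the one half in [tvdist]. *)
Lemma tvdist_ge_test G G0 u c : spd_mixing G -> spd_mixing G0 -> u != 0 ->
  `| \sum_i weight G i * gker 0 (dotv u (mean G i)) (quad (cov G i) u + 1) c -
     \sum_i weight G0 i * gker 0 (dotv u (mean G0 i)) (quad (cov G0 i) u + 1) c |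
  <= 2 * tvdist (mix_density G) (mix_density G0).
Proof.
move=> sG sG0 u0.
have [iG <-] := integral_mix_test c sG u0.
have [iG0 <-] := integral_mix_test c sG0 u0.
rewrite -RintegralB//.
rewrite /tvdist mulrA divff// mul1r.
have iB := integrableB measurableT iG iG0.
apply: le_trans; first exact: le_normr_Rintegral iB.
apply: le_Rintegral => //.
- exact: (integrable_norm iB).
- have iD := integrableB measurableT (integrable_mix sG) (integrable_mix sG0).
  exact: (integrable_norm iD).
move=> t _; rewrite -mulrBl normrM ler_piMr// ger0_norm ?expR_ge0//.
rewrite -expR0 ler_expR mulNr oppr_le0 mulr_ge0// ?sqr_ge0//.
Qed.

Lemma tvdist_ge0 (p q : 'cV[R]_d -> R) : 0 <= tvdist p q.
Proof. by rewrite /tvdist mulr_ge0//; apply: Rintegral_ge0. Qed.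

End mixture.

(** * Derivatives of the Gaussian kernel in mean and variance *)

Section derive_lambda.
Context (R : realType).
Implicit Types (f g : R -> R) (t a b : R).

Lemma is_derive1D f g t a b : is_derive t 1 f a -> is_derive t 1 g b ->
  is_derive t 1 (fun s => f s + g s) (a + b).
Proof. exact: is_deriveD. Qed.

Lemma is_derive1B f g t a b : is_derive t 1 f a -> is_derive t 1 g b ->
  is_derive t 1 (fun s => f s - g s) (a - b).
Proof. exact: is_deriveB. Qed.

Lemma is_derive1M f g t a b : is_derive t 1 f a -> is_derive t 1 g b ->
  is_derive t 1 (fun s => f s * g s) (a * g t + f t * b).
Proof.
move=> df dg; apply: (is_derive_eq (is_deriveM df dg)).
by rewrite addrC [g t *: a]mulrC.
Qed.

Lemma is_derive1_cst t a : is_derive t 1 (fun=> a) 0.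
Proof. exact: is_derive_cst. Qed.

Lemma is_derive1Mn f t a n : is_derive t 1 f a ->
  is_derive t 1 (fun s => n%:R * f s) (n%:R * a).
Proof.
by move=> df; apply: (is_derive_eq (is_derive1M (is_derive1_cst t n%:R) df)); ring.
Qed.

Lemma is_derive1_expR f t a : is_derive t 1 f a ->
  is_derive t 1 (fun s => expR (f s)) (expR (f t) * a).
Proof. by move=> df; apply: (@is_derive1_comp _ expR f). Qed.

Lemma is_derive1_lnf f t a : 0 < f t -> is_derive t 1 f a ->
  is_derive t 1 (fun s => ln (f s)) ((f t)^-1 * a).
Proof. by move=> f0 df; apply: (@is_derive1_comp _ (@ln R) f); apply: is_derive1_ln. Qed.

Lemma is_derive1V f t a : f t != 0 -> is_derive t 1 f a ->
  is_derive t 1 (fun s => (f s)^-1) (- a / f t ^+ 2).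
Proof.
move=> f0 df; apply: (is_derive_eq (is_deriveV f0 df)).
by rewrite [LHS]mulrC mulrN mulNr.
Qed.

End derive_lambda.

Section gauss_kernel.
Context (R : realType).
Implicit Types (tau v c : R).

Lemma gkerSS n tau v c :
  gker n.+2 tau v c =
    (c - tau) / v * gker n.+1 tau v c - n.+1%:R / v * gker n tau v c.
Proof. by rewrite /gker /=; ring. Qed.

(** The variance enters through the heat equation: one derivative in the variance is half of two
    derivatives in the mean. Hence derivatives along any path are again combinations of kernels. *)
Lemma is_derive_gker (tau v : R -> R) (t dt dv c : R) : 0 < v t ->
  is_derive t 1 tau dt -> is_derive t 1 v dv ->
  forall n, is_derive t 1 (fun s => gker n (tau s) (v s) c)
    (dt * gker n.+1 (tau t) (v t) c + dv / 2 * gker n.+2 (tau t) (v t) c).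
Proof.
move=> v0 dtau dvv; have vN0 : v t != 0 by rewrite gt_eqF.
have dz : is_derive t 1 (fun s => c - tau s) (- dt).
  by apply: (is_derive_eq (is_derive1B (is_derive1_cst t c) dtau)); ring.
have dq : is_derive t 1 (fun s => (v s)^-1) (- dv / v t ^+ 2) by exact: is_derive1V.
have d0 : is_derive t 1 (fun s => gker 0 (tau s) (v s) c)
    (dt * gker 1 (tau t) (v t) c + dv / 2 * gker 2 (tau t) (v t) c).
  rewrite (_ : (fun s => _) = fun s =>
    expR (((c - tau s) * (c - tau s) * (v s)^-1 + ln (v s)) * (- 2^-1))).
    apply: (is_derive_eq (is_derive1_expR (is_derive1M (is_derive1D
      (is_derive1M (is_derive1M dz dz) dq) (is_derive1_lnf v0 dvv))
      (is_derive1_cst t _)))).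
    rewrite /gker /= !mulr1 mul1r.
    have -> : - (c - tau t) ^+ 2 / (2 * v t) - ln (v t) / 2 =
      ((c - tau t) * (c - tau t) * (v t)^-1 + ln (v t)) * (- 2^-1) by field.
    by field.
  apply/funext => s; rewrite /gker /= mul1r; congr expR.
  by rewrite invfM; ring.
have d1 : is_derive t 1 (fun s => gker 1 (tau s) (v s) c)
    (dt * gker 2 (tau t) (v t) c + dv / 2 * gker 3 (tau t) (v t) c).
  rewrite (_ : (fun s => _) = fun s =>
    (c - tau s) * (v s)^-1 * gker 0 (tau s) (v s) c); last first.
    by apply/funext => s; rewrite /gker /= mul1r.
  apply: (is_derive_eq (is_derive1M (is_derive1M dz dq) d0)).
  rewrite (gkerSS 1) (gkerSS 0).
  have -> : gker 1 (tau t) (v t) c = (c - tau t) / v t * gker 0 (tau t) (v t) c.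
    by rewrite /gker /= mul1r.
  by field.
(* The recurrence [gkerSS] goes back two indices, so two consecutive statements are carried through
   the induction. *)
suff H n : is_derive t 1 (fun s => gker n (tau s) (v s) c)
    (dt * gker n.+1 (tau t) (v t) c + dv / 2 * gker n.+2 (tau t) (v t) c) /\
   is_derive t 1 (fun s => gker n.+1 (tau s) (v s) c)
    (dt * gker n.+2 (tau t) (v t) c + dv / 2 * gker n.+3 (tau t) (v t) c).
  by move=> n; case: (H n).
elim: n => [|n [IH0 IH1]]; first by [].
split=> //.
rewrite (_ : (fun s => _) = fun s =>
  (c - tau s) * (v s)^-1 * gker n.+1 (tau s) (v s) c -
  n.+1%:R * ((v s)^-1 * gker n (tau s) (v s) c)); last first.
  by apply/funext => s; rewrite gkerSS mulrA.
apply: (is_derive_eq (is_derive1B (is_derive1M (is_derive1M dz dq) IH1)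
  (is_derive1Mn n.+1 (is_derive1M dq IH0)))).
rewrite (gkerSS n.+2) (gkerSS n.+1) (gkerSS n).
rewrite -[n.+3%:R]natr1 -[n.+2%:R]natr1.
by field.
Qed.

End gauss_kernel.

(** * Taylor expansion along parabolic paths *)

(* The coefficient of [t ^+ m] in [exp (a t + b t ^ 2)]. *)
Definition heat_coef (R : fieldType) (m : nat) (a b : R) : R :=
  \sum_(n1 < m.+1) \sum_(n2 < m.+1 | (n1 + 2 * n2 == m)%N)
    a ^+ n1 * b ^+ n2 / (n1`! * n2`!)%:R.

Section heat_coef.
Context (R : realFieldType) (a b : R).

(** The cutoffs are free and the constraint is an indicator, so that index shifts need not adjust
    the ranges; any cutoffs above [m] give [heat_coef m a b]. *)
Let S N1 N2 m := \sum_(n1 < N1) \sum_(n2 < N2)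
  ((n1 + 2 * n2 == m)%N)%:R * (a ^+ n1 / n1`!%:R) * (b ^+ n2 / n2`!%:R).

Let S_recl1 N1 N2 m : (m < N1)%N -> S N1.+1 N2 m = S N1 N2 m.
Proof.
move=> h; rewrite /S big_ord_recr /= [X in _ + X]big1 ?addr0// => j _.
by rewrite gtn_eqF ?mul0r// ltn_addr.
Qed.

Let S_recl2 N1 N2 m : (m < N2)%N -> S N1 N2.+1 m = S N1 N2 m.
Proof.
move=> h; rewrite /S; apply: eq_bigr => i _; rewrite big_ord_recr /=.
rewrite gtn_eqF ?mul0r ?addr0//.
by rewrite (leq_trans h)// (leq_trans _ (leq_addl _ _))// leq_pmull.
Qed.

Let heat_coefS N1 N2 m : (m < N1)%N -> (m < N2)%N -> S N1 N2 m = heat_coef m a b.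
Proof.
have base : S m.+1 m.+1 m = heat_coef m a b.
  apply: eq_bigr => i _; rewrite [RHS]big_mkcond; apply: eq_bigr => j _.
  case: eqP => _; last by rewrite !mul0r.
  by rewrite mul1r natrM invfM mulrACA mulrA.
move=> h1 h2; rewrite -base.
transitivity (S m.+1 N2 m).
  rewrite -(subnK h1); elim: (N1 - _)%N => [//|k IH].
  by rewrite addSn S_recl1 ?IH// addnS ltnS leq_addl.
rewrite -(subnK h2); elim: (N2 - _)%N => [//|k IH].
by rewrite addSn S_recl2 ?IH// addnS ltnS leq_addl.
Qed.

Lemma heat_coef0 : heat_coef 0 a b = 1.
Proof. by rewrite /heat_coef !big_ord1 /= big_mkcond big_ord1 /= mulr1 invr1 mulr1. Qed.

Let expfactS (x : R) n : n.+1%:R * (x ^+ n.+1 / n.+1`!%:R) = x * (x ^+ n / n`!%:R).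
Proof.
have n0 : n.+1%:R != 0 :> R by rewrite pnatr_eq0.
have f0 : n`!%:R != 0 :> R by rewrite pnatr_eq0 -lt0n fact_gt0.
move: n0 f0; rewrite factS natrM exprS; set k := n.+1%:R; set f := n`!%:R => k0 f0.
by clearbody k f; field; rewrite k0 f0.
Qed.

(** The coefficient form of [F' = (a + 2 b t) F] for [F = exp (a t + b t^2)]: on the support of the
    indicator [m.+1] splits as [n1 + 2 * n2], and each summand lowers one factorial. *)
Let S_deriv m N : m.+1%:R * S N.+1 N.+1 m.+1 = a * S N N.+1 m +
   2 * b * (if m is m'.+1 then S N.+1 N m' else 0).
Proof.
transitivity (
    (\sum_(n1 < N.+1) \sum_(n2 < N.+1) ((n1 + 2 * n2 == m.+1)%N)%:R *
      (n1%:R * (a ^+ n1 / n1`!%:R)) * (b ^+ n2 / n2`!%:R)) +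
    2 * (\sum_(n1 < N.+1) \sum_(n2 < N.+1) ((n1 + 2 * n2 == m.+1)%N)%:R *
      (a ^+ n1 / n1`!%:R) * (n2%:R * (b ^+ n2 / n2`!%:R)))).
  rewrite /S !mulr_sumr -big_split; apply: eq_bigr => i _.
  rewrite !mulr_sumr -big_split; apply: eq_bigr => j _ /=.
  case: eqP => [<-|_]; last by rewrite !mul0r !mulr0 addr0.
  by rewrite natrD natrM; ring.
congr (_ + _).
  rewrite big_ord_recl big1 ?add0r; last by move=> i _; rewrite !mul0r mulr0 mul0r.
  rewrite /S mulr_sumr; apply: eq_bigr => i _.
  rewrite mulr_sumr; apply: eq_bigr => j _.
  rewrite lift0 expfactS addSn eqSS; ring.
rewrite -mulrA; congr (_ * _).
rewrite exchange_big /= big_ord_recl big1 ?add0r; last by move=> i _; rewrite !mul0r mulr0.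
case: m => [|m].
  rewrite mulr0 big1// => i _; rewrite big1// => j _.
  by rewrite ?lift0 /bump ?leq0n ?add1n mulnS addnCA add2n eqSS /= !mul0r.
rewrite /S [in RHS]exchange_big /= mulr_sumr; apply: eq_bigr => i _.
rewrite mulr_sumr; apply: eq_bigr => j _.
rewrite ?lift0 /bump ?leq0n ?add1n expfactS mulnS addnCA add2n !eqSS; ring.
Qed.

Lemma heat_coef1 : heat_coef 1 a b = a.
Proof.
have := S_deriv 0 2; rewrite mulr0 addr0 mul1r !heat_coefS//.
by rewrite heat_coef0 mulr1.
Qed.

Lemma heat_coefSS m : m.+2%:R * heat_coef m.+2 a b =
  a * heat_coef m.+1 a b + 2 * b * heat_coef m a b.
Proof. by have := S_deriv m.+1 m.+2; rewrite !heat_coefS// leqW. Qed.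

End heat_coef.

(** Weighted homogeneity, with weight 1 for the mean shift and 2 for the variance shift; it allows a
    solution of the system to be scaled into the unit box. *)
Lemma heat_coefZ (R : fieldType) m (s a b : R) :
  heat_coef m (s * a) (s ^+ 2 * b) = s ^+ m * heat_coef m a b.
Proof.
rewrite /heat_coef mulr_sumr; apply: eq_bigr => i _.
rewrite mulr_sumr; apply: eq_bigr => j /eqP e.
by rewrite -[in s ^+ m]e exprD exprM !exprMn; ring.
Qed.

Section taylor.
Context (R : realType) (tau0 v0 c a b T B : R) (M : nat).

Definition gpath (n : nat) (t : R) := gker n (tau0 + a * t) (v0 + 2 * b * t ^+ 2) c.

Hypotheses (a1 : `|a| <= 1) (b1 : `|b| <= 1) (T1 : T <= 1).
Hypothesis vT : forall t : R, 0 <= t <= T -> 0 < v0 + 2 * b * t ^+ 2.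
Hypothesis gB : forall n (t : R), (n <= M)%N -> 0 <= t <= T -> `|gpath n t| <= B.

Definition gremainder (n N : nat) (t : R) :=
  gpath n t - \sum_(m < N) t ^+ m * (heat_coef m a b * gpath (n + m) 0).

Let dpath n (t : R) : 0 <= t <= T ->
  is_derive t 1 (gpath n) (a * gpath n.+1 t + 2 * b * t * gpath n.+2 t).
Proof.
move=> tT.
have dtau : is_derive t 1 (fun s => tau0 + a * s) a.
  apply: (is_derive_eq (is_derive1D (is_derive1_cst t tau0)
    (is_derive1M (is_derive1_cst t a) (is_derive_id t 1)))).
  by rewrite /=; ring.
have dv : is_derive t 1 (fun s => v0 + 2 * b * s ^+ 2) (4 * b * t).
  apply: (is_derive_eq (is_derive1D (is_derive1_cst t v0)
    (is_derive1M (is_derive1_cst t (2 * b)) (is_derive1M (is_derive_id t 1) (is_derive_id t 1))))).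
  by rewrite /=; ring.
apply: (is_derive_eq (@is_derive_gker _ (fun s => tau0 + a * s)
  (fun s => v0 + 2 * b * s ^+ 2) _ _ _ c (vT tT) dtau dv n)).
by rewrite /gpath; field.
Qed.

Let dsum N (C : nat -> R) (t : R) :
  is_derive t 1 (fun s : R => \sum_(m < N.+1) s ^+ m * C m)
    (\sum_(m < N) t ^+ m * (m.+1%:R * C m.+1)).
Proof.
elim: N => [|N IH].
  rewrite big_ord0 (_ : (fun s => _) = fun=> C 0%N); first exact: is_derive1_cst.
  by apply/funext => s; rewrite big_ord1 mul1r.
rewrite (_ : (fun s => _) = fun s => \sum_(m < N.+1) s ^+ m * C m + s ^+ N.+1 * C N.+1);
  last by apply/funext => s; rewrite big_ord_recr.
have dX : is_derive t 1 (fun s : R => s ^+ N.+1) (N.+1%:R * t ^+ N).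
  have := is_deriveX N.+1 (is_derive_id t (1 : R)).
  by rewrite exprfctE; move=> h; apply: (is_derive_eq h); rewrite /= [LHS]mulr1.
apply: (is_derive_eq (is_derive1D IH (is_derive1M dX (is_derive1_cst t (C N.+1))))).
by rewrite big_ord_recr /=; ring.
Qed.

(** Differentiation lowers the order of a remainder and raises its kernel index; [heat_coefSS] makes
    the sums match. For [N = 0] both remainders on the right are bare kernels, as [0.-1 = 0]. *)
Let dremainder n N (t : R) : 0 <= t <= T ->
  is_derive t 1 (gremainder n N.+1) (a * gremainder n.+1 N t +
    2 * b * t * gremainder n.+2 N.-1 t).
Proof.
move=> tT.
apply: (is_derive_eq (is_derive1B (dpath n tT)
  (dsum N (fun m => heat_coef m a b * gpath (n + m) 0) t))).
rewrite /gremainder; case: N => [|N].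
  by rewrite /= !big_ord0 !subr0.
rewrite [N.+1.-1]/= big_ord_recl heat_coef1 expr0 !mul1r addn1.
rewrite [in RHS]big_ord_recl heat_coef0 expr0 !mul1r addn0.
have -> : \sum_(i < N) t ^+ lift ord0 i * ((lift ord0 i).+1%:R *
     (heat_coef (lift ord0 i).+1 a b * gpath (n + (lift ord0 i).+1) 0)) =
   a * (\sum_(i < N) t ^+ lift ord0 i *
     (heat_coef (lift ord0 i) a b * gpath (n.+1 + lift ord0 i) 0)) +
   2 * b * t * \sum_(m < N) t ^+ m * (heat_coef m a b * gpath (n.+2 + m) 0).
  rewrite !mulr_sumr -big_split; apply: eq_bigr => i _ /=.
  rewrite /bump leq0n add1n (mulrA _.+2%:R) heat_coefSS !addnS !addSn exprS.
  by ring.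
by ring.
Qed.

(** Induction on [N] by the mean value theorem. Each order costs the factor [3 >= |a| + 2 |b|] and
    raises the kernel index by at most 2, whence [n + 2 * N <= M]. *)
Lemma gpath_taylor N n (t : R) : (n + 2 * N <= M)%N -> 0 <= t <= T ->
  `|gremainder n N t| <= 3 ^+ N * B * t ^+ N.
Proof.
elim/ltn_ind: N n t => N IH n t nM tT.
case: N => [|N] in IH nM *.
  rewrite /gremainder big_ord0 subr0 expr0 mul1r mulr1; apply: gB => //.
  by rewrite (leq_trans _ nM)// leq_addr.
have /andP[t0 tleT] := tT.
have sub s : s \in `[0, t] -> 0 <= s <= T.
  by rewrite in_itv /= => /andP[-> /= st]; exact: le_trans st tleT.
have [s st e] := @MVT_segment _ (gremainder n N.+1)
  (fun s => a * gremainder n.+1 N s + 2 * b * s * gremainder n.+2 N.-1 s) 0 t t0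
  (fun s ss => dremainder n N (sub _ (subset_itv_oo_cc ss)))
  (derivable_within_continuous
     (fun s ss => @ex_derive _ _ _ _ _ _ _ (dremainder n N (sub _ ss)))).
have r0 : gremainder n N.+1 0 = 0.
  rewrite /gremainder big_ord_recl expr0 heat_coef0 !mul1r addn0 big1 ?addr0 ?subrr//.
  by move=> i _; rewrite lift0 exprS mul0r mul0r.
move: e; rewrite r0 !subr0 => ->.
have /andP[s0 sT] := sub _ st.
have sle : s <= t by move: st; rewrite in_itv /= => /andP[].
have B0 : 0 <= B by apply: le_trans (gB (leq0n M) tT).
have sN : s ^+ N <= t ^+ N by rewrite lerXn2r ?nnegrE.
have P0 : 0 <= 3 ^+ N * B * t ^+ N :> R by rewrite !mulr_ge0 ?exprn_ge0.
have h1 : `|gremainder n.+1 N s| <= 3 ^+ N * B * t ^+ N.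
  apply: le_trans (_ : 3 ^+ N * B * s ^+ N <= _).
    apply: IH => //; first by rewrite (leq_trans _ nM)// mulnS addnA leq_add2r addn2.
    by rewrite s0.
  by rewrite ler_wpM2l// mulr_ge0// exprn_ge0.
(* The order lost in [N.-1] is regained from the factor [s <= t]; for [N = 0] that factor is just
   bounded by 1. *)
have h2 : `|s * gremainder n.+2 N.-1 s| <= 3 ^+ N * B * t ^+ N.
  clear r0 h1; rewrite normrM ger0_norm//; case: N => [|N] in IH nM sN P0 *.
    rewrite /gremainder big_ord0 subr0 expr0 mul1r mulr1 -[B]mul1r ler_pM//.
      exact: le_trans T1.
    by apply: gB; rewrite ?s0// (leq_trans _ nM)// addnC.
  apply: le_trans (_ : s * (3 ^+ N * B * s ^+ N) <= _).
    rewrite ler_wpM2l//; apply: IH => //; rewrite ?s0//.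
    by rewrite /=; lia.
  rewrite mulrCA -exprS ler_pM ?mulr_ge0 ?exprn_ge0//.
  by rewrite ler_wpM2r// ler_eXn2l ?leqnSn// ltr1n.
rewrite normrM (ger0_norm t0) [t ^+ N.+1]exprSr mulrA ler_wpM2r//.
apply: le_trans (ler_normD _ _) _.
rewrite normrM -mulrA 2!normrM.
set X := 3 ^+ N * B * t ^+ N in P0 h1 h2.
have -> : 3 ^+ N.+1 * B * t ^+ N = X + 2 * X by rewrite exprS /X; ring.
rewrite [ `|2| ]ger0_norm// lerD//; first by rewrite -[X]mul1r ler_pM.
by rewrite -mulrA ler_wpM2l// -[X]mul1r ler_pM.
Qed.

End taylor.

Section gauss_kernel_bound.
Context (R : realType).
Implicit Types (tau v c z q delta : R).

Lemma herm_bound (n : nat) : exists2 C : R, 0 <= C &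
  forall z q, 0 <= q <= 2 -> `|herm n z q| <= C * (1 + z ^+ 2) ^+ n.
Proof.
suff [C [D [C0 D0 h]]] : exists C D : R, [/\ 0 <= C, 0 <= D & forall z q, 0 <= q <= 2 ->
    `|herm n z q| <= C * (1 + z ^+ 2) ^+ n /\
    `|herm n.+1 z q| <= D * (1 + z ^+ 2) ^+ n.+1].
  by exists C => // z q q02; case: (h z q q02).
have zq z q : 0 <= q <= 2 -> `|z * q| <= 1 + z ^+ 2.
  move=> /andP[q0 q2]; rewrite normrM (ger0_norm q0).
  apply: le_trans (_ : `|z| * 2 <= _); first by rewrite ler_wpM2l.
  by rewrite -real_normK ?num_real//; have := sqr_ge0 (1 - `|z|); lra.
elim: n => [|n [C [D [C0 D0 h]]]].
  exists 1, 1; split=> // z q q02; rewrite !expr0 !mul1r expr1 normr1; split=> //.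
  exact: zq.
exists D, (D + n.+1%:R * 2 * C); split=> //; first by rewrite addr_ge0// !mulr_ge0.
move=> z q q02; have [h0 h1] := h z q q02; split=> //.
rewrite [herm n.+2 z q]/=.
apply: le_trans (ler_normB _ _) _; rewrite mulrDl lerD//.
  by rewrite normrM exprS mulrCA ler_pM// zq.
rewrite -(mulrA _ C) normrM ler_pM//.
  rewrite normrM ger0_norm// ler_wpM2l//.
  by case/andP: q02 => q0 q2; rewrite ger0_norm.
apply: (le_trans h0); rewrite ler_wpM2l// ler_weXn2l//; last by rewrite leqW.
by rewrite lerDl sqr_ge0.
Qed.

(** From [1 + y <= (1 + 1/e) (1 + e y)] and [1 + x <= exp x], the rate [delta] being shared among
    [n.+1] factors so that [n = 0] needs no separate case. *)
Lemma expr1D_le_expR (n : nat) delta : 0 < delta -> exists2 C : R, 0 <= C &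
  forall y : R, 0 <= y -> (1 + y) ^+ n <= C * expR (delta * y).
Proof.
move=> d0; pose e := delta / n.+1%:R.
have e0 : 0 < e by rewrite divr_gt0.
exists ((1 + e^-1) ^+ n); first by rewrite exprn_ge0// addr_ge0// invr_ge0 ltW.
move=> y y0.
apply: le_trans (_ : ((1 + e^-1) * expR (e * y)) ^+ n <= _).
  rewrite lerXn2r ?nnegrE ?addr_ge0//.
    by rewrite mulr_ge0 ?expR_ge0// addr_ge0// invr_ge0 ltW.
  apply: le_trans (_ : (1 + e^-1) * (1 + e * y) <= _).
    have -> : (1 + e^-1) * (1 + e * y) = 1 + y + (e * y + e^-1).
      by field; rewrite gt_eqF.
    by have e1 := ltW e0; rewrite lerDl; apply: addr_ge0; [apply: mulr_ge0|rewrite invr_ge0].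
  by rewrite ler_wpM2l ?expR_ge1Dx// addr_ge0// invr_ge0 ltW.
rewrite exprMn; apply: ler_wpM2l.
  by rewrite exprn_ge0// addr_ge0// invr_ge0 ltW.
rewrite -expRM_natl ler_expR /e mulrA ler_wpM2r//.
rewrite mulrCA ger_pMr// ler_pdivrMr// mul1r ler_nat; lia.
Qed.

(** [delta] is the part of the Gaussian decay given up to absorb the Hermite polynomial. *)
Lemma gker_bound (M : nat) delta : 0 < delta -> exists2 C : R, 0 <= C &
  forall n tau v c, (n <= M)%N -> 2^-1 <= v ->
    `|gker n tau v c| <= C * expR (delta * (c - tau) ^+ 2 - (c - tau) ^+ 2 / (2 * v)).
Proof.
move=> d0.
have one n : exists2 C : R, 0 <= C & forall tau v c, 2^-1 <= v ->
    `|gker n tau v c| <= C * expR (delta * (c - tau) ^+ 2 - (c - tau) ^+ 2 / (2 * v)).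
  have [C C0 hC] := herm_bound n; have [D D0 hD] := expr1D_le_expR n d0.
  exists (C * D * expR (ln 2)); first by rewrite !mulr_ge0 ?expR_ge0.
  move=> tau v c v2; have v0 : 0 < v by lra.
  rewrite /gker; set z := c - tau.
  have q02 : 0 <= v^-1 <= 2.
    by rewrite invr_ge0 ltW//= -[leRHS]invrK lef_pV2 ?posrE.
  rewrite normrM (ger0_norm (expR_ge0 _)).
  apply: le_trans (ler_wpM2r (expR_ge0 _) (hC z _ q02)) _.
  apply: le_trans (_ : C * (D * expR (delta * z ^+ 2)) *
     (expR (ln 2) * expR (- (z ^+ 2 / (2 * v)))) <= _).
    apply: ler_pM; rewrite ?mulr_ge0 ?expR_ge0 ?exprn_ge0 ?addr_ge0 ?sqr_ge0//.
      by rewrite ler_wpM2l// hD// sqr_ge0.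
    rewrite -expRD ler_expR mulNr addrC lerD2r.
    have : ln (2^-1 : R) <= ln v by rewrite ler_ln ?posrE.
    have : 0 <= ln (2 : R) by rewrite ln_ge0// ler1n.
    by rewrite lnV ?posrE//; lra.
  by rewrite expRD le_eqVlt; apply/orP; left; apply/eqP; ring.
elim: M => [|M [C C0 h]].
  have [C C0 h] := one 0%N; exists C => // n tau v c; rewrite leqn0 => /eqP->; exact: h.
have [D D0 hD] := one M.+1; exists (C + D); first exact: addr_ge0.
move=> n tau v c; rewrite leq_eqVlt => /predU1P[-> v2|]; last rewrite ltnS => nM v2.
  by apply: (le_trans (hD _ _ _ v2)); rewrite ler_wpM2r ?expR_ge0// lerDr.
by apply: (le_trans (h _ _ _ _ nM v2)); rewrite ler_wpM2r ?expR_ge0// lerDl.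
Qed.

Lemma gker_bounded (M : nat) (V : R) : 0 < V -> exists2 C : R, 0 <= C &
  forall n tau v c, (n <= M)%N -> 2^-1 <= v <= V -> `|gker n tau v c| <= C.
Proof.
move=> V0; have d0 : 0 < (2 * V)^-1 by rewrite invr_gt0 mulr_gt0.
have [C C0 h] := gker_bound M d0; exists C => // n tau v c nM /andP[v1 vV].
apply: (le_trans (h _ _ _ _ nM v1)); rewrite ler_piMr// -expR0 ler_expR subr_le0.
rewrite mulrC ler_wpM2l ?sqr_ge0// lef_pV2 ?posrE ?mulr_gt0//; last lra.
by rewrite ler_wpM2l.
Qed.

(** For variance at most 9/8 the decay rate is at least 4/9, of which 1/36 is spent on the
    polynomial; centering at 0 instead of [tau] lowers it to 3/8. Convergence of the chi-square
    integral requires a rate above 1/4. *)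
Lemma gker_std_bound (M : nat) : exists2 C : R, 0 <= C &
  forall n tau v c, (n <= M)%N -> `|tau| <= 1 -> 7 / 8 <= v <= 9 / 8 ->
    `|gker n tau v c| <= C * expR (- (3 / 8 * c ^+ 2)).
Proof.
have d0 : 0 < 36^-1 :> R by rewrite invr_gt0.
have [C C0 h] := gker_bound M d0.
exists (C * expR (15 / 4)); first by rewrite mulr_ge0 ?expR_ge0.
move=> n tau v c nM tau1 /andP[v1 v2].
have v12 : 2^-1 <= v by lra.
apply: (le_trans (h _ _ _ _ nM v12)).
rewrite -mulrA ler_wpM2l// -expRD ler_expR.
have : (c - tau) ^+ 2 * (4 / 9) <= (c - tau) ^+ 2 / (2 * v).
  rewrite ler_wpM2l ?sqr_ge0// -[leLHS]invrK lef_pV2 ?posrE ?invf_div ?mulr_gt0//; lra.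
have : tau ^+ 2 <= 1 by rewrite -real_normK ?num_real// expr_le1.
(* [5/12 (c - tau)^2 - 3/8 c^2] equals [((c - 10 tau)^2 - 90 tau^2) / 24], and
   [90 / 24 = 15 / 4]. *)
have := sqr_ge0 (c - 10 * tau).
set X := (c - tau) ^+ 2 / _.
by nra.
Qed.

End gauss_kernel_bound.

(** * Linear independence of the kernels *)

Lemma poly_eq0_fun (R : numDomainType) (p : {poly R}) : (forall x, p.[x] = 0) -> p = 0.
Proof.
move=> h; apply/eqP/negPn/negP => p0.
have := @max_poly_roots _ p [seq i%:R | i <- iota 0 (size p)] p0.
rewrite size_map size_iota ltnn => H.
suff : false by []; apply: H; first by apply/allP => x _; apply/eqP.
by rewrite map_inj_uniq ?iota_uniq// => i j /eqP; rewrite eqr_nat => /eqP.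
Qed.

(** For [p != 0] the product [p * q] has at least the size of [p], while the derivative of [p] is
    strictly smaller. *)
Lemma deriv_addM_eq0 (R : idomainType) (p q : {poly R}) :
  q != 0 -> p^`() + p * q = 0 -> p = 0.
Proof.
move=> q0 h; apply/eqP/negPn/negP => p0.
have : size (p * q) = size (p^`()).
  by move/eqP: h; rewrite addr_eq0 => /eqP ->; rewrite size_polyN.
have := lt_size_deriv p0; rewrite size_mul//.
have : (0 < size q)%N by rewrite lt0n size_poly_eq0.
by lia.
Qed.

Lemma is_derive_sum_fun (R : realType) n (f : 'I_n -> R -> R) (df : 'I_n -> R) (t : R) :
  (forall i, is_derive t 1 (f i) (df i)) ->
  is_derive t 1 (fun s => \sum_i f i s) (\sum_i df i).
Proof.
by move=> h; have := is_derive_sum h; rewrite fct_sumE.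
Qed.

(* Divide by the first exponential and differentiate until its polynomial
   factor disappears. *)
Lemma exp_poly_indep (R : realType) n (P Q : 'I_n -> {poly R}) :
  (forall i j, (Q i)^`() = (Q j)^`() -> i = j) ->
  (forall x, \sum_i (P i).[x] * expR (Q i).[x] = 0) -> forall i, P i = 0.
Proof.
elim: n P Q => [|n IH] P Q Qinj h; first by case.
pose D i := Q (lift ord0 i) - Q ord0.
have Dinj i j : (D i)^`() = (D j)^`() -> i = j.
  by rewrite /D !derivB => /addIr/Qinj/lift_inj.
have D0 i : (D i)^`() != 0.
  rewrite /D derivB subr_eq0; apply/eqP => /Qinj/eqP.
  by rewrite eq_sym (negPf (neq_lift _ _)).
(* [p] is the polynomial left without an exponential after the division; the induction on its size
   ends in the case of [n] exponentials. *)
have aux s : forall (p : {poly R}) (q : 'I_n -> {poly R}), (size p <= s)%N ->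
    (forall x, p.[x] + \sum_i (q i).[x] * expR (D i).[x] = 0) -> forall i, q i = 0.
  elim: s => [|s IHs] p q sp hpq.
    apply: (IH q D) => // x; have := hpq x.
    by move: sp; rewrite leqn0 size_poly_eq0 => /eqP ->; rewrite horner0 add0r.
  have sp' : (size p^`() <= s)%N.
    have [->|p0] := eqVneq p 0; first by rewrite deriv0 size_poly0.
    by rewrite -ltnS (leq_trans (lt_size_deriv p0)).
  (* Differentiating turns [q i] into its derivative plus [q i] times the derivative of [D i], which
     vanishes only if [q i] does, so no information is lost. *)
  suff H i : (q i)^`() + q i * (D i)^`() = 0 by move=> i; exact: deriv_addM_eq0 (H i).
  move: i; apply: (IHs p^`()) => // x.
  have df : is_derive x 1 (fun x => p.[x] + \sum_i (q i).[x] * expR (D i).[x])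
      (p^`().[x] + \sum_i ((q i)^`() + q i * (D i)^`()).[x] * expR (D i).[x]).
    apply: (is_derive1D (is_derive_poly p x)).
    apply: (@is_derive_sum_fun _ _ (fun i y => (q i).[y] * expR (D i).[y])) => i.
    apply: (is_derive_eq (is_derive1M (is_derive_poly (q i) x)
      (is_derive1_expR (is_derive_poly (D i) x)))).
    by rewrite hornerD hornerM; ring.
  have h0 : (fun x => p.[x] + \sum_i (q i).[x] * expR (D i).[x]) = cst 0.
    by apply/funext => y; rewrite hpq.
  by rewrite -(@derive_val _ _ _ _ _ _ _ df) h0 derive_cst.
have hD x : (P ord0).[x] + \sum_i (P (lift ord0 i)).[x] * expR (D i).[x] = 0.
  have := h x; rewrite big_ord_recl => /(congr1 (fun y => y * expR (- (Q ord0).[x]))).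
  rewrite mul0r mulrDl -mulrA -expRD subrr expR0 mulr1 mulr_suml => e.
  rewrite -[RHS]e; congr (_ + _); apply: eq_bigr => i _.
  by rewrite -mulrA -expRD /D hornerD hornerN.
have P0 := aux _ _ _ (leqnn _) hD.
move=> i; case: (unliftP ord0 i) => [j ->|->]; first exact: P0.
apply: poly_eq0_fun => x; have := hD x.
by rewrite big1 ?addr0// => j _; rewrite P0 horner0 mul0r.
Qed.

Lemma hermSS (A : pzRingType) n (z q : A) :
  herm n.+2 z q = z * q * herm n.+1 z q - n.+1%:R * q * herm n z q.
Proof. by []. Qed.

Section gauss_kernel_indep.
Context (R : realType).
Implicit Types (mu v c : R).

Let hermp (n : nat) mu v : {poly R} := herm n ('X - mu%:P) (v^-1)%:P.

Let hermpE n mu v c : (hermp n mu v).[c] = herm n (c - mu) v^-1.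
Proof.
suff [] : (hermp n mu v).[c] = herm n (c - mu) v^-1 /\
  (hermp n.+1 mu v).[c] = herm n.+1 (c - mu) v^-1 by [].
elim: n => [|n [IH0 IH1]]; first by rewrite /hermp /= !hornerE.
split=> //; rewrite /hermp !hermSS -IH0 -IH1.
by rewrite !(hornerE, hornerMn).
Qed.

Let size_hermp n mu v : v != 0 -> size (hermp n mu v) = n.+1.
Proof.
move=> v0; have vi0 : v^-1 != 0 by rewrite invr_eq0.
have sq : size ((v^-1)%:P : {poly R}) = 1%N by rewrite size_polyC vi0.
have sX : size (('X - mu%:P) * (v^-1)%:P) = 2%N.
  by rewrite size_mul ?polyXsubC_eq0 ?polyC_eq0// sq size_XsubC.
suff [] : size (hermp n mu v) = n.+1 /\ size (hermp n.+1 mu v) = n.+2 by [].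
elim: n => [|n [IH0 IH1]]; first by split; [rewrite /hermp /= size_poly1|].
split=> //; rewrite /hermp hermSS -!/(hermp _ _ _).
have s2 : size (('X - mu%:P) * (v^-1)%:P * hermp n.+1 mu v) = n.+3.
  by rewrite size_mul -?size_poly_eq0 ?sX ?IH1.
rewrite size_polyDl ?s2// size_polyN.
apply: leq_ltn_trans (size_polyMleq _ _) _.
rewrite IH0 -polyC_natr -polyCM.
have := size_polyC_leq1 (n.+1%:R * v^-1 : R); move: (size _) => k.
by lia.
Qed.

Let expo mu v : {poly R} := - (2 * v)^-1 *: ('X - mu%:P) ^+ 2 - (ln v / 2)%:P.

Let gkerE n mu v c : gker n mu v c = (hermp n mu v).[c] * expR (expo mu v).[c].
Proof.
rewrite /gker hermpE; congr (_ * expR _); rewrite /expo !hornerE.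
by rewrite expr2 /=; ring.
Qed.

Let deriv_expo mu v : v != 0 -> (expo mu v)^`() = - v^-1 *: ('X - mu%:P).
Proof.
move=> v0; rewrite /expo derivB derivC subr0 derivZ deriv_exp derivB derivX derivC subr0.
rewrite mul1r expr1 -scalerMnr scalerMnl; congr (_ *: _).
by rewrite -mulr_natl; field.
Qed.

(** For fixed [i] the kernels are Hermite polynomials of distinct degrees times one exponential of a
    quadratic, and distinct pairs [(mu i, v i)] give exponents with distinct derivatives. So
    [exp_poly_indep] separates the [i], and leading coefficients separate the [m]. *)
Lemma gker_indep n (mu v : 'I_n -> R) N (e : 'I_n -> 'I_N -> R) :
  (forall i, 0 < v i) -> injective (fun i => (mu i, v i)) ->
  (forall c, \sum_i \sum_m e i m * gker m (mu i) (v i) c = 0) ->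
  forall i m, e i m = 0.
Proof.
move=> v0 inj h.
pose P i := \sum_m e i m *: hermp m (mu i) (v i).
have P0 : forall i, P i = 0.
  apply: (@exp_poly_indep R n P (fun i => expo (mu i) (v i))).
    move=> i j; rewrite !deriv_expo ?gt_eqF// => H.
    apply: inj; have := congr1 (fun p : {poly R} => p`_1) H.
    rewrite !coefZ !coefB !coefX !coefC !subr0 !mulr1 => /oppr_inj/invr_inj vij.
    have := congr1 (fun p : {poly R} => p`_0) H.
    rewrite !coefZ !coefB !coefX !coefC !sub0r vij => /mulfI muij.
    by congr (_, _); apply/oppr_inj/muij; rewrite oppr_eq0 invr_eq0 gt_eqF.
  move=> x; rewrite -[RHS](h x); apply: eq_bigr => i _.
  rewrite /P horner_sum mulr_suml; apply: eq_bigr => m _.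
  by rewrite hornerZ gkerE mulrA.
move=> i; move: (P0 i); rewrite /P; move: (e i) (v0 i).
move: (mu i) (v i) => m0 w f w0; clear -w0 hermp size_hermp.
elim: N f => [|N IH] f; first by move=> _ [].
rewrite big_ord_recr /= => H.
have fN : f ord_max = 0.
  have := congr1 (fun p : {poly R} => p`_N) H; rewrite coefD coef0 coef_sum big1 => [|j _].
    rewrite add0r coefZ => /eqP; rewrite mulf_eq0 => /orP[/eqP//|].
    have := size_hermp N m0 (lt0r_neq0 w0) => sN.
    have : lead_coef (hermp N m0 w) != 0 by rewrite lead_coef_eq0 -size_poly_eq0 sN.
    by rewrite lead_coefE sN => /negPf ->.
  by rewrite coefZ nth_default ?mulr0// size_hermp ?gt_eqF//.
have H' := IH (fun j => f (widen_ord (leqnSn N) j)).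
move: H; rewrite fN scale0r addr0 => /H' {}H' m.
case: (unliftP ord_max m) => [j ->|->//].
by rewrite -(H' j); congr f; apply/val_inj; rewrite /= /bump leqNgt ltn_ord.
Qed.

End gauss_kernel_indep.

Section evaluation_points.
Context (R : realType) (T : Type) (I : finType) (phi : I -> T -> R).
Hypothesis phi_indep : forall e : I -> R,
  (forall c, \sum_i e i * phi i c = 0) -> forall i, e i = 0.
Context (c0 : T).

Let n := #|I|.
Let M k (c : nat -> T) : 'M[R]_(k, n) := \matrix_(l, i) phi (enum_val i) (c l).

Let sum_enum (F : I -> R) : \sum_i F i = \sum_(j < n) F (enum_val j).
Proof. by rewrite -(big_enum_val (A := I)) /=; apply: eq_bigl. Qed.

(** Greedy choice of points. While fewer than [n] are chosen, some nonzero combination of the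
    functions vanishes at all of them; by independence it is nonzero at another point [t], whose row
    is therefore independent of the earlier ones. *)
Let extend_points k : (k <= n)%N -> exists c, row_free (M k c).
Proof.
elim: k => [|k IH] kn.
  by exists (fun=> c0); apply: inj_row_free => v _; apply/rowP; case.
have [c fc] := IH (ltnW kn).
have : kermx (M k c)^T != 0.
  rewrite kermx_eq0; apply/negP; rewrite /row_free mxrank_tr => /eqP rk.
  by have := rank_leq_row (M k c); rewrite rk leqNgt kn.
case/rowV0Pn => e /sub_kermxP eM e0.
have [t ht] : exists t, \sum_i e ord0 (enum_rank i) * phi i t != 0.
  apply: contrapT => /forallNP H; move/negP: e0; apply; apply/eqP/rowP => i.
  rewrite mxE -(enum_valK i); apply: (phi_indep (e := fun i => e ord0 (enum_rank i))) => s.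
  by apply/eqP/negPn/negP; exact: H.
exists (fun l => if l == k then t else c l).
apply: inj_row_free => v vM.
have row (i : 'I_n) : \sum_(l < k) v ord0 (widen_ord (leqnSn k) l) * phi (enum_val i) (c l) +
    v ord0 ord_max * phi (enum_val i) t = 0.
  have := congr1 (fun w : 'rV[R]_n => w ord0 i) vM; rewrite !mxE big_ord_recr /= mxE eqxx => H.
  rewrite -[RHS]H.
  by congr (_ + _); apply: eq_bigr => l _; rewrite mxE /= ltn_eqF.
have eMl (l : 'I_k) : \sum_i e ord0 i * phi (enum_val i) (c l) = 0.
  have := congr1 (fun w : 'rV[R]_k => w ord0 l) eM; rewrite !mxE => H; rewrite -[RHS]H.
  by apply: eq_bigr => i _; rewrite !mxE.
have vmax : v ord0 ord_max = 0.
  have : \sum_i e ord0 i * (\sum_(l < k) v ord0 (widen_ord (leqnSn k) l) *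
      phi (enum_val i) (c l) + v ord0 ord_max * phi (enum_val i) t) = 0.
    by rewrite big1// => i _; rewrite row mulr0.
  under eq_bigr do rewrite mulrDr mulr_sumr.
  rewrite big_split /= exchange_big /= big1 ?add0r => [|l _].
    under eq_bigr do rewrite mulrCA.
    rewrite -mulr_sumr => /eqP; rewrite mulf_eq0 => /orP[/eqP//|/eqP H].
    move/eqP: ht; case; rewrite -[RHS]H sum_enum.
    by apply: eq_bigr => i _; rewrite enum_valK.
  under eq_bigr do rewrite mulrCA.
  by rewrite -mulr_sumr eMl mulr0.
have v0 : \row_l v ord0 (widen_ord (leqnSn k) l) = 0.
  apply: (row_free_inj fc); rewrite mul0mx; apply/rowP => i; rewrite !mxE -[RHS](row i).
  by rewrite vmax mul0r addr0; apply: eq_bigr => l _; rewrite !mxE.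
apply/rowP => l; rewrite [RHS]mxE; case: (unliftP ord_max l) => [j ->|->//].
have := congr1 (fun w : 'rV[R]_k => w ord0 j) v0; rewrite !mxE => H; rewrite -[RHS]H; congr (v _ _).
by apply/val_inj; rewrite /= /bump leqNgt ltn_ord.
Qed.

(** Makes independence quantitative: the evaluation matrix at well-chosen points is invertible, and
    [C] is the sum of the absolute entries of its inverse. *)
Lemma evaluation_points : exists (m : nat) (c : 'I_m -> T) (C : R), 0 <= C /\
  forall (e : I -> R) (B : R),
    (forall l, `|\sum_i e i * phi i (c l)| <= B) -> forall i, `|e i| <= C * B.
Proof.
have [c fc] := extend_points (leqnn n).
have uM : M n c \in unitmx by rewrite -row_free_unit.
pose K := invmx (M n c).
exists n, (fun l => c l), (\sum_i \sum_l `|K i l|); split.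
  by apply: sumr_ge0 => i _; apply: sumr_ge0.
move=> e B h i.
pose ev : 'cV[R]_n := \col_i e (enum_val i).
have B0 : 0 <= B.
  by apply: le_trans (h (enum_rank i)).
have -> : e i = (K *m (M n c *m ev)) (enum_rank i) ord0.
  by rewrite mulmxA mulVmx// mul1mx mxE enum_rankK.
rewrite mxE; apply: le_trans (ler_norm_sum _ _ _) _.
apply: (@le_trans _ _ ((\sum_l `|K (enum_rank i) l|) * B)); last first.
  rewrite ler_wpM2r// [leRHS](bigD1 (enum_rank i))//= lerDl.
  by apply: sumr_ge0 => j _; apply: sumr_ge0.
rewrite mulr_suml; apply: ler_sum => l _; rewrite normrM ler_wpM2l//.
apply: le_trans (h l); rewrite mxE le_eqVlt; apply/orP; left; apply/eqP; congr `|_|.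
rewrite [RHS]sum_enum.
by apply: eq_bigr => j _; rewrite !mxE mulrC.
Qed.

End evaluation_points.

(** * The polynomial system defining rbar *)

Section heat_system.
Context (R : realType).

Lemma rbar_polyE m al (c a b : 'I_m -> R) :
  rbar_poly al c a b = \sum_j c j ^+ 2 * heat_coef al (a j) (b j).
Proof.
rewrite /rbar_poly; apply: eq_bigr => j _; rewrite /heat_coef mulr_sumr.
apply: eq_bigr => n1 _; rewrite mulr_sumr; apply: eq_bigr => n2 _.
by rewrite !mulrA.
Qed.

Lemma heat_coef2 (a b : R) : heat_coef 2 a b = a ^+ 2 / 2 + b.
Proof.
have := heat_coefSS a b 0; rewrite heat_coef1 heat_coef0 => h.
by apply: (@mulfI _ 2) => //; rewrite h; field.
Qed.

Lemma heat_coef3 (a b : R) : 3 * heat_coef 3 a b = a * (a ^+ 2 / 2 + b) + 2 * b * a.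
Proof. by have := heat_coefSS a b 1; rewrite heat_coef1 heat_coef2. Qed.

Lemma heat_coef4_0 (b : R) : heat_coef 4 0 b = b ^+ 2 / 2.
Proof.
have := heat_coefSS 0 b 2; rewrite heat_coef2 => h.
by apply: (@mulfI _ 4) => //; rewrite h; field.
Qed.

(** One atom with [a = 1] balances all others, which have [a = -1], and [b = -1/2] throughout. Order
    2 then vanishes atom by atom, and orders 1 and 3 are multiples of the weighted sum of the [a j],
    which is 0. *)
Lemma is_rbar_ge4 n r : (0 < n)%N -> is_rbar R n r -> (4 <= r)%N.
Proof.
case: n => // n _ [r1 nosol _]; rewrite leqNgt; apply/negP => r4; apply: nosol.
pose c (j : 'I_n.+2) : R := if j == ord0 then Num.sqrt n.+1%:R else 1.
pose a (j : 'I_n.+2) : R := if j == ord0 then 1 else -1.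
exists c, a, (fun=> - 2^-1); split; last 2 first.
- move=> j; rewrite /c; case: ifP => _; last exact: oner_neq0.
  by rewrite gt_eqF// sqrtr_gt0.
- by exists ord0; rewrite /a eqxx oner_neq0.
have ca : \sum_j c j ^+ 2 * a j = 0.
  rewrite big_ord_recl /c /a eqxx sqr_sqrtr// mulr1.
  under eq_bigr do rewrite eq_sym (negPf (neq_lift _ _)) expr1n mul1r.
  by rewrite sumr_const card_ord mulNrn subrr.
have a2 j : a j ^+ 2 = 1 by rewrite /a; case: ifP => _; rewrite ?sqrrN expr1n.
have al2 j : heat_coef 2 (a j) (- 2^-1) = 0 by rewrite heat_coef2 a2; lra.
have al3 j : heat_coef 3 (a j) (- 2^-1) = - 3^-1 * a j.
  apply: (@mulfI _ 3) => //; rewrite heat_coef3 a2; lra.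
move=> al /andP[al1 alr]; rewrite rbar_polyE.
have : al \in [:: 1; 2; 3]%N by rewrite !inE; lia.
rewrite !inE => /or3P[] /eqP ->.
- by under eq_bigr do rewrite heat_coef1.
- by rewrite big1// => j _; rewrite al2 mulr0.
- under eq_bigr do rewrite al3 mulrCA.
  by rewrite -mulr_sumr ca mulr0.
Qed.

(** Absence of nontrivial solutions only gives [a = 0]; the order-4 equation is then a positive
    combination of the [b j ^+ 2] and gives [b = 0]. *)
Lemma heat_system_trivial m r (p a b : 'I_m -> R) :
  ~ has_nontrivial_solution R m r -> (4 <= r)%N -> (forall j, 0 < p j) ->
  (forall al, (1 <= al <= r)%N -> \sum_j p j * heat_coef al (a j) (b j) = 0) ->
  forall j, a j = 0 /\ b j = 0.
Proof.
move=> nosol r4 p0 h.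
have a0 j : a j = 0.
  apply/eqP/negPn/negP => aj0; apply: nosol.
  exists (fun j => Num.sqrt (p j)), a, b; split; last by exists j.
    move=> al alr; rewrite rbar_polyE -[RHS](h _ alr); apply: eq_bigr => i _.
    by rewrite sqr_sqrtr// ltW.
  by move=> i; rewrite gt_eqF// sqrtr_gt0.
suff b0 j : b j = 0 by [].
have := h 4%N; rewrite r4 => /(_ isT).
under eq_bigr do rewrite a0 heat_coef4_0.
move=> /psumr_eq0P H; apply/eqP; rewrite -sqrf_eq0.
have /eqP : p j * (b j ^+ 2 / 2) = 0.
  by apply: H => // i _; rewrite mulr_ge0 ?divr_ge0 ?sqr_ge0// ltW.
by rewrite mulf_eq0 gt_eqF//= mulf_eq0 invr_eq0 pnatr_eq0 orbF.
Qed.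

Section continuous_ops.
Context (T : topologicalType).
Implicit Types f g : T -> R.

Lemma continuous_mulf f g : continuous f -> continuous g -> continuous (fun x => f x * g x).
Proof. by move=> cf cg x; apply: cvgM; [exact: cf|exact: cg]. Qed.

Lemma continuous_expf f n : continuous f -> continuous (fun x => f x ^+ n).
Proof.
by move=> cf x; apply: (@continuous_comp _ _ _ f (fun y => y ^+ n));
  [exact: cf|exact: exprn_continuous].
Qed.

Lemma continuous_normf f : continuous f -> continuous (fun x => `|f x|).
Proof. by move=> cf x; apply: cvg_norm; exact: cf. Qed.

Lemma continuous_cstf (k : R) : continuous (fun _ : T => k).
Proof. by move=> x; exact: cvg_cst. Qed.

Lemma continuous_sumf (I : Type) (s : seq I) (P : pred I) (F : I -> T -> R) :
  (forall i, P i -> continuous (F i)) ->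
  continuous (fun x => \sum_(i <- s | P i) F i x).
Proof. by move=> h; apply: continuous_big => //; exact: add_continuous. Qed.

Lemma continuous_heat_coef al f g : continuous f -> continuous g ->
  continuous (fun x => heat_coef al (f x) (g x)).
Proof.
move=> cf cg; apply: continuous_sumf => i _; apply: continuous_sumf => j _.
apply: continuous_mulf; last exact: continuous_cstf.
by apply: continuous_mulf; exact: continuous_expf.
Qed.

End continuous_ops.

(** A continuous function attains its minimum on a compact set. The bound [c1] keeps the weights
    positive there and the last hypothesis keeps [(a, b)] away from 0, so the minimum cannot be
    0. *)
Lemma heat_system_lower_bound m r c1 :
  ~ has_nontrivial_solution R m r -> (4 <= r)%N -> 0 < c1 ->
  exists2 kappa : R, 0 < kappa & forall p a b : 'I_m -> R,
    (forall j, c1 <= p j <= 1) -> (forall j, `|a j| <= 1) -> (forall j, `|b j| <= 1) ->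
    1 <= \sum_j (a j ^+ 2 + b j ^+ 2) ->
    kappa <= \sum_(al < r) `|\sum_j p j * heat_coef al.+1 (a j) (b j)|.
Proof.
move=> nosol r4 c10.
pose T := ('rV[R]_m * 'rV[R]_m * 'rV[R]_m)%type.
pose pp (x : T) j := x.1.1 ord0 j.
pose aa (x : T) j := x.1.2 ord0 j.
pose bb (x : T) j := x.2 ord0 j.
have cp j : continuous (pp ^~ j).
  move=> x; apply: (@continuous_comp _ _ _ (fun x : T => x.1.1) (fun v : 'rV[R]_m => v ord0 j)).
    by apply: (@continuous_comp _ _ _ fst fst); exact: cvg_fst.
  exact: coord_continuous.
have ca j : continuous (aa ^~ j).
  move=> x; apply: (@continuous_comp _ _ _ (fun x : T => x.1.2) (fun v : 'rV[R]_m => v ord0 j)).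
    by apply: (@continuous_comp _ _ _ fst snd); [exact: cvg_fst|exact: cvg_snd].
  exact: coord_continuous.
have cb j : continuous (bb ^~ j).
  move=> x; apply: (@continuous_comp _ _ _ snd (fun v : 'rV[R]_m => v ord0 j)).
    exact: cvg_snd.
  exact: coord_continuous.
pose F (x : T) := \sum_(al < r) `|\sum_j pp x j * heat_coef al.+1 (aa x j) (bb x j)|.
have cF : continuous F.
  apply: continuous_sumf => al _; apply: continuous_normf; apply: continuous_sumf => j _.
  by apply: continuous_mulf; [exact: cp|exact: continuous_heat_coef].
pose N (x : T) := \sum_j (aa x j ^+ 2 + bb x j ^+ 2).
have cN : continuous N.
  apply: continuous_sumf => j _ x.
  by apply: cvgD; [apply: continuous_expf|apply: continuous_expf].
pose box (u v : R) := [set w : 'rV[R]_m | forall j, `[u, v]%classic (w ord0 j)].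
have cbox u v : compact (box u v).
  by apply: (rV_compact (A := fun=> `[u, v]%classic)) => j; exact: segment_compact.
pose K := (box c1 1 `*` box (-1) 1 `*` box (-1) 1) `&` (N @^-1` [set y | 1 <= y]).
have cK : compact K.
  apply: compact_closedI; first by do 2 apply: compact_setX => //.
  by move/continuous_closedP : cN; apply; exact: closed_ge.
have memK (p a b : 'I_m -> R) :
    (forall j, c1 <= p j <= 1) -> (forall j, `|a j| <= 1) -> (forall j, `|b j| <= 1) ->
    1 <= \sum_j (a j ^+ 2 + b j ^+ 2) ->
    K (\row_j p j, \row_j a j, \row_j b j).
  move=> hp ha hb hN; split.
    split; first split; move=> j /=; rewrite mxE in_itv/= ?hp//.
    - by have := ha j; rewrite ler_norml.
    - by have := hb j; rewrite ler_norml.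
  by rewrite /N /= /aa /bb /=; under eq_bigr do rewrite !mxE.
(* The compact set is empty when [1 < c1], for instance; then any [kappa] will do. *)
have [[x0 Kx0]|K0] := pselect (K !=set0); last first.
  exists 1 => // p a b hp ha hb hN; case: K0.
  by exists (\row_j p j, \row_j a j, \row_j b j); exact: memK.
have [x xK xmin] := compact_EVT_min (ex_intro _ x0 Kx0) cK (continuous_subspaceT cF).
exists (F x); last first.
  move=> p a b hp ha hb hN; have := xmin _ (mem_set (memK _ _ _ hp ha hb hN)).
  move=> H; apply: (le_trans H); apply: ler_sum => al _.
  rewrite le_eqVlt; apply/orP; left; apply/eqP; congr `|_|.
  by apply: eq_bigr => j _; rewrite /pp /aa /bb !mxE.
have F0 y : 0 <= F y by apply: sumr_ge0.
rewrite lt_neqAle F0 andbT eq_sym; apply/negP => /eqP Fx0.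
move: xK; rewrite inE => -[[[xp xa] xb] xN].
have p0 j : 0 < pp x j.
  by have := xp j; rewrite /= in_itv/= => /andP[+ _]; exact: lt_le_trans.
have triv : forall j, aa x j = 0 /\ bb x j = 0.
  apply: (heat_system_trivial nosol r4 p0) => al /andP[al1 alr].
  have alr' : (al.-1 < r)%N by rewrite prednK.
  have /psumr_eq0P H := Fx0.
  have /eqP : `|\sum_j pp x j * heat_coef al.-1.+1 (aa x j) (bb x j)| = 0.
    by apply: (H _ (Ordinal alr')).
  by rewrite normr_eq0 prednK// => /eqP.
move: xN; rewrite /= /N big1 ?ler10// => j _.
by have [-> ->] := triv j; rewrite expr0n addr0.
Qed.

End heat_system.

(** * Lower bound in dimension one *)

Lemma surj_onto_set n m (J : {set 'I_n}) : (0 < #|J| <= m)%N ->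
  exists h : 'I_m -> 'I_n, (forall l, h l \in J) /\ (forall j, j \in J -> exists l, h l = j).
Proof.
move=> /andP[J0 Jm]; have /card_gt0P[j0 j0J] := J0.
exists (fun l => nth j0 (enum J) l); split.
  move=> l; have [lJ|Jl] := ltnP l #|J|.
    by rewrite -mem_enum mem_nth// -cardE.
  by rewrite nth_default// -cardE.
move=> j jJ; have jlt : (index j (enum J) < m)%N.
  by apply: leq_trans Jm; rewrite cardE index_mem mem_enum.
by exists (Ordinal jlt); rewrite /= nth_index// mem_enum.
Qed.

(* A group with fewer than [m] atoms is brought to [m] atoms by splitting the
   weights of its atoms evenly, which does not affect the sums. *)
Lemma group_lower_bound (R : realType) m r (c0 : R) :
  ~ has_nontrivial_solution R m r -> (4 <= r)%N -> 0 < c0 ->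
  exists2 kappa : R, 0 < kappa & forall n (J : {set 'I_n}) (p a b : 'I_n -> R),
    (0 < #|J| <= m)%N ->
    (forall j, c0 <= p j <= 1) ->
    (forall j, j \in J -> `|a j| <= 1 /\ `|b j| <= 1) ->
    (exists2 j, j \in J & 1 <= a j ^+ 2 + b j ^+ 2) ->
    kappa <= \sum_(al < r) `|\sum_(j in J) p j * heat_coef al.+1 (a j) (b j)|.
Proof.
move=> nosol r4 c00.
have [->|m0] := posnP m.
  by exists 1 => // n J p a b /andP[]; case: #|J|.
have mR0 : 0 < m%:R :> R by rewrite ltr0n.
(* An atom is split among at most [m] slots, so each slot carries at least [c0 / m]. *)
have [kappa kappa0 hk] := heat_system_lower_bound nosol r4 (divr_gt0 c00 mR0).
exists kappa => [//|n J p a b cJ hp hab [j1 j1J hj1]].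
have [h [hJ hsurj]] := surj_onto_set cJ.
pose w j : nat := #|[pred l | h l == j]|.
have wgt0 l : (0 < w (h l))%N by apply/card_gt0P; exists l; rewrite inE.
have wm j : (w j <= m)%N by rewrite -[leqRHS]card_ord max_card.
pose q l := p (h l) / (w (h l))%:R.
have sumq (F : 'I_n -> R) : \sum_l q l * F (h l) = \sum_(j in J) p j * F j.
  rewrite (partition_big h (mem J)) //=; apply: eq_bigr => j jJ.
  have [l0 hl0] := hsurj _ jJ.
  rewrite (eq_bigr (fun=> p j / (w j)%:R * F j)); last first.
    by move=> l /eqP <-.
  rewrite sumr_const -[LHS]mulr_natl -/(w j); set k : R := (w j)%:R.
  have k0 : k != 0 by rewrite pnatr_eq0 -lt0n -hl0.
  by clearbody k; field.
have -> : \sum_(al < r) `|\sum_(j in J) p j * heat_coef al.+1 (a j) (b j)| =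
   \sum_(al < r) `|\sum_l q l * heat_coef al.+1 (a (h l)) (b (h l))|.
  apply: eq_bigr => al _; congr `|_|.
  by rewrite (sumq (fun j => heat_coef al.+1 (a j) (b j))).
apply: hk.
- move=> l; have /andP[p1 p2] := hp (h l); apply/andP; split.
    apply: ler_pM => //; first exact: ltW.
    by rewrite lef_pV2 ?posrE ?ltr0n// ler_nat.
  rewrite /q ler_pdivrMr ?ltr0n// mul1r (le_trans p2)// ler1n//.
- by move=> l; case: (hab _ (hJ l)).
- by move=> l; case: (hab _ (hJ l)).
have [l hl] := hsurj _ j1J.
rewrite (bigD1 l)//= hl (le_trans hj1)// lerDl sumr_ge0// => i _.
by rewrite addr_ge0// sqr_ge0.
Qed.

Section mixture1d.
Context (R : realType) (k0 m r : nat) (mu0 v0 p0 : 'I_k0 -> R) (c0 : R).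
Hypotheses (nosol : ~ has_nontrivial_solution R m r) (r4 : (4 <= r)%N).
Hypotheses (c0_gt0 : 0 < c0) (v01 : forall i, 1 <= v0 i).
Hypothesis inj0 : injective (fun i => (mu0 i, v0 i)).

Let V := 2 + \sum_i v0 i.

Let v0V i : v0 i + 1 <= V.
Proof.
rewrite /V (bigD1 i)//=; have : 0 <= \sum_(j | j != i) v0 j.
  by apply: sumr_ge0 => j _; apply: le_trans (v01 j).
by lra.
Qed.

(** [rho <= 1/2] keeps the variance at least 1/2 along the path, where the kernels are uniformly
    bounded. Indices up to [2 * r.+1] are needed because [gpath_taylor] uses two per order. *)
Let gker_expand : exists2 D : R, 0 <= D & forall i (a b rho c : R),
  `|a| <= 1 -> `|b| <= 1 -> 0 <= rho <= 2^-1 ->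
  `|gker 0 (mu0 i + a * rho) (v0 i + 2 * b * rho ^+ 2) c -
    \sum_(l < r.+1) rho ^+ l * heat_coef l a b * gker l (mu0 i) (v0 i) c|
  <= D * rho ^+ r.+1.
Proof.
have V0 : 0 < V.
  by rewrite /V ltr_pwDl// sumr_ge0// => i _; apply: le_trans (v01 i).
have [B B0 hB] := gker_bounded (2 * r.+1) V0.
exists (3 ^+ r.+1 * B); first by rewrite mulr_ge0 ?exprn_ge0.
move=> i a b rho c a1 b1 /andP[rho0 rho2].
have vr t : 0 <= t <= rho -> 2^-1 <= v0 i + 2 * b * t ^+ 2 <= V.
  move=> /andP[t0 trho]; have := v0V i; have := v01 i.
  have : `|b * t ^+ 2| <= 4^-1.
    rewrite normrM -[leRHS]mul1r ler_pM// ger0_norm ?sqr_ge0//.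
    have : t <= 2^-1 by exact: le_trans rho2.
    by move=> t2; nra.
  rewrite -mulrA ler_norml => /andP[h1 h2] h3 h4; apply/andP; split; lra.
have T1 : rho <= 1 by apply: le_trans rho2 _; lra.
have := @gpath_taylor R (mu0 i) (v0 i) c a b rho B (2 * r.+1) a1 b1 T1 _ _ r.+1 0 rho.
rewrite /gremainder /gpath; under eq_bigr do rewrite mulr0 addr0 expr0n mulr0 addr0 add0n mulrA.
apply.
- by move=> t /vr/andP[h _]; apply: lt_le_trans h; rewrite invr_gt0.
- by move=> n t nM /vr h; apply: hB.
- by [].
- by rewrite rho0 lexx.
Qed.

Let kernel_points : exists2 C : R, 0 <= C & forall (e : 'I_k0 -> 'I_r.+1 -> R) (B : R),
  (forall c, `|\sum_i \sum_l e i l * gker l (mu0 i) (v0 i) c| <= B) ->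
  forall i l, `|e i l| <= C * B.
Proof.
have indep (e : 'I_k0 * 'I_r.+1 -> R) :
    (forall c, \sum_z e z * gker z.2 (mu0 z.1) (v0 z.1) c = 0) -> forall z, e z = 0.
  move=> h [i l]; apply: (gker_indep (fun i => lt_le_trans ltr01 (v01 i)) inj0
    (e := fun i l => e (i, l))) => c.
  by rewrite pair_bigA -[RHS](h c); apply: eq_bigr => -[].
have [n [c [C [C0 h]]]] := evaluation_points indep 0.
exists C => // e B hB i l.
apply: (h (fun z => e z.1 z.2) B _ (i, l)) => j.
by move: (hB (c j)); rewrite pair_bigA.
Qed.

(** With the Taylor terms collected at each fixed atom, the coefficients [e i l] are bounded by a
    multiple of [B] plus the sum of the [rho i ^+ r.+1]. Those with [1 <= l] dominate
    [kappa * rho i ^+ r], and small radii make the remainder a fraction of this. Order 0 then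
    compares the group weights with [p0]. *)
Lemma mixture1d_lower_bound : exists eps C : R, [/\ 0 < eps, 0 <= C &
  forall n (p mu v : 'I_n -> R) (g : 'I_n -> 'I_k0) (B : R),
    (forall j, c0 <= p j) -> \sum_j p j <= 1 ->
    (forall i, (0 < #|[set j | g j == i]%SET| <= m)%N) ->
    (forall j, `|mu j - mu0 (g j)| <= eps) ->
    (forall j, `|v j - v0 (g j)| <= eps) ->
    (forall c, `|\sum_j p j * gker 0 (mu j) (v j) c -
       \sum_i p0 i * gker 0 (mu0 i) (v0 i) c| <= B) ->
    (forall j, `|mu j - mu0 (g j)| ^+ r <= C * B /\ `|v j - v0 (g j)| ^+ r <= C * B) /\
    (forall i, `|\sum_(j | g j == i) p j - p0 i| <= C * B)].
Proof.
have [D D0 hD] := gker_expand.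
have [C1 C10 hC1] := kernel_points.
have [kappa kappa0 hkappa] := group_lower_bound nosol r4 c0_gt0.
pose K := k0%:R * r%:R * C1.
have K0 : 0 <= K by rewrite !mulr_ge0.
(* Makes the total Taylor remainder cost at most half of [kappa], so that it can be absorbed in the
   left side. *)
pose rmax := Num.min 2^-1 (kappa / 2 / (K * D + 1)).
have KD0 : 0 < K * D + 1 by rewrite ltr_pwDr// mulr_ge0.
have rmax0 : 0 < rmax by rewrite lt_min invr_gt0 ltr0n/= !divr_gt0.
have rmax2 : rmax <= 2^-1 by rewrite ge_min lexx.
have rmaxK : K * D * rmax <= kappa / 2.
  apply: le_trans (_ : (K * D + 1) * rmax <= _).
    by rewrite ler_wpM2r ?lerDl// ltW.
  by rewrite mulrC -ler_pdivlMr// ge_min lexx orbT.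
pose C2 := 2 * K / kappa.
have C20 : 0 <= C2 by rewrite divr_ge0 ?mulr_ge0// ltW.
have C1D : 0 <= C1 * (1 + D * C2).
  by apply: mulr_ge0 => //; apply: addr_ge0 => //; exact: mulr_ge0.
have C2r : 0 <= 2 ^+ r * C2 by apply: mulr_ge0 => //; exact: exprn_ge0.
(* The radius [rh] below contains the square root of the variance shift, hence the square. *)
exists (rmax ^+ 2), (2 ^+ r * C2 + C1 * (1 + D * C2)); split.
- by rewrite exprn_gt0.
- exact: addr_ge0.
move=> n p mu v g B pc p1 cJ hmu hv hB.
have pge0 j : 0 <= p j by apply: le_trans (pc j); rewrite ltW.
have ple1 j : p j <= 1.
  by apply: le_trans p1; rewrite (bigD1 j)//= lerDl sumr_ge0.
have sump i : \sum_(j | g j == i) p j <= 1.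
  apply: le_trans p1; rewrite [leRHS](bigID (fun j => g j == i))/= lerDl sumr_ge0//.
pose dmu j := mu j - mu0 (g j); pose dv j := v j - v0 (g j).
(* After division by the largest radius of a group, all [|a j|] and [|b j|] are at most 1, and one
   of them equals 1 at the atom [js i] unless that radius is 0. *)
pose rh j := Num.max `|dmu j| (Num.sqrt (`|dv j| / 2)).
have rh0 j : 0 <= rh j by rewrite le_max normr_ge0.
have rhmax j : rh j <= rmax.
  rewrite ge_max; apply/andP; split.
    apply: (le_trans (hmu j)); rewrite expr2 ger_pMr//.
    by apply: (le_trans rmax2); lra.
  have rE : Num.sqrt (rmax ^+ 2) = rmax by rewrite sqrtr_sqr ger0_norm// ltW.
  rewrite -rE; apply: ler_wsqrtr.
  by have := hv j; rewrite -/(dv j); have := normr_ge0 (dv j); lra.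
have hmax i : exists j1, g j1 = i /\ forall j, g j = i -> rh j <= rh j1.
  have /andP[/card_gt0P[j0]] := cJ i; rewrite inE => gj0 _.
  case: (@Order.TotalTheory.arg_maxP _ _ _ j0 (fun j => g j == i) rh gj0) => j1 /eqP gj1 h.
  by exists j1; split=> // j /eqP; exact: h.
have [js hjs] := choice hmax.
pose rho i := rh (js i).
have rho0 i : 0 <= rho i by exact: rh0.
have rhomax i : rho i <= rmax by exact: rhmax.
have rhle j : rh j <= rho (g j) by have [_] := hjs (g j); exact.
(* If the radius is 0 these quotients are 0 by convention, and [aE] and [bE] still hold since both
   shifts vanish. *)
pose a j := dmu j / rho (g j); pose b j := dv j / 2 / rho (g j) ^+ 2.
have dmule j : `|dmu j| <= rho (g j).
  by apply: le_trans (rhle j); rewrite le_max lexx.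
have sqle j : Num.sqrt (`|dv j| / 2) <= rho (g j).
  by apply: le_trans (rhle j); rewrite le_max lexx orbT.
have dvle j : `|dv j| / 2 <= rho (g j) ^+ 2.
  by rewrite -[leLHS]sqr_sqrtr ?divr_ge0// lerXn2r ?nnegrE ?sqrtr_ge0.
have aE j : mu j = mu0 (g j) + a j * rho (g j).
  have [z|z] := eqVneq (rho (g j)) 0; last by rewrite /a divfK// /dmu; lra.
  have := dmule j; rewrite z normr_le0 => /eqP; rewrite /dmu mulr0; lra.
have bE j : v j = v0 (g j) + 2 * b j * rho (g j) ^+ 2.
  have [z|z] := eqVneq (rho (g j)) 0; last first.
    by rewrite /b -mulrA divfK ?expf_neq0// /dv; lra.
  have := dvle j; rewrite z expr0n mulr0 ler_pdivrMr// mul0r normr_le0 => /eqP; rewrite /dv; lra.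
have a1 j : `|a j| <= 1.
  have [z|z] := eqVneq (rho (g j)) 0; first by rewrite /a z invr0 mulr0 normr0.
  by rewrite /a normrM normfV (ger0_norm (rho0 _)) ler_pdivrMr ?mul1r// lt_def z rho0.
have b1 j : `|b j| <= 1.
  have [z|z] := eqVneq (rho (g j)) 0; first by rewrite /b z expr0n invr0 mulr0 normr0.
  rewrite /b normrM normfV (ger0_norm (sqr_ge0 _)) ler_pdivrMr ?mul1r.
    by rewrite normrM (ger0_norm (_ : 0 <= 2^-1)).
  by rewrite lt_def sqr_ge0 andbT expf_neq0.
pose e i (l : 'I_r.+1) := \sum_(j | g j == i) p j * (rho i ^+ l * heat_coef l (a j) (b j))
   - (if l == ord0 then p0 i else 0).
pose S := \sum_i rho i ^+ r.+1; pose Sr := \sum_i rho i ^+ r.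
have S0 : 0 <= S by apply: sumr_ge0 => i _; rewrite exprn_ge0.
have SSr : S <= rmax * Sr.
  rewrite mulr_sumr; apply: ler_sum => i _; rewrite exprS ler_wpM2r ?exprn_ge0//.
have eB c : `|\sum_i \sum_l e i l * gker l (mu0 i) (v0 i) c| <= B + D * S.
  pose T j := \sum_(l < r.+1) rho (g j) ^+ l * heat_coef l (a j) (b j) *
    gker l (mu0 (g j)) (v0 (g j)) c.
  have -> : \sum_i \sum_l e i l * gker l (mu0 i) (v0 i) c =
    \sum_j p j * T j - \sum_i p0 i * gker 0 (mu0 i) (v0 i) c.
    rewrite (partition_big g xpredT)//= -sumrB; apply: eq_bigr => i _.
    under eq_bigr do rewrite mulrBl.
    rewrite sumrB; congr (_ - _); last first.
      rewrite big_ord_recl eqxx big1 ?addr0// => l _.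
      by rewrite eq_sym (negPf (neq_lift _ _)) mul0r.
    under [LHS]eq_bigr do rewrite mulr_suml.
    rewrite exchange_big /=; apply: eq_bigr => j /eqP <-.
    rewrite /T mulr_sumr; apply: eq_bigr => l _; ring.
  have -> : \sum_j p j * T j - \sum_i p0 i * gker 0 (mu0 i) (v0 i) c =
    (\sum_j p j * gker 0 (mu j) (v j) c - \sum_i p0 i * gker 0 (mu0 i) (v0 i) c) -
    \sum_j p j * (gker 0 (mu j) (v j) c - T j).
    have -> : \sum_j p j * (gker 0 (mu j) (v j) c - T j) =
      \sum_j p j * gker 0 (mu j) (v j) c - \sum_j p j * T j.
      by rewrite -sumrB; apply: eq_bigr => j _; rewrite mulrBr.
    by ring.
  apply: le_trans (ler_normB _ _) _; rewrite lerD//.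
  apply: le_trans (ler_norm_sum _ _ _) _.
  rewrite (partition_big g xpredT)//= mulr_sumr; apply: ler_sum => i _.
  apply: le_trans (_ : \sum_(j | g j == i) p j * (D * rho i ^+ r.+1) <= _).
    apply: ler_sum => j /eqP gji; rewrite normrM (ger0_norm (pge0 _)) ler_wpM2l//.
    rewrite {1}aE {1}bE -gji /T; apply: hD => //.
    by rewrite rho0/=; apply: le_trans rmax2.
  by rewrite -mulr_suml ler_piMl ?mulr_ge0 ?exprn_ge0.
have eb := hC1 e _ eB.
have B0 : 0 <= B by apply: le_trans (hB 0).
(* Radii are at most 1, so [rho i ^+ r] is below every [rho i ^+ l] with [l <= r], and all orders
   may be weakened to order [r]. *)
have krho i : kappa * rho i ^+ r <= r%:R * (C1 * (B + D * S)).
  have [z|z] := eqVneq (rho i) 0.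
    rewrite z expr0n gtn_eqF; last exact: leq_trans r4.
    rewrite mulr0; apply: mulr_ge0 => //; apply: mulr_ge0 => //.
    by apply: addr_ge0 => //; exact: mulr_ge0.
  have rp : 0 < rho i by rewrite lt_def z rho0.
  have ri1 : rho i <= 1 by apply: (le_trans (rhomax i)); apply: (le_trans rmax2); lra.
  have hk : kappa <= \sum_(al < r) `|\sum_(j in [set j | g j == i]%SET)
      p j * heat_coef al.+1 (a j) (b j)|.
    apply: hkappa => //; first by move=> j; rewrite pc ple1.
    have [gji _] := hjs i; exists (js i); first by rewrite inE gji.
    have : rh (js i) = rho (g (js i)) by rewrite gji.
    rewrite /rh; case: (leP `|dmu (js i)| (Num.sqrt (`|dv (js i)| / 2))) => _ E.
      have : `|b (js i)| = 1.
        rewrite /b normrM normfV (ger0_norm (sqr_ge0 _)) -E sqr_sqrtr ?divr_ge0//.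
        rewrite normrM (ger0_norm (_ : 0 <= 2^-1))// divff//.
        by apply: contraNneq z => h; rewrite -gji -E h sqrtr0.
      by rewrite -(real_normK (num_real (b _))) => ->; rewrite expr1n lerDr sqr_ge0.
    have : `|a (js i)| = 1.
      by rewrite /a normrM normfV (ger0_norm (rho0 _)) E divff// gji.
    by rewrite -(real_normK (num_real (a _))) => ->; rewrite expr1n lerDl sqr_ge0.
  apply: le_trans (ler_wpM2r (exprn_ge0 r (rho0 i)) hk) _.
  rewrite mulr_suml mulr_natl -[X in _ *+ X]card_ord -sumr_const; apply: ler_sum => al _.
  apply: le_trans (eb i (lift ord0 al)).
  rewrite /e eq_sym (negPf (neq_lift _ _)) subr0 lift0.
  have -> : \sum_(j | g j == i) p j * (rho i ^+ al.+1 * heat_coef al.+1 (a j) (b j)) =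
     (\sum_(j in [set j | g j == i]%SET) p j * heat_coef al.+1 (a j) (b j)) * rho i ^+ al.+1.
    rewrite mulr_suml; under [RHS]eq_bigl do rewrite inE.
    by apply: eq_bigr => j _; ring.
  rewrite normrM ler_wpM2l// ger0_norm ?exprn_ge0//.
  by rewrite ler_wiXn2l// ltn_ord.
have SrB : Sr <= C2 * B.
  have : kappa * Sr <= K * (B + D * S).
    rewrite mulr_sumr.
    apply: le_trans (ler_sum _ (fun i _ => krho i)) _.
    by rewrite sumr_const card_ord -[leLHS]mulr_natl /K !mulrA.
  have : K * (D * S) <= kappa / 2 * Sr.
    apply: le_trans (_ : K * D * (rmax * Sr) <= _).
      by rewrite mulrA ler_wpM2l// mulr_ge0.
    by rewrite mulrA ler_wpM2r// sumr_ge0// => i _; rewrite exprn_ge0.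
  have -> : C2 * B = 2 * K * B / kappa by rewrite /C2; ring.
  rewrite ler_pdivlMr//; lra.
have Sr0 : 0 <= Sr by apply: sumr_ge0 => i _; rewrite exprn_ge0.
have rhoSr i : rho i ^+ r <= Sr.
  by rewrite /Sr (bigD1 i)//= lerDl sumr_ge0// => j _; rewrite exprn_ge0.
have SSr' : S <= C2 * B.
  apply: (le_trans SSr); apply: le_trans SrB; rewrite ler_piMl//.
  by apply: (le_trans rmax2); lra.
have pow2 : 1 <= 2 ^+ r :> R by rewrite exprn_ege1// ler1n.
have big1 : 2 ^+ r * (C2 * B) <= (2 ^+ r * C2 + C1 * (1 + D * C2)) * B.
  by rewrite mulrDl -mulrA lerDl mulr_ge0.
split.
  move=> j; split.
    apply: le_trans big1; apply: (@le_trans _ _ (C2 * B)); last by rewrite ler_peMl// mulr_ge0.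
    apply: le_trans SrB; apply: le_trans (rhoSr (g j)).
    by rewrite lerXn2r ?nnegrE//; exact: dmule.
  apply: le_trans big1; apply: (@le_trans _ _ (2 ^+ r * Sr)); last first.
    by rewrite ler_wpM2l// exprn_ge0.
  apply: (@le_trans _ _ ((2 * rho (g j)) ^+ r)).
    rewrite lerXn2r ?nnegrE ?mulr_ge0//.
    have := dvle j; rewrite -/(dv j).
    have : rho (g j) ^+ 2 <= rho (g j).
      rewrite expr2 ler_piMr//; apply: (le_trans (rhomax _)); apply: (le_trans rmax2); lra.
    lra.
  by rewrite exprMn ler_wpM2l// exprn_ge0.
move=> i; have := eb i ord0.
rewrite /e eqxx; under eq_bigr do rewrite expr0 heat_coef0 !mulr1.
move=> H; apply: (le_trans H); rewrite mulrDl.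
apply: (@le_trans _ _ (C1 * (1 + D * C2) * B)); last first.
  by rewrite lerDr; exact: mulr_ge0.
rewrite -mulrA ler_wpM2l// mulrDl mul1r lerD2l -mulrA ler_wpM2l//.
Qed.

End mixture1d.

(** * Separating directions *)

(** The sum determines the larger exponent, because [2^u + 2^v < 2^w + 2^s] when [u <= v < s]. *)
Lemma addn_exp2_inj (a b c e : nat) :
  (2 ^ a + 2 ^ b = 2 ^ c + 2 ^ e)%N -> (a = c /\ b = e) \/ (a = e /\ b = c).
Proof.
have key x y z t : (x <= y)%N -> (z <= t)%N -> (2 ^ x + 2 ^ y = 2 ^ z + 2 ^ t)%N ->
    x = z /\ y = t.
  have lt u v w s : (u <= v)%N -> (v < s)%N -> (2 ^ u + 2 ^ v < 2 ^ w + 2 ^ s)%N.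
    move=> uv vs; apply: (@leq_trans (2 ^ s).+1); last first.
      by rewrite -addn1 addnC leq_add2r expn_gt0.
    rewrite ltnS; apply: leq_trans (leq_pexp2l (isT : 0 < 2)%N vs).
    by rewrite expnS mul2n -addnn leq_add2r leq_pexp2l.
  move=> xy zt e0; case: (ltngtP y t) => yt.
  - by have := lt _ _ z _ xy yt; rewrite e0 ltnn.
  - by have := lt _ _ x _ zt yt; rewrite e0 ltnn.
  - split=> //; move: e0; rewrite yt => /eqP; rewrite eqn_add2r => /eqP.
    exact: expnI.
move=> h; case: (leqP a b) => ab; case: (leqP c e) => ce.
- by left; exact: key.
- by right; apply/and_comm; have := key _ _ _ _ ab (ltnW ce); rewrite h addnC => /(_ erefl) [-> ->].
- by right; have := key _ _ _ _ (ltnW ab) ce; rewrite addnC h => /(_ erefl) [-> ->].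
- by left; have := key _ _ _ _ (ltnW ab) (ltnW ce); rewrite addnC h addnC => /(_ erefl) [-> ->].
Qed.

Section directions.
Context (R : realType) (d : nat).
Implicit Types (y : 'cV[R]_d) (S : 'M[R]_d) (z : R).

(* On this curve [dotv _ y] and [quad S _] are polynomials in [z] whose
   coefficients are the entries of [y] and [S], up to a factor 2. *)
Definition curve z : 'cV[R]_d := \col_i z ^+ (2 ^ i).

Definition dot_poly y : {poly R} := \sum_i y i ord0 *: 'X^(2 ^ i).

Definition quad_poly S : {poly R} := \sum_i \sum_j S i j *: 'X^(2 ^ i + 2 ^ j).

Lemma horner_dot_poly y z : (dot_poly y).[z] = dotv (curve z) y.
Proof.
rewrite dotvE horner_sum; apply: eq_bigr => i _.
by rewrite hornerZ hornerXn mxE mulrC.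
Qed.

Lemma horner_quad_poly S z : (quad_poly S).[z] = quad S (curve z).
Proof.
rewrite quadE horner_sum.
under eq_bigr do rewrite horner_sum.
rewrite exchange_big /=; apply: eq_bigr => j _; rewrite mulr_suml.
by apply: eq_bigr => i _; rewrite hornerZ hornerXn !mxE exprD; ring.
Qed.

Lemma coef_dot_poly y (i : 'I_d) : (dot_poly y)`_(2 ^ i) = y i ord0.
Proof.
rewrite coef_sum (bigD1 i)//= coefZ coefXn eqxx mulr1 big1 ?addr0// => j ji.
rewrite coefZ coefXn (_ : (_ == _) = false) ?mulr0//.
by apply: contraNF ji => /eqP/(expnI (isT : 1 < 2)%N)/val_inj ->.
Qed.

(** An off-diagonal exponent arises from [(i, j)] and from [(j, i)], and by [addn_exp2_inj] from no
    other pair. *)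
Lemma coef_quad_poly S (i j : 'I_d) : S^T = S ->
  (quad_poly S)`_(2 ^ i + 2 ^ j) = if i == j then S i j else 2 * S i j.
Proof.
move=> sS; rewrite coef_sum.
have ind (i' j' : 'I_d) : (2 ^ i + 2 ^ j == 2 ^ i' + 2 ^ j')%N%:R =
    ((i' == i) && (j' == j))%:R + ((i' == j) && (j' == i))%:R -
    ((i == j) && ((i' == i) && (j' == j)))%:R :> R.
  have -> : (2 ^ i + 2 ^ j == 2 ^ i' + 2 ^ j')%N =
      ((i' == i) && (j' == j)) || ((i' == j) && (j' == i)).
    apply/eqP/orP.
      move=> /addn_exp2_inj [[/val_inj-> /val_inj->]|[/val_inj-> /val_inj->]].
        by left; rewrite !eqxx.
      by right; rewrite !eqxx.
    by case=> /andP[/eqP-> /eqP->]//; rewrite addnC.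
  have [<-|ij] := eqVneq i j.
    by case: (i' == i); case: (j' == i); rewrite /= ?subr0 ?addrK ?addr0.
  have [->|i'i] := eqVneq i' i; have [->|j'j] := eqVneq j' j => /=.
  - by rewrite (negPf ij) /= subr0 addr0.
  - by rewrite (negPf ij) /= subr0 addr0.
  - by rewrite subr0 add0r.
  - by rewrite subr0 add0r.
have delta (a b : 'I_d) (k : bool) :
    \sum_i' \sum_j' S i' j' * (k && ((i' == a) && (j' == b)))%:R = k%:R * S a b.
  rewrite (bigD1 a)//= (bigD1 b)//= !eqxx /= andbT big1 ?addr0 => [|j' j'b]; last first.
    by rewrite (negPf j'b) !andbF mulr0.
  rewrite big1 ?addr0 => [|i' i'a]; first by rewrite mulrC.
  by rewrite big1// => j' _; rewrite (negPf i'a) andbF mulr0.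
have delta1 (a b : 'I_d) : \sum_i' \sum_j' S i' j' * ((i' == a) && (j' == b))%:R = S a b.
  by rewrite (delta a b true) mul1r.
transitivity (\sum_i' \sum_j' (S i' j' * (true && ((i' == i) && (j' == j)))%:R +
    S i' j' * (true && ((i' == j) && (j' == i)))%:R -
    S i' j' * ((i == j) && ((i' == i) && (j' == j)))%:R)).
  apply: eq_bigr => i' _; rewrite coef_sum; apply: eq_bigr => j' _.
  by rewrite coefZ coefXn ind mulrBr mulrDr.
under eq_bigr do rewrite big_split big_split /= sumrN.
rewrite big_split big_split /= sumrN delta !delta1.
have -> : S j i = S i j by rewrite -{1}sS mxE.
by case: eqP => [->|_]; rewrite ?mul1r ?mul0r ?subr0; ring.
Qed.

Lemma size_quad_poly S : (size (quad_poly S) <= (2 ^ d + 2 ^ d).+1)%N.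
Proof.
apply: (leq_trans (size_sum _ _ _)); apply/bigmax_leqP => i _.
apply: (leq_trans (size_sum _ _ _)); apply/bigmax_leqP => j _.
apply: (leq_trans (size_scale_leq _ _)); rewrite size_polyXn ltnS.
by rewrite leq_add// leq_pexp2l// ltnW.
Qed.

Lemma size_dot_poly y : (size (dot_poly y) <= (2 ^ d + 2 ^ d).+1)%N.
Proof.
apply: (leq_trans (size_sum _ _ _)); apply/bigmax_leqP => i _.
apply: (leq_trans (size_scale_leq _ _)); rewrite size_polyXn ltnS.
by rewrite (leq_trans (_ : 2 ^ i <= 2 ^ d)%N) ?leq_addr// leq_pexp2l// ltnW.
Qed.

Lemma enorm_ge0 m n (A : 'M[R]_(m, n)) : 0 <= enorm A.
Proof. exact: sqrtr_ge0. Qed.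

Lemma enorm_le_entries m n (A : 'M[R]_(m, n)) B : 0 <= B ->
  (forall i j, `|A i j| <= B) -> enorm A <= (m * n).+1%:R * B.
Proof.
move=> B0 h; have K0 : 0 <= (m * n).+1%:R * B by rewrite mulr_ge0.
rewrite -[leRHS](ger0_norm K0) -sqrtr_sqr; apply: ler_wsqrtr.
apply: (@le_trans _ _ (\sum_(i < m) \sum_(j < n) B ^+ 2)).
  apply: ler_sum => i _; apply: ler_sum => j _.
  by rewrite -(real_normK (num_real (A i j))) lerXn2r ?nnegrE.
rewrite !sumr_const !card_ord -mulrnA -[leLHS]mulr_natl exprMn mulnC.
rewrite ler_wpM2r ?exprn_ge0// -natrX ler_nat.
by apply: (@leq_trans (m * n).+1); rewrite ?leqnSn// expnS expn1 leq_pmulr.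
Qed.

(** Directions are taken on the curve away from the roots of [Q], which include every [z] at which
    two projected atoms coincide. Monomials remain independent off these roots, so
    [evaluation_points] recovers all coefficients, hence all entries, from finitely many [z]. *)
Lemma separating_directions k0 (th : 'I_k0 -> 'cV[R]_d) (S : 'I_k0 -> 'M[R]_d) :
  (0 < d)%N -> (forall i, (S i)^T = S i) -> injective (fun i => (th i, S i)) ->
  exists (N : nat) (u : 'I_N -> 'cV[R]_d) (C : R), [/\ 0 <= C,
    forall l, u l != 0,
    forall l, injective (fun i => (dotv (u l) (th i), quad (S i) (u l))) &
    forall (y : 'cV[R]_d) (A : 'M[R]_d) B, A^T = A ->
      (forall l, `|dotv (u l) y| <= B) -> (forall l, `|quad A (u l)| <= B) ->
      enorm y <= C * B /\ enorm A <= C * B].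
Proof.
move=> d0 sS inj.
(* Vanishes wherever the atoms [i] and [j] have the same projection: the means are compared if they
   differ, the covariances otherwise. *)
pose q i j := let p := dot_poly (th i - th j) in
  if p == 0 then quad_poly (S i - S j) else p.
have q0 i j : i != j -> q i j != 0.
  move=> ij; rewrite /q; case: ifP => [/eqP p0|->//]; apply/eqP => p1.
  move/eqP: ij; apply; apply: inj; congr (_, _).
    apply/eqP; rewrite -subr_eq0; apply/eqP/colP => a.
    by rewrite -coef_dot_poly p0 coef0 mxE.
  apply/eqP; rewrite -subr_eq0; apply/eqP/matrixP => a b.
  have sD : (S i - S j)^T = S i - S j by rewrite linearB /= !sS.
  rewrite [RHS]mxE; have := coef_quad_poly a b sD; rewrite p1 coef0.
  by case: eqP => [_ <-//|_ /esym/eqP]; rewrite mulf_eq0 pnatr_eq0 => /eqP.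
(* The factor ['X] excludes [z = 0], so that the direction, whose first coordinate is [z], is
   nonzero. *)
pose Q := 'X * \prod_i \prod_(j | i != j) q i j.
have Q0 : Q != 0.
  rewrite mulf_neq0 ?polyX_eq0//; apply/prodf_neq0 => i _.
  by apply/prodf_neq0 => j; exact: q0.
pose T := {z : R | Q.[z] != 0}.
have [z0 hz0] : exists z, Q.[z] != 0.
  apply: contrapT => /forallNP h; move/eqP: Q0; apply.
  by apply: poly_eq0_fun => z; apply/eqP/negPn/negP; exact: h.
pose M := (2 ^ d + 2 ^ d).+1.
pose phi (l : 'I_M) (z : T) : R := val z ^+ l.
have indep (e : 'I_M -> R) : (forall z : T, \sum_l e l * phi l z = 0) -> forall l, e l = 0.
  move=> h l; pose p := \poly_(i < M) e (inord i).
  have hp z : Q.[z] != 0 -> p.[z] = 0.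
    move=> Qz; rewrite horner_poly -[RHS](h (exist _ z Qz)); apply: eq_bigr => i _.
    by rewrite inord_val.
  have : Q * p = 0.
    apply: poly_eq0_fun => z; rewrite hornerM.
    by have [->|/hp ->] := eqVneq Q.[z] 0; rewrite ?mul0r ?mulr0.
  move/eqP; rewrite mulf_eq0 (negPf Q0) /= => /eqP/(congr1 (fun p : {poly R} => p`_l)).
  by rewrite coef_poly ltn_ord inord_val coef0.
have [N [c [C [C0 hC]]]] := evaluation_points indep (exist _ z0 hz0).
have bound (p : {poly R}) B : (size p <= M)%N ->
    (forall l, `|p.[val (c l)]| <= B) -> forall i, `|p`_i| <= C * `|B|.
  move=> sp hB i.
  have hB' l : `|\sum_(k < M) p`_k * phi k (c l)| <= `|B|.
    apply: (@le_trans _ _ B); last exact: ler_norm.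
    by rewrite -horner_coef_wide.
  have [iM|Mi] := ltnP i M; first exact: (hC (fun k => p`_k) _ hB' (Ordinal iM)).
  by rewrite nth_default ?normr0 ?mulr_ge0// (leq_trans sp).
exists N, (fun l => curve (val (c l))), ((d * d).+1%:R * C); split.
- by rewrite mulr_ge0.
- move=> l; apply/eqP => /colP/(_ (Ordinal d0)); rewrite !mxE expn0 expr1 => cl0.
  by have := valP (c l); rewrite cl0 hornerM hornerX mul0r eqxx.
- move=> l i j [h1 h2]; apply/eqP/negPn/negP => ij.
  have : Q.[val (c l)] != 0 := valP (c l).
  rewrite hornerM mulf_eq0 => /norP[_].
  rewrite horner_prod => /prodf_neq0/(_ i isT).
  rewrite horner_prod => /prodf_neq0/(_ j ij); rewrite /q.
  case: ifP => _; rewrite ?horner_dot_poly ?horner_quad_poly.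
    have -> : quad (S i - S j) (curve (val (c l))) =
        quad (S i) (curve (val (c l))) - quad (S j) (curve (val (c l))).
      by rewrite !dotv_quad mulmxBl dotvBr.
    by rewrite h2 subrr eqxx.
  by rewrite dotvBr h1 subrr eqxx.
move=> y A B sA hy hA.
have B0 : 0 <= B.
  have [N0|N0] := posnP N; last by apply: le_trans (hy (Ordinal N0)).
  suff : false by [].
  have h1 : `|1 : R| <= C * 0.
    apply: (hC (fun=> 1) 0 _ (Ordinal (ltn0Sn _))) => l; suff : false by [].
    by case: l => l; rewrite N0.
  by move: h1; rewrite mulr0 normr1 ler10.
have hy' := bound _ B (size_dot_poly y)
  (fun l => eq_ind_r (fun t => `|t| <= B) (hy l) (horner_dot_poly y _)).
have hA' := bound _ B (size_quad_poly A)
  (fun l => eq_ind_r (fun t => `|t| <= B) (hA l) (horner_quad_poly A _)).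
rewrite ger0_norm// in hy' hA'.
have CB0 : 0 <= C * B by rewrite mulr_ge0.
split; rewrite -mulrA.
  apply: (@le_trans _ _ ((d * 1).+1%:R * (C * B))).
    by apply: enorm_le_entries => // i j; rewrite ord1 -coef_dot_poly.
  by rewrite ler_wpM2r// ler_nat ltnS leq_mul.
apply: enorm_le_entries => // i j.
have := hA' (2 ^ i + 2 ^ j)%N; rewrite coef_quad_poly//; case: eqP => // _ h.
by apply: le_trans h; rewrite normrM ger0_norm// ler_peMl// ler1n.
Qed.

End directions.

(** * Wasserstein distances *)

Section wasserstein.
Context (R : realType) (d : nat) (G G0 : mixing R d).
Implicit Types (r : nat) (q : 'M[R]_(natoms G, natoms G0)).

Definition atom_dist (i : 'I_(natoms G)) (j : 'I_(natoms G0)) : R :=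
  enorm (mean G i - mean G0 j) + enorm (cov G i - cov G0 j).

Lemma atom_dist_ge0 i j : 0 <= atom_dist i j.
Proof. by rewrite addr_ge0 ?enorm_ge0. Qed.

Lemma transport_cost_nat r q :
  transport_cost r%:R q = \sum_i \sum_j q i j * atom_dist i j ^+ r.
Proof.
apply: eq_bigr => i _; apply: eq_bigr => j _.
by rewrite powR_mulrn// atom_dist_ge0.
Qed.

Lemma transport_cost_ge0 r q : coupling G G0 q -> 0 <= transport_cost r%:R q.
Proof.
move=> [q0 _ _]; rewrite transport_cost_nat; apply: sumr_ge0 => i _.
by apply: sumr_ge0 => j _; rewrite mulr_ge0 ?exprn_ge0 ?atom_dist_ge0.
Qed.

Lemma coupling_nonempty : coupling G G0 !=set0.
Proof.
exists (\matrix_(i, j) (weight G i * weight G0 j)); split.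
- by move=> i j; rewrite mxE mulr_ge0// ltW// weight_gt0.
- by move=> i; under eq_bigr do rewrite mxE; rewrite -mulr_sumr weight_sum1 mulr1.
- by move=> j; under eq_bigr do rewrite mxE; rewrite -mulr_suml weight_sum1 mul1r.
Qed.

Let costs r := @transport_cost R d r%:R G G0 @` coupling G G0.

Let costs_lb r : lbound (costs r) 0.
Proof. by move=> _ [q cq <-]; exact: transport_cost_ge0. Qed.

Let costs_nonempty r : costs r !=set0.
Proof. by have [q cq] := coupling_nonempty; exists (transport_cost r%:R q), q. Qed.

Lemma wasserstein_exp r : (0 < r)%N -> wasserstein r%:R G G0 ^+ r = inf (costs r).
Proof.
move=> r0; have rN : r%:R != 0 :> R by rewrite pnatr_eq0 -lt0n.
have i0 : 0 <= inf (costs r) by apply: lb_le_inf (costs_nonempty r) (@costs_lb r).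
rewrite -powR_mulrn ?powR_ge0// /wasserstein -powRrM mulVf// powRr1//.
Qed.

Lemma wasserstein_ge0 (s : R) : 0 <= wasserstein s G G0.
Proof. exact: powR_ge0. Qed.

Lemma wasserstein_le_cost r q : (0 < r)%N -> coupling G G0 q ->
  wasserstein r%:R G G0 ^+ r <= \sum_i \sum_j q i j * atom_dist i j ^+ r.
Proof.
move=> r0 cq; rewrite wasserstein_exp// -transport_cost_nat; apply: ge_inf.
  by exists 0; exact: costs_lb.
by exists q.
Qed.

Lemma wasserstein_ge r B : (0 < r)%N ->
  (forall q, coupling G G0 q -> B <= \sum_i \sum_j q i j * atom_dist i j ^+ r) ->
  B <= wasserstein r%:R G G0 ^+ r.
Proof.
move=> r0 h; rewrite wasserstein_exp//; apply: lb_le_inf (costs_nonempty r) _.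
by move=> _ [q cq <-]; rewrite transport_cost_nat; exact: h.
Qed.

Lemma wasserstein_ge_left r delta i : (0 < r)%N -> 0 <= delta ->
  (forall j, delta <= atom_dist i j) ->
  weight G i * delta ^+ r <= wasserstein r%:R G G0 ^+ r.
Proof.
move=> r0 d0 h; apply: wasserstein_ge => // q [q0 qi _].
rewrite (bigD1 i)//= -(qi i) mulr_suml -[leLHS]addr0 lerD//.
  apply: ler_sum => j _; rewrite ler_wpM2l// lerXn2r ?nnegrE ?atom_dist_ge0//.
apply: sumr_ge0 => i' _; apply: sumr_ge0 => j _.
by rewrite mulr_ge0 ?exprn_ge0 ?atom_dist_ge0.
Qed.

Lemma wasserstein_ge_right r delta j : (0 < r)%N -> 0 <= delta ->
  (forall i, delta <= atom_dist i j) ->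
  weight G0 j * delta ^+ r <= wasserstein r%:R G G0 ^+ r.
Proof.
move=> r0 d0 h; apply: wasserstein_ge => // q [q0 _ qj].
rewrite exchange_big (bigD1 j)//= -(qj j) mulr_suml -[leLHS]addr0 lerD//.
  apply: ler_sum => i _; rewrite ler_wpM2l// lerXn2r ?nnegrE ?atom_dist_ge0//.
apply: sumr_ge0 => j' _; apply: sumr_ge0 => i _.
by rewrite mulr_ge0 ?exprn_ge0 ?atom_dist_ge0.
Qed.

(** Convexity of the power: its graph lies above the tangent at [y]. The induction step leaves a
    nonnegative multiple of [(x - y) ^+ 2]. *)
Lemma exprn_tangent r (x y : R) : 0 <= x -> 0 <= y ->
  y ^+ r.+1 + r.+1%:R * y ^+ r * (x - y) <= x ^+ r.+1.
Proof.
move=> x0 y0; elim: r => [|r IH]; first by rewrite !expr1 expr0; lra.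
have h1 := ler_wpM2l x0 IH; rewrite -exprS in h1; apply: le_trans h1.
rewrite -subr_ge0.
have -> : x * (y ^+ r.+1 + r.+1%:R * y ^+ r * (x - y)) -
    (y ^+ r.+2 + r.+2%:R * y ^+ r.+1 * (x - y)) = r.+1%:R * y ^+ r * (x - y) ^+ 2.
  by rewrite -[r.+2%:R]natr1 !exprS; ring.
by rewrite mulr_ge0 ?sqr_ge0// mulr_ge0// exprn_ge0.
Qed.

(** Jensen's inequality under the probability [q], by way of the tangent at the mean cost [y]:
    summation cancels the linear term. *)
Lemma wasserstein1_le r : (0 < r)%N ->
  wasserstein 1 G G0 ^+ r <= wasserstein r%:R G G0 ^+ r.
Proof.
move=> r0; apply: (@wasserstein_ge r _ r0) => q cq.
case: r r0 => [|r] r0; first by rewrite ltnn in r0.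
have [q0 qi _] := cq.
pose y := \sum_i \sum_j q i j * atom_dist i j.
have y0 : 0 <= y.
  apply: sumr_ge0 => i _; apply: sumr_ge0 => j _.
  by rewrite mulr_ge0 ?atom_dist_ge0.
have W1y : wasserstein 1 G G0 <= y.
  by have := @wasserstein_le_cost 1 q isT cq; rewrite expr1.
apply: (@le_trans _ _ (y ^+ r.+1)).
  by rewrite lerXn2r ?nnegrE ?wasserstein_ge0.
have q1 : \sum_i \sum_j q i j = 1.
  by under eq_bigr do rewrite qi; exact: weight_sum1.
apply: (@le_trans _ _ (\sum_i \sum_j q i j *
    (y ^+ r.+1 + r.+1%:R * y ^+ r * (atom_dist i j - y)))); last first.
  apply: ler_sum => i _; apply: ler_sum => j _; rewrite ler_wpM2l//.
  by apply: exprn_tangent => //; exact: atom_dist_ge0.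
have -> : \sum_i \sum_j q i j * (y ^+ r.+1 + r.+1%:R * y ^+ r * (atom_dist i j - y)) =
    \sum_i \sum_j (q i j * (y ^+ r.+1 - r.+1%:R * y ^+ r * y) +
      (q i j * atom_dist i j) * (r.+1%:R * y ^+ r)).
  by apply: eq_bigr => i _; apply: eq_bigr => j _; ring.
under eq_bigr do rewrite big_split /= -!mulr_suml.
by rewrite big_split /= -!mulr_suml q1 -/y; lra.
Qed.

(** Each target receives from its own group as much as both masses allow; the total surplus [T] is
    spread over the deficits in proportion, at distance at most [M]. *)
Lemma wasserstein_le_matching r (M : R) (g : 'I_(natoms G) -> 'I_(natoms G0)) :
  (0 < r)%N -> (forall i j, atom_dist i j <= M) ->
  wasserstein r%:R G G0 ^+ r <= \sum_i weight G i * atom_dist i (g i) ^+ r +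
    M ^+ r * \sum_j `|\sum_(i | g i == j) weight G i - weight G0 j|.
Proof.
move=> r0 hM.
pose P j := \sum_(i | g i == j) weight G i; pose w0 j := weight G0 j.
have wG i : 0 <= weight G i by rewrite ltW// weight_gt0.
have w00 j : 0 <= w0 j by rewrite /w0 ltW// weight_gt0.
have P0 j : 0 <= P j by apply: sumr_ge0.
pose mn j := Num.min (P j) (w0 j).
have mnP j : mn j <= P j by rewrite ge_min lexx.
have mnw j : mn j <= w0 j by rewrite ge_min lexx orbT.
have mn0 j : 0 <= mn j by rewrite le_min P0 w00.
(* The fraction of group [j] that stays with its target; 0 for an empty group, by the convention on
   division. *)
pose al j := mn j / P j.
have al0 j : 0 <= al j by rewrite divr_ge0.
have al1 j : al j <= 1.
  have [z|z] := eqVneq (P j) 0; first by rewrite /al z invr0 mulr0.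
  by rewrite ler_pdivrMr ?mul1r// lt_def z P0.
have Pal j : P j * al j = mn j.
  have [z|z] := eqVneq (P j) 0; last by rewrite /al mulrC divfK.
  by rewrite z mul0r; apply/eqP; rewrite eq_le mn0 -z mnP.
have P1 : \sum_j P j = 1.
  by rewrite -(weight_sum1 G) [RHS](partition_big g xpredT).
pose T := \sum_j (P j - mn j).
have TE : T = \sum_j (w0 j - mn j).
  by rewrite /T !sumrB P1 -(weight_sum1 G0).
have T0 : 0 <= T by apply: sumr_ge0 => j _; rewrite subr_ge0.
have Tz j : T = 0 -> P j = mn j /\ w0 j = mn j.
  move=> z; split; apply/eqP; rewrite -subr_eq0; apply/eqP.
    have /psumr_eq0P H := z; apply: H => // i _; by rewrite subr_ge0.
  move: z; rewrite TE => z.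
  have /psumr_eq0P H := z; apply: H => // i _; by rewrite subr_ge0.
pose q : 'M[R]_(natoms G, natoms G0) := \matrix_(i, j)
  (weight G i * al (g i) * (g i == j)%:R +
   weight G i * (1 - al (g i)) * ((w0 j - mn j) / T)).
have sumT i : weight G i * (1 - al (g i)) * (\sum_j (w0 j - mn j) / T) =
    weight G i * (1 - al (g i)).
  rewrite -mulr_suml -TE.
  have [z|z] := eqVneq T 0; last by rewrite divff// mulr1.
  have [PE _] := Tz (g i) z.
  have Pi : P (g i) != 0.
    rewrite gt_eqF// /P (bigD1 i)//= ltr_pwDl ?weight_gt0// sumr_ge0//.
  by rewrite /al -PE divff// subrr mulr0 !mul0r.
have sumW : \sum_i weight G i * (1 - al (g i)) = T.
  rewrite (partition_big g xpredT)//=; apply: eq_bigr => j _.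
  rewrite -Pal /P mulr_suml -sumrB; apply: eq_bigr => i /eqP ->.
  by rewrite mulrBr mulr1.
have cq : coupling G G0 q.
  split.
  - move=> i j; rewrite mxE addr_ge0//; first by rewrite mulr_ge0// mulr_ge0.
    by rewrite mulr_ge0 ?divr_ge0 ?subr_ge0// mulr_ge0// subr_ge0.
  - move=> i; under eq_bigr do rewrite mxE.
    rewrite big_split /= -[X in _ + X]mulr_sumr sumT (bigD1 (g i))//= eqxx mulr1.
    rewrite big1 ?addr0; first by rewrite mulrBr mulr1 addrC subrK.
    by move=> j ji; rewrite eq_sym (negPf ji) mulr0.
  - move=> j; under eq_bigr do rewrite mxE.
    rewrite big_split /= -mulr_suml sumW.
    have -> : T * ((w0 j - mn j) / T) = w0 j - mn j.
      have [z|z] := eqVneq T 0; last by rewrite mulrC divfK.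
      by have [_ ->] := Tz j z; rewrite subrr mul0r mulr0.
    rewrite (bigID (fun i => g i == j))/= [X in _ + X + _]big1 ?addr0; last first.
      by move=> i /negPf ->; rewrite mulr0.
    under eq_bigr => i /eqP gi do rewrite gi eqxx mulr1.
    by rewrite -mulr_suml -/(P j) Pal addrC subrK.
apply: le_trans (wasserstein_le_cost r0 cq) _.
have M0 (i : 'I_(natoms G)) (j : 'I_(natoms G0)) : 0 <= M.
  exact: le_trans (atom_dist_ge0 i j) (hM i j).
have cost_le i j : q i j * atom_dist i j ^+ r <=
    weight G i * al (g i) * (g i == j)%:R * atom_dist i j ^+ r +
    weight G i * (1 - al (g i)) * ((w0 j - mn j) / T) * M ^+ r.
  rewrite mxE mulrDl lerD2l ler_wpM2l//.
    by rewrite mulr_ge0 ?divr_ge0 ?subr_ge0// mulr_ge0// subr_ge0.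
  by rewrite lerXn2r ?nnegrE ?atom_dist_ge0// (M0 i j).
apply: le_trans (ler_sum _ (fun i _ => ler_sum _ (fun j _ => cost_le i j))) _.
under eq_bigr do rewrite big_split /=.
rewrite big_split /= lerD//.
  apply: ler_sum => i _; rewrite (bigD1 (g i))//= eqxx mulr1 big1 ?addr0.
    by rewrite ler_wpM2r ?exprn_ge0 ?atom_dist_ge0// ler_piMr.
  by move=> j ji; rewrite eq_sym (negPf ji) mulr0 mul0r.
under eq_bigr do rewrite -mulr_suml -mulr_sumr sumT.
rewrite -mulr_suml sumW mulrC.
have [n0|n0] := posnP (natoms G0).
  by rewrite /T !big1 ?mulr0// => j; exfalso; move: j => [j]; rewrite n0.
have [nG|nG] := posnP (natoms G).
  have := weight_sum1 G; rewrite big1 => [/eqP|i _].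
    by rewrite eq_sym oner_eq0.
  by exfalso; move: i => [i]; rewrite nG.
rewrite ler_wpM2l ?exprn_ge0 ?(M0 (Ordinal nG) (Ordinal n0))//.
apply: ler_sum => j _; rewrite -/(P j) -/(w0 j) /mn.
case: (leP (P j) (w0 j)) => _; last exact: ler_norm.
by rewrite subrr normr_ge0.
Qed.

End wasserstein.

(** * Lower bound for the total variation *)

Section norms.
Context (R : realType).

(** The witness is the inverse of a sum of inverses; the summand 1 keeps it positive when no index
    satisfies [P]. *)
Lemma finite_lower_bound (I : finType) (P : pred I) (f : I -> R) :
  (forall i, P i -> 0 < f i) -> exists2 delta, 0 < delta & forall i, P i -> delta <= f i.
Proof.
move=> h; have S0 : 0 <= \sum_(i | P i) (f i)^-1.
  by apply: sumr_ge0 => i Pi; rewrite invr_ge0 ltW// h.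
have S1 : 0 < 1 + \sum_(i | P i) (f i)^-1 by rewrite ltr_pwDl.
exists (1 + \sum_(i | P i) (f i)^-1)^-1; first by rewrite invr_gt0.
move=> i Pi; rewrite -[leRHS]invrK lef_pV2 ?posrE ?invr_gt0 ?h//.
rewrite (bigD1 i)//= addrCA lerDl addr_ge0// sumr_ge0// => j /andP[Pj _].
by rewrite invr_ge0 ltW// h.
Qed.

Lemma entry_le_enorm m n (A : 'M[R]_(m, n)) i j : `|A i j| <= enorm A.
Proof.
rewrite -sqrtr_sqr; apply: ler_wsqrtr; rewrite (bigD1 i)//= (bigD1 j)//= -addrA lerDl.
rewrite addr_ge0// sumr_ge0// => k _; rewrite ?sqr_ge0//.
by apply: sumr_ge0 => l _; rewrite sqr_ge0.
Qed.

Lemma dotv_le_enorm d (u y : 'cV[R]_d) : `|dotv u y| <= (\sum_i `|u i ord0|) * enorm y.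
Proof.
rewrite dotvE mulr_suml; apply: le_trans (ler_norm_sum _ _ _) _.
by apply: ler_sum => i _; rewrite normrM ler_wpM2l// entry_le_enorm.
Qed.

Lemma quad_le_enorm d (A : 'M[R]_d) (u : 'cV[R]_d) :
  `|quad A u| <= (\sum_i `|u i ord0|) ^+ 2 * enorm A.
Proof.
rewrite quadE expr2 -mulrA mulr_suml; apply: le_trans (ler_norm_sum _ _ _) _.
apply: ler_sum => j _; rewrite normrM mulrC ler_wpM2l// mulr_suml.
apply: le_trans (ler_norm_sum _ _ _) _.
by apply: ler_sum => i _; rewrite normrM ler_wpM2l// entry_le_enorm.
Qed.

Lemma quadBl d (A B : 'M[R]_d) (u : 'cV[R]_d) : quad (A - B) u = quad A u - quad B u.
Proof. by rewrite !dotv_quad mulmxBl dotvBr. Qed.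

Lemma enormZ m n (c : R) (A : 'M[R]_(m, n)) : enorm (c *: A) = `|c| * enorm A.
Proof.
rewrite /enorm -sqrtr_sqr -sqrtrM ?sqr_ge0//; congr Num.sqrt.
rewrite mulr_sumr; apply: eq_bigr => i _; rewrite mulr_sumr; apply: eq_bigr => j _.
by rewrite mxE exprMn.
Qed.

(** A substitute for [atom_dist] whose triangle inequality and separation of points follow entry by
    entry; [l1dist_le] compares the two. *)
Definition l1dist d (x y : 'cV[R]_d * 'M[R]_d) : R :=
  \sum_a `|(x.1 - y.1) a ord0| + \sum_a \sum_b `|(x.2 - y.2) a b|.

Lemma l1dist_le d (x y : 'cV[R]_d * 'M[R]_d) :
  l1dist x y <= (d%:R + d%:R * d%:R) * (enorm (x.1 - y.1) + enorm (x.2 - y.2)).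
Proof.
have h1 : \sum_a `|(x.1 - y.1) a ord0| <= d%:R * enorm (x.1 - y.1).
  apply: le_trans (ler_sum _ (fun a _ => entry_le_enorm _ a ord0)) _.
  by rewrite sumr_const card_ord -[leLHS]mulr_natl.
have h2 : \sum_a \sum_b `|(x.2 - y.2) a b| <= d%:R * d%:R * enorm (x.2 - y.2).
  apply: le_trans (ler_sum _ (fun a _ => ler_sum _ (fun b _ => entry_le_enorm _ a b))) _.
  by rewrite !sumr_const card_ord -mulrnA -[leLHS]mulr_natl natrM.
rewrite /l1dist; set e1 := enorm _ in h1 *; set e2 := enorm _ in h2 *.
have e10 : 0 <= e1 by exact: enorm_ge0.
have e20 : 0 <= e2 by exact: enorm_ge0.
have dd : 0 <= d%:R * d%:R :> R by rewrite mulr_ge0.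
have d1 : 0 <= d%:R :> R by [].
have := mulr_ge0 d1 e20; have := mulr_ge0 dd e10.
by move: h1 h2; set D := d%:R; nra.
Qed.

Lemma l1dist_triangle d (x y z : 'cV[R]_d * 'M[R]_d) : l1dist x y <= l1dist z x + l1dist z y.
Proof.
rewrite /l1dist [leRHS]addrACA; apply: lerD.
  rewrite -big_split; apply: ler_sum => a _ /=.
  rewrite [in leLHS](_ : (x.1 - y.1) a ord0 = (z.1 - y.1) a ord0 - (z.1 - x.1) a ord0).
    by apply: le_trans (ler_normB _ _) _; rewrite addrC.
  by rewrite !mxE; ring.
rewrite -big_split; apply: ler_sum => a _ /=; rewrite -big_split; apply: ler_sum => b _ /=.
rewrite [in leLHS](_ : (x.2 - y.2) a b = (z.2 - y.2) a b - (z.2 - x.2) a b).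
  by apply: le_trans (ler_normB _ _) _; rewrite addrC.
by rewrite !mxE; ring.
Qed.

Lemma l1dist_ge0 d (x y : 'cV[R]_d * 'M[R]_d) : 0 <= l1dist x y.
Proof.
rewrite /l1dist addr_ge0//; first exact: sumr_ge0.
by apply: sumr_ge0 => a _; apply: sumr_ge0.
Qed.

Lemma l1dist_eq0 d (x y : 'cV[R]_d * 'M[R]_d) : l1dist x y = 0 -> x = y.
Proof.
case: x => x1 x2; case: y => y1 y2.
have n1 : 0 <= \sum_a `|(x1 - y1) a ord0| by apply: sumr_ge0.
have n2 : 0 <= \sum_a \sum_b `|(x2 - y2) a b|.
  by apply: sumr_ge0 => a _; apply: sumr_ge0.
move=> /eqP; rewrite /l1dist /= paddr_eq0// => /andP[/eqP/psumr_eq0P h1 /eqP/psumr_eq0P h2].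
congr (_, _).
  apply/eqP; rewrite -subr_eq0; apply/eqP/colP => a; rewrite [RHS]mxE.
  by apply/eqP; rewrite -normr_eq0 h1.
apply/eqP; rewrite -subr_eq0; apply/eqP/matrixP => a b; rewrite [RHS]mxE.
apply/eqP; rewrite -normr_eq0; apply/eqP.
have /psumr_eq0P h3 : \sum_b `|(x2 - y2) a b| = 0.
  by apply: h2 => // i _; apply: sumr_ge0.
exact: h3.
Qed.

End norms.

Section fibers.

(** Each of the other [k0 - 1] fibers takes at least one of the at most [k] indices. *)
Lemma card_fiber_le n k k0 (g : 'I_n -> 'I_k0) i : (n <= k)%N ->
  (forall i, exists j, g j = i) -> (#|[set j | g j == i]%SET| <= (k - k0).+1)%N.
Proof.
move=> nk gs.
have nE : (n = \sum_(i < k0) #|[set j | g j == i]%SET|)%N.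
  rewrite -[LHS]card_ord -sum1_card (partition_big g xpredT)//=.
  by apply: eq_bigr => l _; rewrite sum1dep_card; apply: eq_card => j; rewrite !inE.
have : (k0.-1 + #|[set j | g j == i]%SET| <= n)%N.
  rewrite [leqRHS]nE (bigD1 i)//= addnC leq_add2l.
  have -> : (k0.-1 = \sum_(l < k0 | l != i) 1)%N.
    by rewrite sum1_card cardC1 card_ord.
  apply: leq_sum => l _; apply/card_gt0P; have [j gj] := gs l.
  by exists j; rewrite inE gj.
case: k0 g i gs nE => [|k0] g i gs _; first by case: i.
by move: (#|_|) => c; lia.
Qed.

End fibers.

Section lower_bound.
Context (R : realType) (d k r : nat) (G0 : mixing R d) (c0 : R).
Hypotheses (d0 : (0 < d)%N) (spd0 : spd_mixing G0) (k0k : (natoms G0 < k)%N).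
Hypotheses (hr : is_rbar R (k - natoms G0) r) (c0_gt0 : 0 < c0).

Let k0 := natoms G0.

Let r4 : (4 <= r)%N.
Proof. by apply: is_rbar_ge4 hr; rewrite subn_gt0. Qed.

Let r_gt0 : (0 < r)%N.
Proof. exact: leq_trans r4. Qed.

Let localization eta : 0 < eta -> exists2 eps0 : R, 0 < eps0 &
  forall G : mixing R d, (forall i, c0 <= weight G i) ->
    wasserstein r%:R G G0 <= eps0 ->
    (forall i, exists j, atom_dist (G := G) (G0 := G0) i j < eta) /\
    (forall j, exists i, atom_dist (G := G) (G0 := G0) i j < eta).
Proof.
move=> eta0.
have [w w0 hw] := @finite_lower_bound R _ xpredT (weight G0) (fun i _ => weight_gt0 i).
(* [s < 1] gives [s ^+ r <= s], hence [(eta * s) ^+ r < c * eta ^+ r] for every weight [c] above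
   [s], which is less than the cost of an isolated atom. *)
pose s := Num.min 1 (Num.min c0 w) / 2.
have m0 : 0 < Num.min 1 (Num.min c0 w) by rewrite !lt_min ltr01 c0_gt0 w0.
have s0 : 0 < s by rewrite divr_gt0.
have sm : s < Num.min 1 (Num.min c0 w) by rewrite /s; lra.
have [s1 [sc sw]] : s < 1 /\ s < c0 /\ s < w.
  by move: sm; rewrite !lt_min => /andP[-> /andP[-> ->]].
exists (eta * s); first by rewrite mulr_gt0.
move=> G hG hW.
have lt_Wr c : s < c -> wasserstein r%:R G G0 ^+ r < c * eta ^+ r.
  move=> cs; apply: (@le_lt_trans _ _ ((eta * s) ^+ r)).
    by rewrite lerXn2r ?nnegrE ?wasserstein_ge0// mulr_ge0// ltW.
  rewrite exprMn mulrC ltr_pM2r ?exprn_gt0//; apply: le_lt_trans cs.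
  by rewrite -[leRHS]expr1 ler_wiXn2l// ltW.
split.
  move=> i; apply: contrapT => /forallNP h.
  have := lt_Wr _ (lt_le_trans sc (hG i)); apply/negP; rewrite -leNgt.
  apply: wasserstein_ge_left => //; first exact: ltW.
  by move=> j; rewrite leNgt; apply/negP; exact: h.
move=> j; apply: contrapT => /forallNP h.
have := lt_Wr _ (lt_le_trans sw (hw j isT)); apply/negP; rewrite -leNgt.
apply: wasserstein_ge_right => //; first exact: ltW.
by move=> i; rewrite leNgt; apply/negP; exact: h.
Qed.

(** In each direction [tvdist_ge_test] supplies [B = 2 * V] for the one-dimensional bound. The
    directional differences reassemble into [atom_dist], and [wasserstein_le_matching] turns the
    estimates for positions and group weights into one for the transport cost. *)
Lemma tvdist_lower_bound : exists eps0 C0 : R, [/\ 0 < eps0, 0 < C0 &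
  forall G : mixing R d, spd_mixing G -> (natoms G <= k)%N ->
    (forall i, c0 <= weight G i) -> wasserstein r%:R G G0 <= eps0 ->
    C0 * wasserstein r%:R G G0 ^+ r <= tvdist (mix_density G) (mix_density G0)].
Proof.
have sym0 i : (cov G0 i)^T = cov G0 i by case: (spd0 i).
have [N [u [C [C_ge0 u0 uinj hu]]]] := separating_directions d0 sym0 (@atom_inj R d G0).
have N0 : (0 < N)%N.
  rewrite lt0n; apply/eqP => Nz; pose y : 'cV[R]_d := const_mx 1.
  have no (l : 'I_N) (Q : Prop) : Q by exfalso; case: l => l; rewrite Nz.
  have [ey _] := hu y 0 0 (trmx0 _ _ _) (fun l => no l _) (fun l => no l _).
  have := le_trans (entry_le_enorm y (Ordinal d0) ord0) ey.
  by rewrite mxE mulr0 normr1 ler10.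
pose m := (k - k0).+1.
have nosol : ~ has_nontrivial_solution R m r by case: hr.
have proj l : exists ec : R * R, [/\ 0 < ec.1, 0 <= ec.2 &
  forall n (p mu v : 'I_n -> R) (g : 'I_n -> 'I_k0) (B : R),
    (forall j, c0 <= p j) -> \sum_j p j <= 1 ->
    (forall i, (0 < #|[set j | g j == i]%SET| <= m)%N) ->
    (forall j, `|mu j - dotv (u l) (mean G0 (g j))| <= ec.1) ->
    (forall j, `|v j - (quad (cov G0 (g j)) (u l) + 1)| <= ec.1) ->
    (forall c, `|\sum_j p j * gker 0 (mu j) (v j) c -
       \sum_i weight G0 i * gker 0 (dotv (u l) (mean G0 i)) (quad (cov G0 i) (u l) + 1) c| <= B) ->
    (forall j, `|mu j - dotv (u l) (mean G0 (g j))| ^+ r <= ec.2 * B /\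
               `|v j - (quad (cov G0 (g j)) (u l) + 1)| ^+ r <= ec.2 * B) /\
    (forall i, `|\sum_(j | g j == i) p j - weight G0 i| <= ec.2 * B)].
  have v01 i : 1 <= quad (cov G0 i) (u l) + 1.
    by rewrite lerDr ltW//; case: (spd0 i) => _; apply.
  have inj : injective (fun i => (dotv (u l) (mean G0 i), quad (cov G0 i) (u l) + 1)).
    by move=> i j [h1 /addIr h2]; apply: (uinj l); rewrite h1 h2.
  have [eps [C' [h1 h2 h3]]] :=
    mixture1d_lower_bound (weight G0) nosol r4 c0_gt0 v01 inj.
  by exists (eps, C').
have [ec hec] := choice proj.
have [eps1 eps10 heps1] := @finite_lower_bound R _ xpredT (fun l => (ec l).1)
  (fun l _ => let: And3 h _ _ := hec l in h).
pose C1 := \sum_l (ec l).2.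
have ec20 l : 0 <= (ec l).2 by case: (hec l).
have C1ge l : (ec l).2 <= C1 by rewrite /C1 (bigD1 l)//= lerDl sumr_ge0.
have C10 : 0 <= C1 by rewrite sumr_ge0.
pose U l := \sum_i `|u l i ord0|.
have U0 l : 0 <= U l by apply: sumr_ge0.
pose KU := 1 + \sum_l (U l + U l ^+ 2).
have U20 l : 0 <= U l + U l ^+ 2 by rewrite addr_ge0 ?exprn_ge0.
have KU0 : 0 < KU by rewrite ltr_pwDl// sumr_ge0.
have KUl l : U l + U l ^+ 2 <= KU.
  rewrite /KU (bigD1 l)//= addrCA lerDl addr_ge0// sumr_ge0//.
have gap (z : 'I_k0 * 'I_k0) : z.1 != z.2 -> 0 < l1dist (atom G0 z.1) (atom G0 z.2).
  move=> zz; rewrite lt_def l1dist_ge0 andbT; apply/eqP => /l1dist_eq0 /atom_inj z12.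
  by move: zz; rewrite z12 eqxx.
have [delta delta0 hdelta] := finite_lower_bound gap.
pose K1 : R := d%:R + d%:R * d%:R.
have K10 : 0 <= K1 by rewrite /K1 addr_ge0 ?mulr_ge0.
have K11 : 0 < 2 * K1 + 1 by rewrite ltr_wpDl// mulr_ge0.
(* The first bound makes the atom of [G0] within [eta] of an atom of [G] unique; the second makes
   the projected distances admissible in every direction. *)
pose eta := Num.min (delta / (2 * K1 + 1)) (eps1 / KU).
have eta0 : 0 < eta by rewrite lt_min !divr_gt0.
have etad : 2 * K1 * eta < delta.
  apply: (@lt_le_trans _ _ ((2 * K1 + 1) * eta)).
    by rewrite ltr_pM2r// ltrDl.
  by rewrite mulrC -ler_pdivlMr// ge_min lexx.
have etae : KU * eta <= eps1.
  by rewrite mulrC -ler_pdivlMr// ge_min lexx orbT.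
have [eps0 eps00 hloc] := localization eta0.
pose L := \sum_i \sum_j l1dist (atom G0 i) (atom G0 j).
have L0 : 0 <= L.
  by apply: sumr_ge0 => i _; apply: sumr_ge0 => j _; exact: l1dist_ge0.
have Lij i j : l1dist (atom G0 i) (atom G0 j) <= L.
  rewrite /L (bigD1 i)//= (bigD1 j)//= -addrA lerDl addr_ge0// sumr_ge0// => i' _.
    exact: l1dist_ge0.
  by apply: sumr_ge0 => j' _; exact: l1dist_ge0.
pose M := ((d * 1).+1%:R + (d * d).+1%:R) * (eta + L).
have etaL : 0 <= eta + L by rewrite addr_ge0// ltW.
have M0 : 0 <= M by rewrite mulr_ge0// addr_ge0.
pose Ct := 2 * C1 * ((2 * C) ^+ r + M ^+ r * k0%:R) + 1.
have Ct0 : 0 < Ct.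
  by rewrite ltr_wpDl// mulr_ge0 ?mulr_ge0// addr_ge0 ?mulr_ge0 ?exprn_ge0// mulr_ge0.
exists eps0, Ct^-1; split=> //; first by rewrite invr_gt0.
move=> G spdG nG wG hW; have [hl hr'] := hloc G wG hW.
have [g hg] := choice hl.
set V := tvdist _ _; have V0 : 0 <= V by exact: tvdist_ge0.
have close i j : atom_dist (G := G) (G0 := G0) i j < eta -> g i = j.
  move=> hij; apply/eqP/negPn/negP => gij.
  have := hdelta (g i, j) gij; rewrite /= leNgt => /negP; apply.
  apply: le_lt_trans etad.
  apply: le_trans (l1dist_triangle _ _ (atom G i)) _.
  apply: le_trans (lerD (l1dist_le _ _) (l1dist_le _ _)) _ => /=.
  have a1 : enorm (mean G i - mean G0 (g i)) + enorm (cov G i - cov G0 (g i)) <= eta.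
    exact: ltW (hg i).
  have a2 : enorm (mean G i - mean G0 j) + enorm (cov G i - cov G0 j) <= eta.
    exact: ltW hij.
  by have := ler_wpM2l K10 a1; have := ler_wpM2l K10 a2; rewrite -/K1; lra.
have gsurj j : exists i, g i = j.
  by have [i hij] := hr' j; exists i; exact: close.
have fib i : (0 < #|[set j | g j == i]%SET| <= m)%N.
  rewrite card_fiber_le// andbT; apply/card_gt0P.
  by have [j gj] := gsurj i; exists j; rewrite inE gj.
have enle i : enorm (mean G i - mean G0 (g i)) <= eta /\
    enorm (cov G i - cov G0 (g i)) <= eta.
  have := hg i; rewrite /atom_dist => /ltW h; split; apply: le_trans h.
    by rewrite lerDl enorm_ge0.
  by rewrite lerDr enorm_ge0.
have bound l : (forall j, `|dotv (u l) (mean G j - mean G0 (g j))| ^+ r <= C1 * (2 * V) /\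
    `|quad (cov G j - cov G0 (g j)) (u l)| ^+ r <= C1 * (2 * V)) /\
  (forall i, `|\sum_(j | g j == i) weight G j - weight G0 i| <= C1 * (2 * V)).
  have [e0 _ H] := hec l.
  have vE j : quad (cov G j) (u l) + 1 - (quad (cov G0 (g j)) (u l) + 1) =
      quad (cov G j - cov G0 (g j)) (u l) by rewrite quadBl; ring.
  have c1 j : `|dotv (u l) (mean G j) - dotv (u l) (mean G0 (g j))| <= (ec l).1.
    rewrite -dotvBr; apply: le_trans (dotv_le_enorm _ _) _.
    apply: le_trans (heps1 l isT); apply: le_trans etae.
    apply: ler_pM; [exact: U0|exact: enorm_ge0| |by case: (enle j)].
    by apply: le_trans (KUl l); rewrite lerDl exprn_ge0.
  have c2 j : `|quad (cov G j) (u l) + 1 - (quad (cov G0 (g j)) (u l) + 1)| <= (ec l).1.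
    rewrite vE; apply: le_trans (quad_le_enorm _ _) _.
    apply: le_trans (heps1 l isT); apply: le_trans etae.
    apply: ler_pM; [exact: sqr_ge0| exact: enorm_ge0| |by case: (enle j)].
    by apply: le_trans (KUl l); rewrite lerDr.
  have w1 : \sum_j weight G j <= 1 by rewrite weight_sum1.
  have [H1 H2] := H _ _ _ _ g _ wG w1 fib c1 c2
    (fun c => tvdist_ge_test c spdG spd0 (u0 l)).
  have up : (ec l).2 * (2 * V) <= C1 * (2 * V) by rewrite ler_wpM2r// mulr_ge0.
  split=> [j|i]; last exact: le_trans (H2 i) up.
  have [h1 h2] := H1 j; rewrite dotvBr -vE.
  by split; apply: le_trans up.
(* The estimates are for [r]-th powers while [hu] is linear, so an [r]-th root is taken first. *)
pose B := (C1 * (2 * V)) `^ r%:R^-1.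
have CV0 : 0 <= C1 * (2 * V).
  by apply: mulr_ge0 => //; exact: mulr_ge0.
have Br : B ^+ r = C1 * (2 * V).
  by rewrite /B -powR_mulrn ?powR_ge0// -powRrM mulVf ?powRr1// pnatr_eq0 -lt0n.
have B0 : 0 <= B by exact: powR_ge0.
have distB j : atom_dist (G := G) (G0 := G0) j (g j) ^+ r <= (2 * C) ^+ r * (C1 * (2 * V)).
  rewrite -Br -exprMn lerXn2r ?nnegrE ?atom_dist_ge0 ?mulr_ge0//.
  have sym : (cov G j - cov G0 (g j))^T = cov G j - cov G0 (g j).
    by rewrite linearB /= sym0; case: (spdG j) => ->.
  have hB1 l : `|dotv (u l) (mean G j - mean G0 (g j))| <= B.
    have [/(_ j)[h _] _] := bound l.
    by rewrite -(ler_pXn2r r_gt0) ?nnegrE// Br.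
  have hB2 l : `|quad (cov G j - cov G0 (g j)) (u l)| <= B.
    have [/(_ j)[_ h] _] := bound l.
    by rewrite -(ler_pXn2r r_gt0) ?nnegrE// Br.
  have [h1 h2] := hu _ _ B sym hB1 hB2.
  by rewrite /atom_dist; lra.
have distM i j : atom_dist (G := G) (G0 := G0) i j <= M.
  have [e1 e2] := enle i.
  rewrite /atom_dist /M mulrDl lerD//; apply: enorm_le_entries => // a b.
    rewrite (_ : _ a b = (mean G i - mean G0 (g i)) a b + (mean G0 (g i) - mean G0 j) a b).
      apply: le_trans (ler_normD _ _) _; rewrite lerD//.
        exact: le_trans (entry_le_enorm _ _ _) e1.
      apply: le_trans (Lij (g i) j); rewrite /l1dist /= ord1 (bigD1 a)//= -addrA lerDl.
      rewrite addr_ge0// sumr_ge0// => a' _; exact: sumr_ge0.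
    by rewrite !mxE; ring.
  rewrite (_ : _ a b = (cov G i - cov G0 (g i)) a b + (cov G0 (g i) - cov G0 j) a b).
    apply: le_trans (ler_normD _ _) _; rewrite lerD//.
      exact: le_trans (entry_le_enorm _ _ _) e2.
    apply: le_trans (Lij (g i) j); rewrite /l1dist /=; apply: ler_wpDl; first exact: sumr_ge0.
    rewrite (bigD1 a)//= (bigD1 b)//= -addrA lerDl addr_ge0 ?sumr_ge0// => a' _.
    exact: sumr_ge0.
  by rewrite !mxE; ring.
have := wasserstein_le_matching g r_gt0 distM.
have s1 : \sum_i weight G i * atom_dist (G := G) (G0 := G0) i (g i) ^+ r <=
    (2 * C) ^+ r * (C1 * (2 * V)).
  apply: (@le_trans _ _ (\sum_i weight G i * ((2 * C) ^+ r * (C1 * (2 * V))))).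
    by apply: ler_sum => i _; rewrite ler_wpM2l// ltW// weight_gt0.
  by rewrite -mulr_suml weight_sum1 mul1r.
have s2 : \sum_j `|\sum_(i | g i == j) weight G i - weight G0 j| <=
    k0%:R * (C1 * (2 * V)).
  apply: le_trans (ler_sum _ (fun j _ => (bound (Ordinal N0)).2 j)) _.
  by rewrite sumr_const card_ord -[leLHS]mulr_natl.
have Mr : 0 <= M ^+ r by rewrite exprn_ge0.
have s3 := ler_wpM2l Mr s2.
move=> hWW; rewrite mulrC ler_pdivrMr// /Ct.
apply: (le_trans hWW); apply: (le_trans (lerD s1 s3)).
have -> : V * (2 * C1 * ((2 * C) ^+ r + M ^+ r * k0%:R) + 1) =
   (2 * C) ^+ r * (C1 * (2 * V)) + M ^+ r * (k0%:R * (C1 * (2 * V))) + V by ring.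
by rewrite lerDl.
Qed.

End lower_bound.

(** * Upper bound for the Hellinger distance *)

(** [mixing] demands distinct atoms, whereas perturbed atoms may coincide; equal points are merged
    and their weights added. *)
Lemma merge_atoms (R : realType) (d : nat) (I : finType) (w : I -> R)
    (pt : I -> 'cV[R]_d * 'M[R]_d) :
  (forall i, 0 < w i) -> \sum_i w i = 1 ->
  exists (G : mixing R d) (h : I -> 'I_(natoms G)), [/\ (natoms G <= #|I|)%N,
    forall l, exists i, h i = l,
    forall i, atom G (h i) = pt i &
    forall l, weight G l = \sum_(i | h i == l) w i].
Proof.
move=> w0 w1; pose s := undup [seq pt i | i <- enum I].
pose x0 : 'cV[R]_d * 'M[R]_d := (0, 0).
have ps i : pt i \in s by rewrite mem_undup map_f// mem_enum.
pose h i : 'I_(size s) := Ordinal (etrans (index_mem (pt i) s) (ps i)).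
have hpt i : nth x0 s (h i) = pt i by rewrite /= nth_index.
have hsurj l : exists i, h i = l.
  have : nth x0 s l \in s by rewrite mem_nth.
  rewrite mem_undup => /mapP[i _ e]; exists i; apply/val_inj => /=.
  by rewrite -e index_uniq// undup_uniq.
pose W (l : 'I_(size s)) := \sum_(i | h i == l) w i.
have W0 l : 0 < W l.
  have [i hi] := hsurj l; rewrite /W (bigD1 i) ?hi//= ltr_pwDl// sumr_ge0// => j _.
  exact: ltW.
have W1 : \sum_l W l = 1 by rewrite -w1 [RHS](partition_big h xpredT).
have inj : injective (fun l : 'I_(size s) => ((nth x0 s l).1, (nth x0 s l).2)).
  move=> l l' /=; rewrite -!surjective_pairing => e; apply/val_inj/eqP.
  by rewrite -(nth_uniq x0 (ltn_ord l) (ltn_ord l') (undup_uniq _)); apply/eqP.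
exists (@Mixing R d (size s) W _ _ W0 W1 inj), h; split=> //=.
- by rewrite (leq_trans (size_undup _))// size_map -cardE.
- by move=> i; rewrite /atom /= -surjective_pairing nth_index.
Qed.

(** By [heat_coefZ] one may divide [a] by [K] and [b] by [K ^+ 2], and [1 <= K] makes the latter
    enough to bring [b] below 1. The squares of the [c j], normalized, serve as weights. *)
Lemma scaled_solution (R : realType) m r : has_nontrivial_solution R m r ->
  exists w a b : 'I_m -> R, [/\ (forall j, 0 < w j) /\ \sum_j w j = 1,
    forall j, `|a j| <= 1, forall j, `|b j| <= 1, exists j, a j != 0 &
    forall al, (1 <= al <= r)%N -> \sum_j w j * heat_coef al (a j) (b j) = 0].
Proof.
move=> [c [a [b [h c0 [j0 aj0]]]]].
pose K := 1 + \sum_j (`|a j| + `|b j|).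
have K0 : 0 < K by rewrite ltr_pwDl// sumr_ge0// => j _; rewrite addr_ge0.
have abK j : `|a j| <= K /\ `|b j| <= K.
  have S0 : 0 <= \sum_(i | i != j) (`|a i| + `|b i|).
    by apply: sumr_ge0 => i _; rewrite addr_ge0.
  rewrite /K (bigD1 j)//=; have := normr_ge0 (a j); have := normr_ge0 (b j); lra.
have K1 : 1 <= K by rewrite lerDl sumr_ge0// => j _; rewrite addr_ge0.
pose C := \sum_j c j ^+ 2.
have c20 j : 0 < c j ^+ 2 by rewrite exprn_even_gt0 //= c0.
have C0 : 0 < C.
  by rewrite /C (bigD1 j0)//= ltr_pwDl// sumr_ge0// => j _; rewrite ltW.
exists (fun j => c j ^+ 2 / C), (fun j => K^-1 * a j), (fun j => K^-1 ^+ 2 * b j).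
split.
- by split=> [j|]; rewrite ?divr_gt0// -mulr_suml divff// gt_eqF.
- move=> j; rewrite normrM ger0_norm ?invr_ge0 ?(ltW K0)// mulrC ler_pdivrMr// mul1r.
  by case: (abK j).
- move=> j; rewrite normrM ger0_norm ?exprn_ge0 ?invr_ge0 ?(ltW K0)//.
  rewrite exprVn mulrC ler_pdivrMr ?exprn_gt0// mul1r.
  have [_ h1] := abK j; apply: (le_trans h1).
  by rewrite expr2 ler_peMl// ltW.
- by exists j0; rewrite mulf_neq0// invr_eq0 gt_eqF.
move=> al hal; transitivity (K^-1 ^+ al / C * \sum_j c j ^+ 2 * heat_coef al (a j) (b j)).
  by rewrite mulr_sumr; apply: eq_bigr => j _; rewrite heat_coefZ; ring.
by rewrite -rbar_polyE h// mulr0.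
Qed.

Section hellinger_bound.
Context (R : realType) (d : nat).
Local Notation mu := (lebesgue_tuple R d).

(** [(p - q) ^+ 2] is the left side times the square of the sum of the roots, which is at least
    [q]. *)
Lemma sqr_sub_sqrt_le (p q : R) : 0 <= p -> 0 < q ->
  (Num.sqrt p - Num.sqrt q) ^+ 2 <= (p - q) ^+ 2 / q.
Proof.
move=> p0 q0; rewrite ler_pdivlMr//.
have sq0 : 0 < Num.sqrt q by rewrite sqrtr_gt0.
have sp0 : 0 <= Num.sqrt p by rewrite sqrtr_ge0.
have pE : p = Num.sqrt p ^+ 2 by rewrite sqr_sqrtr.
have qE : q = Num.sqrt q ^+ 2 by rewrite sqr_sqrtr// ltW.
rewrite [X in _ <= (X - _) ^+ 2]pE {2 3}qE.
set x := Num.sqrt p in sp0 *; set y := Num.sqrt q in sq0 *.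
rewrite subr_sqr [leRHS]exprMn ler_wpM2l ?sqr_ge0//.
by rewrite lerXn2r ?nnegrE ?addr_ge0 ?(ltW sq0)// lerDr.
Qed.

Lemma mix_density_ge0 (G : mixing R d) x : spd_mixing G -> 0 <= mix_density G x.
Proof.
move=> sG; apply: sumr_ge0 => i _; rewrite mulr_ge0 ?(ltW (weight_gt0 _))//.
by rewrite ltW// gauss_density_gt0.
Qed.

Lemma mix_density_ge_atom (G : mixing R d) x i : spd_mixing G ->
  weight G i * gauss_density (mean G i) (cov G i) x <= mix_density G x.
Proof.
move=> sG; rewrite /mix_density (bigD1 i)//= lerDl sumr_ge0// => j _.
by rewrite mulr_ge0 ?(ltW (weight_gt0 _))// ltW// gauss_density_gt0.
Qed.

Lemma measurable_mix (G : mixing R d) :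
  measurable_fun setT (fun t : d.-tuple (measurableTypeR R) => mix_density G (tcol t)).
Proof.
apply: measurable_sum => i; apply: measurable_funM => //.
exact: measurable_gauss.
Qed.

Lemma hellinger_ge0 (p q : 'cV[R]_d -> R) : 0 <= hellinger p q.
Proof. exact: sqrtr_ge0. Qed.

(* The chi-square bound [(sqrt p - sqrt q)^2 <= (p - q)^2 / q]; [exp (l^2 / 4)]
   is integrable against the Gaussian since the variance of [l] is 1. *)
Lemma hellinger_le (G G0 : mixing R d) (i : 'I_(natoms G0)) (u : 'cV[R]_d) (B : R) :
  spd_mixing G -> spd_mixing G0 -> quad (cov G0 i) u = 1 -> 0 <= B ->
  (forall x, `|mix_density G x - mix_density G0 x| <=
     weight G0 i * gauss_density (mean G0 i) (cov G0 i) x *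
     (B * expR (dotv u (x - mean G0 i) ^+ 2 / 8))) ->
  hellinger (mix_density G) (mix_density G0) <= 2 * B.
Proof.
move=> sG sG0 u1 B0 h.
set w := weight G0 i in h; have w0 : 0 < w by exact: weight_gt0.
have w1 : w <= 1.
  rewrite -(weight_sum1 G0) (bigD1 i)//= lerDl sumr_ge0// => j _.
  by rewrite ltW// weight_gt0.
set f := gauss_density (mean G0 i) (cov G0 i) in h.
have f0 x : 0 < f x by exact: gauss_density_gt0.
(* Taking [s = 1] doubles the variance of [l]; the density ratio is then [exp (l^2 / 4) / sqrt 2],
   so the dominating function is a multiple of a Gaussian density. *)
pose th' := mean G0 i + 0 *: (cov G0 i *m u).
pose S' := rank_one_upd (cov G0 i) u 1.
have m11 : -1 < 1 :> R by lra.
have spdS' : spd_mx S' by exact: spd_rank_one.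
have g2 x : gauss_density th' S' x * expR (ln 2 / 2) =
    f x * expR (dotv u (x - mean G0 i) ^+ 2 / 4).
  rewrite gauss_density_rank_one//.
  rewrite -/f -!mulrA; congr (_ * _); rewrite /gker /= mul1r subr0.
  by rewrite -!expRD; congr expR; rewrite -[1 + 1]/2; field.
have bound x : (Num.sqrt (mix_density G x) - Num.sqrt (mix_density G0 x)) ^+ 2 <=
    w * B ^+ 2 * expR (ln 2 / 2) * gauss_density th' S' x.
  have wf0 : 0 < w * f x by rewrite mulr_gt0.
  have q0 : 0 < mix_density G0 x.
    by apply: lt_le_trans wf0 _; exact: mix_density_ge_atom.
  apply: le_trans (sqr_sub_sqrt_le (mix_density_ge0 _ sG) q0) _.
  apply: (@le_trans _ _ ((mix_density G x - mix_density G0 x) ^+ 2 / (w * f x))).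
    rewrite ler_wpM2l ?sqr_ge0// lef_pV2 ?posrE//.
    exact: mix_density_ge_atom.
  rewrite ler_pdivrMr// -[leLHS]real_normK ?num_real//.
  apply: (@le_trans _ _ ((w * f x * (B * expR (dotv u (x - mean G0 i) ^+ 2 / 8))) ^+ 2)).
    rewrite lerXn2r ?nnegrE// mulr_ge0 ?(ltW wf0)// mulr_ge0// expR_ge0.
  have -> : w * B ^+ 2 * expR (ln 2 / 2) * gauss_density th' S' x =
      w * B ^+ 2 * (gauss_density th' S' x * expR (ln 2 / 2)) by ring.
  rewrite g2.
  have -> : expR (dotv u (x - mean G0 i) ^+ 2 / 4) =
      expR (dotv u (x - mean G0 i) ^+ 2 / 8) ^+ 2.
    by rewrite -expRM_natl; congr expR; field.
  by rewrite le_eqVlt; apply/orP; left; apply/eqP; ring.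
have mf : measurable_fun setT (fun t : d.-tuple (measurableTypeR R) =>
    (Num.sqrt (mix_density G (tcol t)) - Num.sqrt (mix_density G0 (tcol t))) ^+ 2).
  have ms : measurable_fun setT (@Num.sqrt R).
    by apply: continuous_measurable_fun; exact: sqrt_continuous.
  apply: measurable_funX; apply: measurable_funB.
    by apply: (measurableT_comp ms); exact: measurable_mix.
  by apply: (measurableT_comp ms); exact: measurable_mix.
have ib := integrable_gauss th' spdS'.
pose K := w * B ^+ 2 * expR (ln 2 / 2).
have K0 : 0 <= K by rewrite mulr_ge0 ?expR_ge0// mulr_ge0 ?exprn_ge0// ltW.
have ibK : mu.-integrable setT (EFin \o (fun t => K * gauss_density th' S' (tcol t))).
  rewrite (_ : _ \o _ = fun t => (K%:E * (gauss_density th' S' (tcol t))%:E)%E).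
    by apply: integrableZl.
  by apply/funext => t; rewrite /= EFinM.
have ie : mu.-integrable setT (EFin \o (fun t : d.-tuple (measurableTypeR R) =>
    (Num.sqrt (mix_density G (tcol t)) - Num.sqrt (mix_density G0 (tcol t))) ^+ 2)).
  apply: le_integrable ibK => //; first exact/measurable_EFinP.
  move=> t _ /=; have Kg : 0 <= K * gauss_density th' S' (tcol t).
    by rewrite mulr_ge0// ltW// gauss_density_gt0.
  by rewrite lee_fin (ger0_norm (sqr_ge0 _)) (ger0_norm Kg); exact: bound.
have : \int[mu]_t (Num.sqrt (mix_density G (\col_i tnth t i)) -
    Num.sqrt (mix_density G0 (\col_i tnth t i))) ^+ 2 <= K.
  apply: le_trans (_ : \int[mu]_t (K * gauss_density th' S' (tcol t)) <= _).
    by apply: le_Rintegral => // t _; exact: bound.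
  rewrite RintegralZl//.
  by rewrite /Rintegral integral_gauss// mulr1.
move=> hI.
have e2 : expR (ln 2 / 2) <= 2 :> R.
  rewrite -[leRHS](@lnK R) ?posrE// ler_expR.
  by have : 0 <= ln (2 : R); [rewrite ln_ge0// ler1n|lra].
have B20 : 0 <= 2 * B by rewrite mulr_ge0.
rewrite /hellinger -[leRHS](ger0_norm B20) -sqrtr_sqr; apply: ler_wsqrtr.
have : K <= 2 * B ^+ 2.
  rewrite /K mulrC ler_pM ?expR_ge0 ?mulr_ge0 ?exprn_ge0 ?(ltW w0)//.
  by rewrite ler_piMl ?exprn_ge0.
have := sqr_ge0 B; rewrite exprMn; lra.
Qed.

End hellinger_bound.

Section perturbation.
Context (R : realType) (d m r : nat) (G0 : mixing R d) (i0 : 'I_(natoms G0)).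
Context (u : 'cV[R]_d) (w a b : 'I_m -> R).
Hypotheses (d0 : (0 < d)%N) (r0 : (0 < r)%N) (spd0 : spd_mixing G0).
Hypothesis u1 : quad (cov G0 i0) u = 1.
Hypotheses (w0 : forall j, 0 < w j) (w1 : \sum_j w j = 1).
Hypotheses (a1 : forall j, `|a j| <= 1) (b1 : forall j, `|b j| <= 1).
Hypothesis a0 : exists j, a j != 0.
Hypothesis hsol : forall al, (1 <= al < r)%N -> \sum_j w j * heat_coef al (a j) (b j) = 0.

Let S := cov G0 i0.
Let wv : 'cV[R]_d := S *m u.
Let p0 := weight G0 i0.

Definition perturbed_atom (t : R) (j : 'I_m) : 'cV[R]_d * 'M[R]_d :=
  (mean G0 i0 + (a j * t) *: wv, rank_one_upd S u (2 * b j * t ^+ 2)).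

Let small_var (t : R) j : 0 <= t <= 4^-1 -> `|2 * b j * t ^+ 2| <= 8^-1.
Proof.
move=> /andP[t0 t4]; rewrite normrM normrM [ `|2| ]ger0_norm// (ger0_norm (sqr_ge0 t)).
have : t ^+ 2 <= 16^-1 by nra.
have := b1 j; have := normr_ge0 (b j); have := sqr_ge0 t; nra.
Qed.

(** Order 0 cancels [gker 0 0 1 l] since the weights sum to 1, and the orders from 1 to [r.-1]
    cancel by [hsol]. The bound [t <= 1/4] keeps the variances within [[7/8, 9/8]], as
    [gker_std_bound] requires. *)
Let mixture_expansion : exists2 C : R, 0 <= C & forall t l : R, 0 <= t <= 4^-1 ->
  `|\sum_j w j * gker 0 (a j * t) (1 + 2 * b j * t ^+ 2) l - gker 0 0 1 l| <=
    C * t ^+ r * expR (- (3 / 8 * l ^+ 2)).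
Proof.
have [C C0 hC] := @gker_std_bound R (2 * r).
exists (3 ^+ r * C); first by rewrite mulr_ge0 ?exprn_ge0.
move=> t l t4; have /andP[t0 tle] := t4.
pose B := C * expR (- (3 / 8 * l ^+ 2)).
have T1 : t <= 1 by lra.
have small s j : 0 <= s <= t -> 7 / 8 <= 1 + 2 * b j * s ^+ 2 <= 9 / 8.
  move=> /andP[s0 st]; have := @small_var s j; rewrite s0 (le_trans st tle) => /(_ isT).
  by rewrite ler_norml => /andP[h1 h2]; apply/andP; split; lra.
have tay j : `|gremainder 0 1 l (a j) (b j) 0 r t| <= 3 ^+ r * B * t ^+ r.
  apply: (gpath_taylor (T := t) (M := 2 * r)) => //.
  - by move=> s /small -/(_ j)/andP[h _]; apply: lt_le_trans h; lra.
  - move=> n s nM sT; apply: hC => //; last exact: small.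
    rewrite add0r normrM -[leRHS]mulr1 ler_pM//.
    by case/andP: sT => s0 st; rewrite ger0_norm//; lra.
  - by rewrite t0 lexx.
have -> : \sum_j w j * gker 0 (a j * t) (1 + 2 * b j * t ^+ 2) l - gker 0 0 1 l =
    \sum_j w j * gremainder 0 1 l (a j) (b j) 0 r t.
  rewrite /gremainder; under [RHS]eq_bigr do rewrite mulrBr.
  rewrite sumrB; congr (_ - _).
    by apply: eq_bigr => j _; rewrite /gpath add0r.
  under eq_bigr do rewrite mulr_sumr.
  rewrite exchange_big /=.
  have term (k : nat) : \sum_j w j * (t ^+ k * (heat_coef k (a j) (b j) *
      gpath 0 1 l (a j) (b j) (0 + k) 0)) =
      t ^+ k * gker k 0 1 l * \sum_j w j * heat_coef k (a j) (b j).
    rewrite mulr_sumr; apply: eq_bigr => j _.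
    by rewrite /gpath mulr0 expr0n /= mulr0 !addr0 add0n; ring.
  under eq_bigr do rewrite term.
  case: r r0 hsol => // r' _ h; rewrite big_ord_recl [X in _ = _ + X]big1 ?addr0 => [|k _].
    under eq_bigr do rewrite heat_coef0 mulr1.
    by rewrite w1 expr0 mulr1 mul1r.
  by rewrite h ?mulr0// lift0 /= ltnS.
apply: le_trans (ler_norm_sum _ _ _) _.
apply: (@le_trans _ _ (\sum_j w j * (3 ^+ r * B * t ^+ r))).
  by apply: ler_sum => j _; rewrite normrM (ger0_norm (ltW (w0 j))) ler_wpM2l// ltW.
rewrite -mulr_suml w1 mul1r /B le_eqVlt; apply/orP; left; apply/eqP; ring.
Qed.

Let wv_gt0 : 0 < enorm wv.
Proof.
rewrite lt_def enorm_ge0 andbT; apply/eqP => h.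
have := dotv_le_enorm u wv; rewrite h mulr0 -dotv_quad u1 normr1.
by rewrite ler10.
Qed.

(** The lower bound on [W_1] comes from one perturbed atom with [a js != 0]: it carries mass at
    least [p0 * w js] and lies at distance of order [t] from every atom of [G0]. The upper bound
    moves the perturbed atoms back to [i0]. *)
Lemma perturbation : exists t0 Ch cw Cw : R, [/\ 0 < t0, 0 < Ch, 0 < cw, 0 < Cw &
  forall t, 0 < t <= t0 -> exists G : mixing R d, [/\
    (natoms G <= m + (natoms G0).-1)%N,
    forall l, (exists i, atom G l = atom G0 i) \/ (exists j, atom G l = perturbed_atom t j),
    cw * t <= wasserstein 1 G G0 <= Cw * t &
    hellinger (mix_density G) (mix_density G0) <= Ch * t ^+ r]].
Proof.
have [C C0 hC] := mixture_expansion.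
have p00 : 0 < p0 by exact: weight_gt0.
have p01 : p0 <= 1.
  rewrite -(weight_sum1 G0) (bigD1 i0)//= lerDl sumr_ge0// => j _.
  by rewrite ltW// weight_gt0.
pose E1 := enorm wv; pose E2 := enorm (wv *m wv^T).
have E20 : 0 <= E2 by exact: enorm_ge0.
have [js ajs] := a0.
have gapP i : i != i0 -> 0 < l1dist (atom G0 i0) (atom G0 i).
  move=> ii; rewrite lt_def l1dist_ge0 andbT; apply/eqP => /l1dist_eq0 /atom_inj e.
  by move: ii; rewrite e eqxx.
have [gap gap0 hgap] := finite_lower_bound gapP.
pose K1 : R := d%:R + d%:R * d%:R.
have K10 : 0 < K1 by rewrite ltr_pwDl ?ltr0n// mulr_ge0.
pose Cw := E1 + 2 * E2.
have Cw0 : 0 < Cw by rewrite ltr_pwDl// mulr_ge0.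
(* The second bound keeps perturbed atoms at distance at least [t] from the atoms of [G0] other than
   [i0]; the summand 1 in [Cw + 1] provides that [t]. *)
pose t0 := Num.min 4^-1 (gap / (K1 * (Cw + 1))).
have KC0 : 0 < K1 * (Cw + 1) by rewrite mulr_gt0// ltr_wpDl// ltW.
have t00 : 0 < t0 by rewrite lt_min invr_gt0 ltr0n divr_gt0.
pose c1 := Num.min (`|a js| * E1) 1.
have c10 : 0 < c1 by rewrite lt_min ltr01 andbT mulr_gt0// normr_gt0.
exists t0, (2 * C + 1), (p0 * w js * c1), Cw; split=> //.
- by rewrite ltr_wpDl// mulr_ge0.
- by rewrite !mulr_gt0.
move=> t /andP[t_gt0 tle].
have t4 : t <= 4^-1 by apply: (le_trans tle); rewrite ge_min lexx.
have t_ge0 : 0 <= t by exact: ltW.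
have t04 : 0 <= t <= 4^-1 by rewrite t_ge0.
have tgap : K1 * (Cw + 1) * t <= gap.
  by rewrite mulrC -ler_pdivlMr//; apply: (le_trans tle); rewrite ge_min lexx orbT.
pose n0 := (natoms G0).-1.
pose I := ('I_m + 'I_n0)%type.
pose wt (z : I) : R := match z with inl j => p0 * w j | inr l => weight G0 (lift i0 l) end.
pose pt (z : I) := match z with
  inl j => perturbed_atom t j | inr l => atom G0 (lift i0 l) end.
pose tgt (z : I) : 'I_(natoms G0) := match z with inl j => i0 | inr l => lift i0 l end.
have wt0 z : 0 < wt z.
  by case: z => [j|l] /=; [rewrite mulr_gt0|exact: weight_gt0].
have sumI (F : I -> R) : \sum_z F z = \sum_j F (inl j) + \sum_l F (inr l).
  by rewrite big_sumType.
have sum0 (F : 'I_(natoms G0) -> R) : \sum_i F i = F i0 + \sum_(l < n0) F (lift i0 l).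
  by rewrite (bigD1_ord i0).
have wt1 : \sum_z wt z = 1.
  by rewrite sumI /= -mulr_sumr w1 mulr1 -(sum0 (weight G0)) weight_sum1.
have [G [h [nG hsurj hpt hw]]] := merge_atoms pt wt0 wt1.
have hmc z : mean G (h z) = (pt z).1 /\ cov G (h z) = (pt z).2.
  by have := hpt z; rewrite /atom => <-.
have svar j : -1 < 2 * b j * t ^+ 2.
  by have := small_var j t04; rewrite ler_norml => /andP[h1 _]; lra.
have spdG : spd_mixing G.
  move=> l; have [z <-] := hsurj l; have [_ ->] := hmc z.
  by case: z => [j|l'] /=; [apply: spd_rank_one; [exact: spd0|exact: u1|exact: svar]|exact: spd0].
have sum_atoms (F : 'I_(natoms G) -> R) : \sum_l weight G l * F l = \sum_z wt z * F (h z).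
  rewrite [RHS](partition_big h xpredT)//=; apply: eq_bigr => l _.
  by rewrite hw mulr_suml; apply: eq_bigr => z /eqP ->.
exists G; split.
- by apply: (leq_trans nG); rewrite card_sum !card_ord.
- move=> l; have [z <-] := hsurj l; rewrite hpt.
  by case: z => [j|l'] /=; [right; exists j|left; exists (lift i0 l')].
- have dist_inl j : atom_dist (G := G) (G0 := G0) (h (inl j)) i0 =
      `|a j| * t * E1 + `|2 * b j * t ^+ 2| * E2.
    have [mE cE] := hmc (inl j); rewrite /atom_dist mE cE /= /rank_one_upd -/S.
    rewrite [X in enorm X + _](_ : _ = (a j * t) *: wv); last by rewrite addrC addKr.
    rewrite [X in _ + enorm X](_ : _ = (2 * b j * t ^+ 2) *: (wv *m wv^T)); last first.
      by rewrite addrC addKr.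
    by rewrite !enormZ normrM (ger0_norm t_ge0).
  have dist_inr l : atom_dist (G := G) (G0 := G0) (h (inr l)) (lift i0 l) = 0.
    have [mE cE] := hmc (inr l); rewrite /atom_dist mE cE /= !subrr.
    have e0 p q : enorm (0 : 'M[R]_(p, q)) = 0.
      by rewrite -(scale0r (0 : 'M[R]_(p, q))) enormZ normr0 mul0r.
    by rewrite !e0 addr0.
  have dist_le j : atom_dist (G := G) (G0 := G0) (h (inl j)) i0 <= Cw * t.
    rewrite dist_inl [leRHS](mulrDl E1); apply: lerD.
      by rewrite (mulrC E1) ler_wpM2r ?enorm_ge0// ler_piMl.
    rewrite [leRHS]mulrAC ler_wpM2r//.
    rewrite normrM normrM [ `|2| ]ger0_norm// (ger0_norm (sqr_ge0 t)) -mulrA ler_wpM2l//.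
    by rewrite expr2 mulrA ler_piMl// mulr_ile1//; lra.
  apply/andP; split.
    pose ls := h (inl js).
    have wls : p0 * w js <= weight G ls.
      rewrite hw (bigD1 (inl js))//= lerDl sumr_ge0// => z _; exact: ltW.
    have far i : c1 * t <= atom_dist (G := G) (G0 := G0) ls i.
      have [->|ii] := eqVneq i i0.
        rewrite /ls dist_inl; apply: (@le_trans _ _ (`|a js| * t * E1)).
          by rewrite mulrAC ler_wpM2r// ge_min lexx.
        by rewrite lerDl mulr_ge0.
      apply: (@le_trans _ _ t); first by rewrite ler_piMl// ge_min lexx orbT.
      have := le_trans (hgap i ii) (l1dist_triangle _ _ (atom G ls)).
      have h1 : l1dist (atom G ls) (atom G0 i0) <= K1 * (Cw * t).
        apply: le_trans (l1dist_le _ _) _; rewrite ler_wpM2l ?(ltW K10)//.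
        exact: dist_le.
      have h2 := l1dist_le (atom G ls) (atom G0 i); rewrite -/K1 in h2.
      move=> h3; have : K1 * t <= K1 * atom_dist (G := G) (G0 := G0) ls i.
        rewrite /atom_dist; move: h1 h2 h3 tgap; rewrite /=.
        by set X := enorm _ + enorm _; lra.
      by rewrite ler_pM2l.
    have := @wasserstein_ge_left R d G G0 1 (c1 * t) ls isT _ far.
    rewrite !expr1 => H; apply: le_trans (H _); last by rewrite mulr_ge0// ltW.
    by rewrite -mulrA ler_wpM2r// mulr_ge0// ltW.
  pose q : 'M[R]_(natoms G, natoms G0) :=
    \matrix_(l, i) \sum_(z | (h z == l) && (tgt z == i)) wt z.
  have cq : coupling G G0 q.
    split.
    + by move=> l i; rewrite mxE sumr_ge0// => z _; exact: ltW.
    + move=> l; under eq_bigr do rewrite mxE.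
      by rewrite hw [RHS](partition_big tgt xpredT).
    + move=> i; under eq_bigr do rewrite mxE.
      transitivity (\sum_(z | tgt z == i) wt z).
        rewrite [RHS](partition_big h xpredT)//=; apply: eq_bigr => l _.
        by apply: eq_bigl => z; rewrite andbC.
      rewrite big_mkcond sumI /=.
      transitivity (\sum_k if k == i then weight G0 k else 0); last first.
        by rewrite -big_mkcond big_pred1_eq.
      rewrite sum0; congr (_ + _).
      by case: eqP => _; [rewrite -mulr_sumr w1 mulr1|rewrite big1].
  have := wasserstein_le_cost (isT : (0 < 1)%N) cq; rewrite expr1.
  move=> H; apply: (le_trans H).
  have -> : \sum_l \sum_i q l i * atom_dist (G := G) (G0 := G0) l i ^+ 1 =
      \sum_z wt z * atom_dist (G := G) (G0 := G0) (h z) (tgt z).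
    rewrite [RHS](partition_big h xpredT)//=; apply: eq_bigr => l _.
    rewrite [RHS](partition_big tgt xpredT)//=; apply: eq_bigr => i _.
    by rewrite mxE expr1 mulr_suml; apply: eq_bigr => z /andP[/eqP-> /eqP->].
  rewrite sumI /= [X in _ + X]big1 ?addr0 => [|l _]; last by rewrite dist_inr mulr0.
  apply: (@le_trans _ _ (\sum_j p0 * w j * (Cw * t))).
    by apply: ler_sum => j _; rewrite ler_wpM2l// mulr_ge0 ?ltW.
  by rewrite -mulr_suml -mulr_sumr w1 mulr1 ler_piMl// mulr_ge0// ltW.
have -> : (2 * C + 1) * t ^+ r = 2 * (C * t ^+ r) + t ^+ r by ring.
apply: ler_wpDr; first exact: exprn_ge0.
apply: (hellinger_le spdG spd0 u1); first by rewrite mulr_ge0 ?exprn_ge0.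
move=> x; set l := dotv u (x - mean G0 i0).
set f := gauss_density (mean G0 i0) (cov G0 i0) x.
have f0 : 0 < f by exact: gauss_density_gt0.
(* Unperturbed atoms cancel, and [gauss_density_rank_one] factors the density of the atom [i0] out
   of the rest. *)
have -> : mix_density G x - mix_density G0 x = p0 * f * (expR (l ^+ 2 / 2) *
    (\sum_j w j * gker 0 (a j * t) (1 + 2 * b j * t ^+ 2) l - gker 0 0 1 l)).
  have k1 : expR (l ^+ 2 / 2) * gker 0 0 1 l = 1.
    by rewrite /gker /= mul1r ln1 subr0 -expRD -[RHS]expR0; congr expR; field.
  rewrite mulrBr k1 /mix_density.
  rewrite (sum_atoms (fun l => gauss_density (mean G l) (cov G l) x)) sumI sum0 /=.
  rewrite [in X in _ + X - _](eq_bigr (fun l =>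
    weight G0 (lift i0 l) * gauss_density (mean G0 (lift i0 l)) (cov G0 (lift i0 l)) x)).
    rewrite [in X in X + _ - _](eq_bigr (fun j => p0 * f * (expR (l ^+ 2 / 2) *
        (w j * gker 0 (a j * t) (1 + 2 * b j * t ^+ 2) l)))).
      by rewrite -!mulr_sumr -/p0 -/f; ring.
    move=> j _; have [-> ->] := hmc (inl j).
    rewrite [pt _]/(perturbed_atom t j) /= (gauss_density_rank_one (spd0 i0) u1)// -/l -/f; ring.
  by move=> l' _; have [-> ->] := hmc (inr l').
have pf0 : 0 <= p0 * f := ltW (mulr_gt0 p00 f0).
rewrite normrM (ger0_norm pf0) ler_wpM2l//.
rewrite normrM ger0_norm ?expR_ge0//.
apply: le_trans (ler_wpM2l (expR_ge0 _) (hC t l t04)) _.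
(* [1/2 - 3/8 = 1/8] is the exponent that [hellinger_le] allows. *)
rewrite mulrCA -expRD ler_wpM2l ?mulr_ge0 ?exprn_ge0// ler_expR; lra.
Qed.

End perturbation.

Section vanishing_ratio.
Context (R : realType) (d k rbar : nat) (Theta : set 'cV[R]_d) (Omega : set 'M[R]_d).
Context (G0 : mixing R d).
Hypotheses (d0 : (0 < d)%N) (hOmega : Omega `<=` @spd_mx R d).
Hypotheses (hG0 : supported_in Theta Omega G0) (k0 : (0 < natoms G0 < k)%N).
Hypothesis hG0_int : forall i, interior_prod Theta Omega (atom G0 i).
Hypothesis hrbar : is_rbar R (k - natoms G0) rbar.

Lemma spd_supported (G : mixing R d) : supported_in Theta Omega G -> spd_mixing G.
Proof. by move=> h i; apply: hOmega; have [] := h i. Qed.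

(** The interior is relative to the symmetric matrices: the path is continuous at 0, and it stays
    symmetric because each update is a multiple of an outer square. *)
Lemma perturbed_atom_supported m (i0 : 'I_(natoms G0)) (u : 'cV[R]_d) (a b : 'I_m -> R) :
  exists2 t1 : R, 0 < t1 & forall t, 0 <= t < t1 -> forall j,
    (Theta `*` Omega) (perturbed_atom i0 u a b t j).
Proof.
have symS : (cov G0 i0)^T = cov G0 i0 by case: (spd_supported hG0 i0).
set S := cov G0 i0 in symS.
have := hG0_int i0; rewrite /interior_prod /interior /=.
rewrite /nbhs /= -nbhs_subspace_in; last by split.
rewrite /within /= => near_atom.
have path_cvg j : perturbed_atom i0 u a b t j @[t --> (0 : R)] --> atom G0 i0.
  have a_cvg : (a j * t) @[t --> (0 : R)] --> (0 : R).
    by rewrite -[X in _ --> X](mulr0 (a j)); apply: cvgMl_tmp; exact: cvg_id.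
  have b_cvg : (2 * b j * t ^+ 2) @[t --> (0 : R)] --> (0 : R).
    rewrite -[X in _ --> X](mulr0 (2 * b j)); apply: cvgMl_tmp.
    by have := @exprn_continuous R 2 0; rewrite /continuous_at expr0n.
  apply: (@cvg_pair _ _ _ (nbhs (0 : R)) (nbhs (mean G0 i0)) (nbhs S)) => /=.
    rewrite -[X in _ --> nbhs X]addr0; apply: cvgD; first exact: cvg_cst.
    by rewrite -[X in _ --> X](scale0r (S *m u)); apply: cvgZr_tmp.
  rewrite -[X in _ --> nbhs X]addr0; apply: cvgD; first exact: cvg_cst.
  by rewrite -[X in _ --> X](scale0r ((S *m u) *m (S *m u)^T)); apply: cvgZr_tmp.
pose P j (t : R) := ([set: 'cV[R]_d] `*` @sym_mx R d) (perturbed_atom i0 u a b t j) ->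
  (Theta `*` Omega) (perturbed_atom i0 u a b t j).
have near0 : \forall t \near (0 : R), forall j, P j t.
  by apply: (@filter_forall R _ P (nbhs (0 : R)) _) => j; exact: path_cvg near_atom.
have /nbhs_ballP[e /= e0 he] := near0.
exists e => // t /andP[t0 te] j; apply: (he t).
  by rewrite /ball /= sub0r normrN ger0_norm.
split=> //=; rewrite /sym_mx /= /rank_one_upd linearD linearZ /= trmx_mul trmxK.
by rewrite symS.
Qed.

(** The infimum is 0 for each single [eps]: along the perturbation the ratio is at most a constant
    times [t] to the power [rbar - r], and [t] may be arbitrarily small. *)
Lemma ereal_inf_hellinger_ratio (r eps : R) : 0 < r -> r < rbar%:R -> 0 < eps ->
  ereal_inf [set hellinger_ratio r G G0 | G in
    [set G | mix_atmost k Theta Omega G /\ wasserstein 1 G G0 <= eps]] = 0%E.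
Proof.
move=> r0 r_lt eps0; have /andP[G0_gt0 ltk] := k0.
have spd0 := spd_supported hG0.
apply/le_anti/andP; split; last first.
  apply: le_ereal_inf_tmp => _ [G _ <-]; rewrite /hellinger_ratio.
  case: ifP => _; first by rewrite leey.
  by rewrite lee_fin divr_ge0 ?hellinger_ge0 ?powR_ge0.
pose m := (k - natoms G0).+1.
have r4 : (3 < rbar)%N by apply: (is_rbar_ge4 _ hrbar); rewrite subn_gt0.
have rbar0 : (0 < rbar)%N by exact: leq_trans r4.
(* By minimality of [rbar] the order [rbar.-1] still has a nontrivial solution; minimality concerns
   positive orders only, hence the use of [r4]. *)
have sol : has_nontrivial_solution R m rbar.-1.
  apply: contrapT => nosol; have [_ _ rmin] := hrbar.
  have rp : (0 < rbar.-1)%N by rewrite -ltnS prednK// (leq_trans _ r4).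
  by have := rmin _ rp nosol; rewrite leqNgt prednK// leqnn.
have [w [a [b [[w0 w1] a1 b1 a0 hsol]]]] := scaled_solution sol.
pose i0 := Ordinal G0_gt0.
pose v : 'cV[R]_d := const_mx 1.
have v0 : v != 0.
  apply/eqP => /matrixP/(_ (Ordinal d0) ord0); rewrite !mxE => /eqP.
  by rewrite oner_eq0.
have u1 := quad_normalize (spd0 i0) v0; set u := _ *: v in u1.
have hsol' al : (1 <= al < rbar)%N -> \sum_j w j * heat_coef al (a j) (b j) = 0.
  by move=> /andP[h1 h2]; apply: hsol; rewrite h1 -ltnS prednK.
have [t0 [Ch [cw [Cw [t00 Ch0 cw0 Cw0 hG]]]]] :=
  perturbation d0 rbar0 spd0 u1 w0 w1 a1 b1 a0 hsol'.
have [t1 t10 ht1] := perturbed_atom_supported i0 u a b.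
apply/lee_addgt0Pr => eta eta0; rewrite add0e.
pose s := rbar%:R - r; have s0 : 0 < s by rewrite subr_gt0.
pose C := Ch / cw `^ r.
have C0 : 0 < C by rewrite divr_gt0// powR_gt0.
have eC0 : 0 < eta / C by exact: divr_gt0.
(* In turn: validity of the perturbation, support in the parameter set, [W_1] at most [eps], and
   ratio at most [eta]. *)
pose t := Num.min (Num.min t0 (t1 / 2)) (Num.min (eps / Cw) ((eta / C) `^ s^-1)).
have t_gt0 : 0 < t by rewrite !lt_min t00 !divr_gt0//= powR_gt0.
have tt0 : t <= t0 by rewrite /t !ge_min lexx.
have tt1 : t < t1.
  apply: (@le_lt_trans _ _ (t1 / 2)); first by rewrite /t !ge_min lexx !orbT.
  by rewrite ltr_pdivrMr// ltr_pMr// ltr1n.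
have teps : Cw * t <= eps.
  by rewrite mulrC -ler_pdivlMr// /t !ge_min lexx !orbT.
have teta : t `^ s <= eta / C.
  have te : t <= (eta / C) `^ s^-1 by rewrite /t !ge_min lexx !orbT.
  apply: (@le_trans _ _ (((eta / C) `^ s^-1) `^ s)).
    by apply: ge0_ler_powR; rewrite ?nnegrE ?powR_ge0// ltW.
  by rewrite -powRrM mulVf ?gt_eqF// powRr1// ltW.
have [|G [nG suppG /andP[Wge Wle] hG']] := hG t; first by rewrite t_gt0.
have W0 : 0 < wasserstein 1 G G0 by apply: lt_le_trans Wge; exact: mulr_gt0.
apply: (@le_trans _ _ (hellinger_ratio r G G0)).
  apply: ereal_inf_lbound; exists G => //; split; last exact: le_trans Wle teps.
  split.
    apply: (leq_trans nG); rewrite /m addSn -addnS prednK//.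
    by rewrite subnK// ltnW.
  move=> l; case: (suppG l) => [[i ->]|[j ->]]; first exact: hG0.
  by apply: ht1; rewrite ltW.
have Wr0 : 0 < wasserstein 1 G G0 `^ r by apply: powR_gt0; exact: W0.
rewrite /hellinger_ratio (gt_eqF W0) lee_fin ler_pdivrMr; last exact: Wr0.
apply: (le_trans hG'); apply: (@le_trans _ _ (eta * (cw * t) `^ r)); last first.
  rewrite ler_wpM2l ?(ltW eta0)//; apply: ge0_ler_powR; rewrite ?nnegrE//; try exact: ltW.
  by rewrite mulr_ge0// ltW.
rewrite powRM ?(ltW cw0) ?(ltW t_gt0)// -powR_mulrn ?(ltW t_gt0)//.
have -> : rbar%:R = s + r by rewrite subrK.
rewrite powRD; last by rewrite (gt_eqF t_gt0) implybT.
rewrite !mulrA ler_wpM2r ?powR_ge0//.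
move: teta; rewrite ler_pdivlMr// => teta.
have -> : Ch = C * cw `^ r by rewrite divfK// gt_eqF// powR_gt0.
by rewrite mulrAC ler_wpM2r ?powR_ge0// mulrC.
Qed.

End vanishing_ratio.

Theorem theorem4p1 (R : realType) (d : nat) (hd : (1 <= d)%N)
    (Theta : set 'cV[R]_d) (Omega : set 'M[R]_d)
    (hTheta : bounded_set Theta)
    (hOmega : Omega `<=` @spd_mx R d)
    (hOmega_bd : eigenvalues_bounded_above Omega)
    (k0 k : nat) (hk0 : (1 <= k0)%N) (hk : (k0 + 1 <= k)%N)
    (G0 : mixing R d) (hG0 : mix_exact k0 Theta Omega G0)
    (hG0_int : forall i, interior_prod Theta Omega (atom G0 i))
    (rbar : nat) (hrbar : is_rbar R (k - k0) rbar) :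
  (forall r : R, 1 <= r -> r < rbar%:R ->
     ereal_inf [set hellinger_ratio r G G0 | G in
         [set G | mix_atmost k Theta Omega G /\ wasserstein 1 G G0 <= eps]]
       @[eps --> (0 : R)^'+] --> 0%E)
  /\
  (forall c0 : R, 0 < c0 ->
     exists eps0 C0 : R, [/\ 0 < eps0, 0 < C0 &
       forall G : mixing R d, mix_atmost_lb k c0 Theta Omega G ->
         wasserstein rbar%:R G G0 <= eps0 ->
         C0 * wasserstein rbar%:R G G0 ^+ rbar
           <= tvdist (mix_density G) (mix_density G0) /\
         C0 * wasserstein 1 G G0 ^+ rbar
           <= C0 * wasserstein rbar%:R G G0 ^+ rbar]).
Proof.
case: hG0 => nG0 suppG0; rewrite addn1 in hk; rewrite -nG0 in hk hk0 hrbar.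
split=> [r r1 r_lt|c0 c00].
  (* The infimum is 0 for every positive [eps], so the function is constant to the right of 0. *)
  apply: cvg_near_cst; near=> eps.
  apply: (ereal_inf_hellinger_ratio hd hOmega suppG0 _ hG0_int hrbar) => //.
  - by rewrite hk0.
  - exact: lt_le_trans r1.
have [eps0 [C0 [eps00 C00 hG]]] :=
  tvdist_lower_bound hd (spd_supported hOmega suppG0) hk hrbar c00.
exists eps0, C0; split; [exact: eps00|exact: C00|move=> G [[nG suppG] wG] hW; split].
  exact: (hG G (spd_supported hOmega suppG) nG wG hW).
by apply: ler_wpM2l; [exact: ltW|apply: wasserstein1_le; case: hrbar].
Unshelve. all: by end_near.
Qed.
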